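(* Let $\overline{M}$ be a smooth manifold of dimension $n+1$ with boundary $\partial M$ and interior $M$, and suppose that $g$ is a projectively compact Ricci flat pseudo-Riemannian metric of signature $(p,q)$ on $M$. Then the order of projective compactness is one, and the projective structure induced on the (totally geodesic) boundary $\partial M$ canonically inherits a holonomy reduction to the group $SO(p,q)\subset SL(n+1,\mathbb{R})$; that is, the standard tractor bundle of the induced projective structure on $\partial M$ carries a canonical non-degenerate bundle metric of signature $(p,q)$ which is parallel for the tractor connection of $\partial M$.
   Context: All affine connections are torsion free; smooth means $C^\infty$. For a one-form $\Upsilon$, write $\hat\nabla=\nabla+\Upsilon$ for $\hat\nabla_\xi\eta=\nabla_\xi\eta+\Upsilon(\xi)\eta+\Upsilon(\eta)\xi$; connections so related are projectively equivalent, and a projective structure is an equivalence class. A local defining function for $\partial M$ is a smooth $\rho:U\to\mathbb{R}_{\ge0}$, $U\subset\overline{M}$ open, with $\rho^{-1}(\{0\})=U\cap\partial M$ and $d\rho\neq0$ along $U\cap\partial M$. A pseudo-Riemannian metric $g$ on $M$ with Levi-Civita connection $\nabla$ is projectively compact of order $\alpha>0$ if near each boundary point there is a defining function $\rho$ such that $\nabla+\frac{d\rho}{\alpha\rho}$ extends smoothly to the boundary; it is projectively compact if this holds for some $\alpha>0$. Then the projective class of $\nabla$ extends uniquely to a projective structure on $\overline{M}$. Tractors: on a manifold $N$ of dimension $m\geq2$ with projective structure let $\mathcal{E}(w)=\mathrm{vol}(N)^{-w/(m+1)}$, where $\mathrm{vol}(N)$ is the bundle of volume densities. The cotractor bundle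 is $\mathcal{T}^*=J^1(\mathcal{E}(1))$, of rank $m+1$. A connection $\tilde\nabla$ in the class gives $\mathcal{T}^*\cong\mathcal{E}(1)\oplus T^*N\otimes\mathcal{E}(1)$, elements $\binom{\sigma}{\mu_a}$, changing to $\binom{\sigma}{\mu_a+\Upsilon_a\sigma}$ when passing to $\tilde\nabla+\Upsilon$. The tractor connection is $\nabla^{\mathcal{T}^*}_a\binom{\sigma}{\mu_b}=\binom{\tilde\nabla_a\sigma-\mu_a}{\tilde\nabla_a\mu_b+\tilde{\mathsf P}_{ab}\sigma}$, where for $\tilde\nabla$ preserving a volume density $\tilde{\mathsf P}_{ab}=\frac1{m-1}\widetilde{\mathrm{Ric}}_{ab}$. The standard tractor bundle $\mathcal{T}$ with its tractor connection is the dual. Induced projective structure on $\partial M$: for $g$ as in the claim, the boundary is totally geodesic for the extended projective structure (for $\tilde\nabla$ in the class smooth up to the boundary, $\tilde\nabla_\xi\eta$ is tangent to $\partial M$ along $\partial M$ for $\xi,\eta$ tangent to $\partial M$), and the restrictions of such $\tilde\nabla$ to $\partial M$ define the induced projective structure. The canonical reduction arises as follows. Let $\sigma=\mathrm{vol}(g)^{-1/(n+2)}\in\Gamma(\mathcal{E}(1))$, which extends by zero to $\overline{M}$, and let $L(\sigma)=\binom{\sigma}{\tilde\nabla_a\sigma}\in\Gamma(\mathcal{T}^* )$, a parallel nowhere vanishing section over $\overline M$. Over $M$, in the splitting determined by $\nabla$, the degenerate symmetric bilinear form $\left(\binom{\sigma_1}{\mu_a},\binom{\sigma_2}{\mu'_a}\right)\mapsto\sigma^{-2}g^{ab}\mu_a\mu'_b$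 on $\mathcal{T}^*$ is parallel and extends to a parallel form on $\mathcal{T}^*$ over $\overline{M}$ with null space spanned by $L(\sigma)$. The standard tractor bundle of $\partial M$ is identified with $\tilde{\mathcal{T}}=\ker L(\sigma)\subset\mathcal{T}|_{\partial M}$ and $\tilde{\mathcal{T}}^*=\mathcal{T}^*|_{\partial M}/\langle L(\sigma)\rangle$; the bundle metric on $\tilde{\mathcal{T}}$ is the inverse of the form induced on $\tilde{\mathcal{T}}^*$. *)

(* Defs.v *)
From mathcomp Require Import all_boot all_order all_algebra.
From mathcomp Require Import all_classical all_reals all_analysis.
Import numFieldNormedType.Exports.
Import Order.TTheory GRing.Theory Num.Theory.

Set Implicit Arguments.
Unset Strict Implicit.
Unset Printing Implicit Defensive.

Local Open Scope classical_set_scope.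
Local Open Scope ring_scope.

(* Geometric objects on a manifold are given by their components in the charts
   of an atlas, subject to the transformation law under changes of charts.

   Matrix conventions: a point of R^m is a row vector x and x 0 a is its a-th
   coordinate; on a manifold with boundary of dimension n+1 the coordinate
   number 0 is the nonnegative one.  Christoffel symbols are written G c a b,
   with nabla_{e_a} e_b = \sum_c (G c a b) e_c.  Cotractors are column vectors,
   densities are expressed through the coordinate density |dx| of each chart. *)

Section Calculus.
Context {R : realType} {m : nat}.

(* The partial derivatives of f at x relative to D.  For D relatively open in a
   half-space this is the usual partial derivative, except in the transversal
   direction at a boundary point, where it is one-sided. *)
Definition dquot (a : 'I_m) (f : 'rV[R]_m -> R) (x : 'rV[R]_m) (h : R) : R :=
  h^-1 * (f (x + h *: delta_mx 0 a) - f x).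

Definition punctured (D : set 'rV[R]_m) (a : 'I_m) (x : 'rV[R]_m) :=
  within [set h : R | D (x + h *: delta_mx 0 a)] (0 : R)^'.

Definition pderivable (D : set 'rV[R]_m) a f x : Prop :=
  cvg (dquot a f x @ punctured D a x).

Definition pderiv (D : set 'rV[R]_m) a f x : R :=
  lim (dquot a f x @ punctured D a x).

(* On a relatively open subset of a half-space this is smoothness up to the
   boundary: all iterated partial derivatives exist and are continuous. *)
Fixpoint Ck (k : nat) (D : set 'rV[R]_m) (f : 'rV[R]_m -> R) : Prop :=
  {within D, continuous f} /\
  if k is k'.+1 then
    forall a, (forall x, D x -> pderivable D a f x) /\ Ck k' D (pderiv D a f)
  else True.

Definition smooth (D : set 'rV[R]_m) f : Prop := forall k, Ck k D f.

End Calculus.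

(* crd i is the coordinate map of the chart i on its domain dom i, and prm i is
   its inverse. *)
Record atlas (R : realType) (m : nat) (T : Type) := Atlas {
  idx : Type;
  dom : idx -> set T;
  crd : idx -> T -> 'rV[R]_m;
  prm : idx -> 'rV[R]_m -> T }.

Section Fields.
Context {R : realType} {m : nat} {T : Type} (A : atlas R m T).

Definition img (i : idx A) : set 'rV[R]_m := crd i @` dom i.

Definition smooth_in (i : idx A) (W : set T) (f : T -> R) : Prop :=
  smooth (crd i @` (W `&` dom i)) (f \o prm i).

Definition smooth_mx r s (i : idx A) (W : set T) (F : T -> 'M[R]_(r, s)) :=
  forall a b, smooth_in i W (fun p => F p a b).

Definition smooth_fun (W : set T) (f : T -> R) : Prop :=
  forall i : idx A, smooth_in i W f.

Definition pd (i : idx A) (a : 'I_m) (f : T -> R) (p : T) : R :=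
  pderiv (img i) a (f \o prm i) (crd i p).

Definition pdmx r s (i : idx A) (a : 'I_m) (F : T -> 'M[R]_(r, s)) (p : T) :=
  \matrix_(b, c) pd i a (fun q => F q b c) p.

Definition grad (i : idx A) (f : T -> R) (p : T) : 'cV[R]_m :=
  \col_a pd i a f p.

(* (jac i j p) a b is the partial derivative of the coordinate b of the chart j
   in the direction a of the chart i. *)
Definition jac (i j : idx A) (p : T) : 'M[R]_m :=
  \matrix_(a, b) pd i a (fun q => crd j q 0 b) p.

Definition overlap (W : set T) (i j : idx A) (p : T) : Prop :=
  [/\ W p, dom i p & dom j p].

Definition vfield := idx A -> T -> 'rV[R]_m.

Definition is_vfield (W : set T) (X : vfield) : Prop :=
  (forall i, smooth_mx i W (X i)) /\
  (forall i j p, overlap W i j p -> X j p = X i p *m jac i j p).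

Definition oneform := idx A -> T -> 'cV[R]_m.

Definition is_oneform (W : set T) (w : oneform) : Prop :=
  (forall i, smooth_mx i W (w i)) /\
  (forall i j p, overlap W i j p -> w i p = jac i j p *m w j p).

Definition vdensity := idx A -> T -> R.

Definition is_vdensity (W : set T) (v : vdensity) : Prop :=
  [/\ forall i, smooth_in i W (v i),
      forall i p, W p -> dom i p -> 0 < v i p
    & forall i j p, overlap W i j p -> v i p = `|\det (jac i j p)| * v j p].

Definition has_signature k (p q : nat) (B : 'M[R]_k) : Prop :=
  (p + q = k)%N /\
  exists2 P : 'M[R]_k, P \in unitmx &
    B = P *m diag_mx (\row_(i < k) if (i < p)%N then 1 else -1) *m P^T.

Definition tensor2 := idx A -> T -> 'M[R]_m.

Definition is_metric (p q : nat) (W : set T) (g : tensor2) : Prop :=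
  [/\ forall i, smooth_mx i W (g i),
      forall i x, W x -> dom i x -> has_signature p q (g i x)
    & forall i j x, overlap W i j x ->
        g i x = jac i j x *m g j x *m (jac i j x)^T].

Definition conn := idx A -> T -> 'I_m -> 'I_m -> 'I_m -> R.

Definition is_conn (W : set T) (G : conn) : Prop :=
  [/\ forall i c a b, smooth_in i W (fun p => G i p c a b),
      forall i p c a b, W p -> dom i p -> G i p c a b = G i p c b a
    & forall i j p, overlap W i j p -> forall d a b,
        \sum_c G i p c a b * jac i j p c d =
        pd i a (fun q => jac i j q b d) p +
        \sum_e \sum_f jac i j p a e * jac i j p b f * G j p d e f].

(* the covariant derivative of Y in the direction X *)
Definition cov (G : conn) (X Y : vfield) : vfield := fun i p =>
  \row_c \sum_a X i p 0 a *
    (pd i a (fun q => Y i q 0 c) p + \sum_b G i p c a b * Y i p 0 b).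

Definition levi_civita (W : set T) (g : tensor2) (G : conn) : Prop :=
  is_conn W G /\
  forall i p, W p -> dom i p -> forall c a b,
    pd i c (fun q => g i q a b) p
    - \sum_d G i p d c a * g i p d b - \sum_d G i p d c b * g i p a d = 0.

(* Ric_ab is the trace over c of R_ca^c_b, where
   R(X,Y) = [nabla_X, nabla_Y] - nabla_[X,Y]. *)
Definition ricci (G : conn) (i : idx A) (p : T) : 'M[R]_m :=
  \matrix_(a, b) \sum_c
    (pd i c (fun q => G i q c a b) p - pd i a (fun q => G i q c c b) p
     + \sum_e (G i p c c e * G i p e a b - G i p c a e * G i p e c b)).

(* the connection G + w, for a one-form w *)
Definition proj_change (G : conn) (w : oneform) : conn := fun i p c a b =>
  G i p c a b + w i p a 0 * (b == c)%:R + w i p b 0 * (a == c)%:R.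

Definition conn_eq (W : set T) (G G' : conn) : Prop :=
  forall i p c a b, W p -> dom i p -> G i p c a b = G' i p c a b.

Definition proj_equiv (W : set T) (G G' : conn) : Prop :=
  exists2 w, is_oneform W w & conn_eq W G' (proj_change G w).

Definition preserves (W : set T) (G : conn) (v : vdensity) : Prop :=
  forall i p a, W p -> dom i p ->
    pd i a (v i) p - (\sum_b G i p b a b) * v i p = 0.

Definition special (W : set T) (G : conn) : Prop :=
  exists2 v, is_vdensity W v & preserves W G v.

(* Tractors.  In the chart i the section s |dx|^(-1/(m+1)) of E(1) is
   represented by the function s, and its 1-jet by the column (s, d_a s); this
   trivializes the cotractor bundle J^1(E(1)).  Tractors are expressed in the
   dual frame. *)

(* E(1) component in the chart i of the local section with component 1 in j *)
Definition dens_trans (i j : idx A) (p : T) : R :=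
  `|\det (jac i j p)| `^ (- (m.+1)%:R^-1).

(* V_i = jet_trans i j *m V_j for the jet components in i and j *)
Definition jet_trans (i j : idx A) (p : T) : 'M[R]_(1 + m) :=
  block_mx (dens_trans i j p)%:M 0
    (grad i (dens_trans i j) p) (dens_trans i j p *: jac i j p).

Definition cotractor := idx A -> T -> 'cV[R]_(1 + m).

Definition is_cotractor (W : set T) (V : cotractor) : Prop :=
  (forall i, smooth_mx i W (V i)) /\
  (forall i j p, overlap W i j p -> V i p = jet_trans i j p *m V j p).

(* A bilinear form on cotractors: (V, V') |-> V^T *m H i p *m V' *)
Definition tractor_form := idx A -> T -> 'M[R]_(1 + m).

Definition is_cotractor_form (W : set T) (H : tractor_form) : Prop :=
  [/\ forall i, smooth_mx i W (H i),
      forall i p, W p -> dom i p -> (H i p)^T = H i p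
    & forall i j p, overlap W i j p ->
        H j p = (jet_trans i j p)^T *m H i p *m jet_trans i j p].

(* A bilinear form on the standard tractor bundle *)
Definition is_tractor_form (W : set T) (h : tractor_form) : Prop :=
  [/\ forall i, smooth_mx i W (h i),
      forall i p, W p -> dom i p -> (h i p)^T = h i p
    & forall i j p, overlap W i j p ->
        h i p = jet_trans i j p *m h j p *m (jet_trans i j p)^T].

(* G induces d + theta on E(1) *)
Definition theta (G : conn) (i : idx A) (p : T) : 'cV[R]_m :=
  \col_a ((m.+1)%:R^-1 * \sum_b G i p b a b).

(* The matrix of the isomorphism J^1(E(1)) = E(1) (+) T^*(1) determined by G:
   the jet of s is mapped to (s, nabla s) = (s, d s + theta s). *)
Definition splitting (G : conn) (i : idx A) (p : T) : 'M[R]_(1 + m) :=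
  block_mx 1%:M 0 (theta G i p) 1%:M.

Definition schouten (G : conn) (i : idx A) (p : T) : 'M[R]_m :=
  m.-1%:R^-1 *: ricci G i p.

(* In the splitting determined by G, the tractor connection
     nabla_a (s, mu_b) = (nabla_a s - mu_a, nabla_a mu_b + P_ab s)
   is d_a + split_form G i a. *)
Definition split_form (G : conn) (i : idx A) (a : 'I_m) (p : T) :
    'M[R]_(1 + m) :=
  block_mx (theta G i p a 0)%:M (- delta_mx 0 a)
    (\col_b schouten G i p a b)
    (\matrix_(b, c) ((b == c)%:R * theta G i p a 0 - G i p c a b)).

(* ... and in the jet frame it is d_a + jet_form G i a. *)
Definition jet_form (G : conn) (i : idx A) (a : 'I_m) (p : T) : 'M[R]_(1 + m) :=
  invmx (splitting G i p) *m
    (split_form G i a p *m splitting G i p + pdmx i a (splitting G i) p).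

(* A projective structure is given as the sheaf of its representatives:
   cls U G means that G is, on the open set U, a smooth connection in the
   projective class.  The tractor connection does not depend on the
   representative G preserving a volume density that is used to compute it;
   such representatives exist near each point, since adding to G the one-form
   with components - theta in a chart yields a connection preserving |dx|. *)
Definition tractor_prop (cls : set T -> conn -> Prop)
    (eqn : forall (w : 'I_m -> T -> 'M[R]_(1 + m)) (i : idx A) (a : 'I_m),
       T -> Prop) : Prop :=
  forall U G, cls U G -> special U G ->
  forall i p a, U p -> dom i p -> eqn (jet_form G i) i a p.

Definition cotractor_parallel cls (V : cotractor) : Prop :=
  tractor_prop cls (fun w i a p => pdmx i a (V i) p + w a p *m V i p = 0).

Definition cotractor_form_parallel cls (H : tractor_form) : Prop :=
  tractor_prop cls (fun w i a p =>
    pdmx i a (H i) p - (w a p)^T *m H i p - H i p *m w a p = 0).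

(* The connection form on the standard tractor bundle is - (w a p)^T. *)
Definition tractor_form_parallel cls (h : tractor_form) : Prop :=
  tractor_prop cls (fun w i a p =>
    pdmx i a (h i) p + w a p *m h i p + h i p *m (w a p)^T = 0).

(* vol(g)^(-1/(m+1)), a section of E(1) *)
Definition scale (g : tensor2) (i : idx A) (p : T) : R :=
  Num.sqrt `|\det (g i p)| `^ (- (m.+1)%:R^-1).

(* In the splitting of the Levi-Civita connection G of g, the form
   scale^(-2) g^{ab} mu_a mu'_b *)
Definition metric_cotractor_form (g : tensor2) (G : conn) : tractor_form :=
  fun i p =>
    (splitting G i p)^T *m
    block_mx (0 : 'M[R]_1) 0 0 ((scale g i p) ^- 2 *: invmx (g i p)) *m
    splitting G i p.

End Fields.

Section Boundary.
Context {R : realType} {n : nat} {T : topologicalType} (A : atlas R n.+1 T).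

Definition halfspace : set 'rV[R]_n.+1 := [set x | 0 <= x 0 0].

Record manifold_with_boundary : Prop := ManifoldWithBoundary {
  mwb_hausdorff : hausdorff_space T;
  mwb_countable : @second_countable T;
  mwb_cover : forall p : T, exists i : idx A, dom i p;
  mwb_open : forall i : idx A, open (dom i);
  mwb_img : forall i : idx A, exists2 O, open O & img i = O `&` halfspace;
  mwb_crdK : forall (i : idx A) p, dom i p -> prm i (crd i p) = p;
  mwb_crd_cont : forall i : idx A, {within dom i, continuous (crd i)};
  mwb_prm_cont : forall i : idx A, {within img i, continuous (prm i)};
  mwb_smooth : forall (i j : idx A) b,
    smooth_in i (dom j) (fun p => crd j p 0 b) }.

Definition bdry : set T := [set p | exists2 i : idx A, dom i p & crd i p 0 0 = 0].

Definition minterior : set T := ~` bdry.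

Definition defining_function (U : set T) (rho : T -> R) : Prop :=
  [/\ smooth_fun A U rho,
      forall p, U p -> 0 <= rho p,
      forall p, U p -> (rho p = 0 <-> bdry p)
    & forall (i : idx A) p, U p -> bdry p -> dom i p -> grad i rho p != 0].

Definition proj_compact_order (alpha : R) (nabla : conn A) : Prop :=
  forall p, bdry p -> exists U rho,
    [/\ open U, U p, defining_function U rho &
        exists2 C, is_conn U C &
          conn_eq (U `&` minterior) C
            (proj_change nabla
               (fun i q => (alpha * rho q)^-1 *: grad i rho q))].

Definition proj_compact (nabla : conn A) : Prop :=
  exists2 alpha : R, 0 < alpha & proj_compact_order alpha nabla.

(* the extension to the manifold with boundary of the projective class of a
   connection defined on the interior *)
Definition ext_class (nabla : conn A) (U : set T) (C : conn A) : Prop :=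
  [/\ open U, is_conn U C & proj_equiv (U `&` minterior) nabla C].

Definition tangent_along_bdry (U : set T) (X : vfield A) : Prop :=
  forall i p, U p -> bdry p -> dom i p -> X i p 0 0 = 0.

Definition totally_geodesic (cls : set T -> conn A -> Prop) : Prop :=
  forall U C, cls U C -> forall X Y, is_vfield U X -> is_vfield U Y ->
    tangent_along_bdry U X -> tangent_along_bdry U Y ->
    tangent_along_bdry U (cov C X Y).

(* The boundary as an n-dimensional manifold: its charts are obtained by
   dropping the coordinate number 0.  Its points remain points of T, and its
   (relatively) open subsets are represented by open subsets of T. *)
Definition bdry_atlas : atlas R n T := {|
  idx := idx A;
  dom := fun i => dom i `&` bdry;
  crd := fun i p => \row_(a < n) crd i p 0 (lift ord0 a);
  prm := fun i y => prm i (row_mx (0 : 'M[R]_1) y : 'rV_(1 + n)) |}.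

(* restriction to the boundary of a connection for which it is totally
   geodesic *)
Definition restrict_conn (C : conn A) : conn bdry_atlas := fun i p c a b =>
  C i p (lift ord0 c) (lift ord0 a) (lift ord0 b).

Definition bdry_class (cls : set T -> conn A -> Prop)
    (U : set T) (D : conn bdry_atlas) : Prop :=
  [/\ open U, is_conn U D &
      forall p, U p -> bdry p -> exists U' C,
        [/\ cls U' C, U' p & proj_equiv (U `&` U') (restrict_conn C) D]].

Definition extends_L (g : tensor2 A) (L : cotractor A) : Prop :=
  is_cotractor setT L /\
  forall i p, minterior p -> dom i p ->
    L i p = col_mx (scale g i p)%:M (grad i (scale g i) p).

Definition extends_form (g : tensor2 A) (nabla : conn A) (H : tractor_form A) :
    Prop :=
  is_cotractor_form setT H /\
  forall i p, minterior p -> dom i p -> H i p = metric_cotractor_form g nabla i p.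

(* Let L extend L(sigma).  Along the boundary L = (0, d sigma) is a nowhere
   vanishing section of (conormal bundle)(1), which identifies the conormal
   bundle with E(-1) and hence vol(bdry) with E(-n-1), i.e., E(1) restricted to
   the boundary with the bundle E(1) of the boundary.  If d sigma has the
   coordinate expression lambda dx^0, this maps s |dx|^(-1/(n+2)) to
   lambda^(1/(n+1)) s |dx^1 ... dx^n|^(-1/(n+1)). *)
Definition bdry_factor (L : cotractor A) (i : idx A) (p : T) : R :=
  L i p (rshift 1 (ord0 : 'I_n.+1)) 0 `^ ((n.+1)%:R^-1).

(* The projection from cotractors to cotractors of the boundary induced by
   restricting 1-jets of densities to the boundary.  Its kernel is spanned by
   L, so it identifies the quotient by L with the cotractor bundle of the
   boundary. *)
Definition bdry_proj (L : cotractor A) (i : idx A) (p : T) :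
    'M[R]_(1 + n, 1 + (1 + n)) :=
  let k : T -> R := bdry_factor L i in
  block_mx (k p)%:M 0
    (@grad _ _ _ bdry_atlas i k p) (row_mx (0 : 'cV_n) (k p)%:M).

(* h is the inverse of the form induced by H on the quotient by L. *)
Definition inverse_induced (L : cotractor A) (H : tractor_form A)
    (h : tractor_form bdry_atlas) : Prop :=
  forall i p, bdry p -> dom i p ->
    h i p \in unitmx /\
    H i p = (bdry_proj L i p)^T *m invmx (h i p) *m bdry_proj L i p.

(* h is the bundle metric obtained by the canonical construction from the
   Ricci flat metric g with Levi-Civita connection nabla. *)
Definition canonical_metric (g : tensor2 A) (nabla : conn A)
    (h : tractor_form bdry_atlas) : Prop :=
  exists L H,
    [/\ extends_L g L,
        cotractor_parallel (ext_class nabla) L,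
        forall i p, dom i p -> L i p != 0,
        forall i p, bdry p -> dom i p -> L i p (lshift n.+1 0) 0 = 0
      & [/\ extends_form g nabla H,
            cotractor_form_parallel (ext_class nabla) H,
            forall i p, dom i p -> forall V : 'cV_(1 + n.+1),
              H i p *m V = 0 <-> exists c : R, V = c *: L i p
          & inverse_induced L H h]].

(* the reduction of the tractor holonomy of the boundary to SO(p, q) *)
Definition parallel_tractor_metric (cls : set T -> conn A -> Prop) (p q : nat)
    (h : tractor_form bdry_atlas) : Prop :=
  [/\ is_tractor_form bdry h,
      forall i x, bdry x -> dom i x -> has_signature p q (h i x)
    & tractor_form_parallel (bdry_class cls) h].

End Boundary.

(* Main.v *)
(* The Ricci tensor transforms under nabla -> nabla + d rho / (alpha rho) by an
   explicit formula.  Multiplied by rho^2 it extends to the boundary and forces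
   alpha = 1; divided by rho it then shows that the Hessian of rho vanishes on
   tangential directions, i.e., that the boundary is totally geodesic.

   As g is Ricci flat, L(sigma) and the form sigma^(-2) g^{ab} are parallel, so in
   a chart they solve linear first order systems whose coefficients, depending on
   the projective class only, are smooth up to the boundary.  By Gronwall's
   inequality such solutions extend smoothly.  The quotient sigma / rho solves a
   system of this kind together with its inverse, so it extends positively and
   L(sigma) = (0, d sigma) does not vanish on the boundary.

   In the interior the determinant of the form reduced by dropping the normal
   component mu_0 is L_0^2 up to sign, where L_0 is that component of L(sigma).
   Hence the reduced form stays non-degenerate at the boundary, and its
   signature is (p, q) by continuity.  The projection to boundary cotractors
   intertwines the two tractor connections, since the symmetry of the second
   derivatives of the parallel section L(sigma) relates the Schouten tensor of the
   boundary to that of the ambient structure; so the induced metric is parallel. *)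

Require Import Defs.
From mathcomp Require Import all_boot all_order all_algebra.
From mathcomp Require Import all_classical all_reals all_analysis.
From mathcomp Require Import ring lra zify.
Import numFieldNormedType.Exports.
Import Order.TTheory GRing.Theory Num.Theory.

Set Implicit Arguments.
Unset Strict Implicit.
Unset Printing Implicit Defensive.

Local Open Scope classical_set_scope.
Local Open Scope ring_scope.

(** * Calculus on locally orthant-like sets *)

(** Near the boundary the Levi-Civita connection is singular, so none of its data extend directly.
    The way around this is that its trace-free part in a chart ([thomas]) depends on the projective
    class only and hence equals that of a representative smooth up to the boundary; in the jet frame
    the tractor connection form involves this part alone. Identities are then proved in the interior
    and carried to the boundary by density and continuity. Passing to the boundary lowers the
    dimension, which changes both the weight of E(1) and the trace that [thomas] removes. Both
    discrepancies come from the normal component of L(sigma): its power 1/(n+1) corrects the weight,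
    and the logarithmic derivative of that same power corrects the trace. This coincidence is what
    makes the projection of cotractors compatible with the two connections. *)

Section Cubes.
Context {R : realType} {m : nat}.
Implicit Types (D : set 'rV[R]_m) (f g : 'rV[R]_m -> R) (x y : 'rV[R]_m).
Implicit Types (a b : 'I_m) (e h : R).

Definition cube x (r : R) : set 'rV[R]_m :=
  [set y | forall a, `|y 0 a - x 0 a| < r].

Lemma shiftE x (h : R) a b :
  (x + h *: delta_mx 0 a) 0 b = x 0 b + h * (b == a)%:R.
Proof. by rewrite !mxE eqxx. Qed.

Lemma nbhs_cubeP x (P : set 'rV[R]_m) :
  nbhs x P <-> exists2 r : R, 0 < r & cube x r `<=` P.
Proof.
split.
  move=> /nbhs_ballP[r /= r0 rP]; exists r => // y yr; apply: rP.
  by split=> // i j; rewrite ord1 /ball /= distrC.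
move=> [r r0 rP]; apply/nbhs_ballP; exists r => //= y [_ yr]; apply: rP => a.
by have := yr 0 a; rewrite /ball /= distrC.
Qed.

Lemma cube_center x (r : R) : 0 < r -> cube x r x.
Proof. by move=> r0 a; rewrite subrr normr0. Qed.

Lemma cube_shift x (r h : R) a : `|h| < r -> cube x r (x + h *: delta_mx 0 a).
Proof.
move=> hr b; rewrite shiftE [_ + _ * _]addrC addrK; case: (b == a).
  by rewrite mulr1.
by rewrite mulr0 normr0; apply: le_lt_trans hr.
Qed.

Lemma cubeW x (r s : R) : r <= s -> cube x r `<=` cube x s.
Proof. by move=> rs y yr a; exact: lt_le_trans (yr a) rs. Qed.

Lemma cube_cube x y (r : R) : cube x r y ->
  exists2 s : R, 0 < s & cube y s `<=` cube x r.
Proof.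
move=> yr; have : nbhs y (cube x r); last by move/nbhs_cubeP.
pose f a : set 'rV[R]_m := [set z | `|z 0 a - x 0 a| < r].
suff yf a : nbhs y (f a) by exact: (@filter_forall _ _ f (nbhs y) _ yf).
apply: open_nbhs_nbhs; split; last exact: yr.
rewrite (_ : f a = (fun z : 'rV[R]_m => z 0 a) @^-1` (ball (x 0 a) r)).
  apply: open_comp; last exact: ball_open.
  by move=> z _; exact: coord_continuous.
by apply/seteqP; split => z; rewrite /f /= -ball_normE /= distrC.
Qed.

(** The set of constrained coordinates is a parameter: one coordinate for the half-space charts of
    the manifold, none for the charts of its boundary. One calculus then serves both. *)
Definition orthant (S : pred 'I_m) : set 'rV[R]_m :=
  [set x | forall a, S a -> 0 <= x 0 a].

Definition lorthant D := exists S O, open O /\ D = O `&` orthant S.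

Lemma lorthant_cube D x : lorthant D -> D x -> exists S,
  [/\ orthant S x & exists2 r : R, 0 < r &
      forall y, cube x r y -> (D y <-> orthant S y)].
Proof.
move=> [S [V [oO ->]]] [Vx Sx]; exists S; split=> //.
have /nbhs_cubeP[r r0 rO] : nbhs x V by exact: open_nbhs_nbhs.
by exists r => // y /rO Oy; split=> [[]|].
Qed.

Lemma orthant_shift S x (h : R) a : orthant S x -> 0 <= h ->
  orthant S (x + h *: delta_mx 0 a).
Proof. by move=> Sx h0 b /Sx Sb; rewrite shiftE addr_ge0// mulr_ge0. Qed.

(** Positive shifts never violate a sign constraint. Hence the filter that defines a derivative is
    proper even at boundary points, and one-sided derivatives are unique. *)
Lemma lorthant_shift D x a : lorthant D -> D x -> exists2 r : R, 0 < r &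
  forall h, 0 <= h < r -> D (x + h *: delta_mx 0 a).
Proof.
move=> lD /(lorthant_cube lD)[S [Sx [r r0 rD]]]; exists r => // h /andP[h0 hr].
apply/rD; last exact: orthant_shift.
by apply: cube_shift; rewrite ger0_norm.
Qed.

Lemma lorthantI D (O : set 'rV[R]_m) : lorthant D -> open O ->
  lorthant (D `&` O).
Proof.
move=> [S [V [oV ->]]] oO; exists S, (V `&` O); split; first exact: openI.
by rewrite setIAC.
Qed.

Lemma punctured_proper D a x : lorthant D -> D x ->
  ProperFilter (punctured D a x).
Proof.
move=> lD Dx; split; last first.
  exact: within_filter.
move=> /nbhs_ballP[e /= e0 eP].
have [r r0 rD] := lorthant_shift a lD Dx.
pose h := Num.min e r / 2.
have h0 : 0 < h by rewrite divr_gt0// lt_min e0.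
have hm : h < Num.min e r by rewrite gtr_pMr ?invf_lt1 ?ltr1n// lt_min e0.
move: hm; rewrite lt_min => /andP[he hr].
apply: (eP h) => /=; first by rewrite /ball /= sub0r normrN gtr0_norm.
- by rewrite gt_eqF.
- by apply: rD; rewrite ltW.
Qed.

End Cubes.

(** * Rules for one-sided partial derivatives *)

Section PartialDerivatives.
Context {R : realType} {m : nat}.
Implicit Types (D : set 'rV[R]_m) (f g : 'rV[R]_m -> R) (x y : 'rV[R]_m).
Implicit Types (a b : 'I_m) (e h : R).

(** As a relation, the derivative obeys the usual rules without separate existence claims; the value
    of [pderiv] is recovered by uniqueness. *)
Definition is_pd D a f x (l : R) := dquot a f x @ punctured D a x --> l.

#[local] Instance punctured_filter D a x : Filter (punctured D a x).
Proof. exact: within_filter. Qed.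

Lemma near_punctured D a x (P : set R) :
  (\forall h \near punctured D a x, P h) <-> exists2 r : R, 0 < r &
    forall h, h != 0 -> `|h| < r -> D (x + h *: delta_mx 0 a) -> P h.
Proof.
split.
  move=> /nbhs_ballP[e /= e0 eP]; exists e => // h h0 he Dh.
  by apply: (eP h) => //; rewrite /ball /= sub0r normrN.
move=> [r r0 rP]; apply/nbhs_ballP; exists r => //= h.
by rewrite /ball /= sub0r normrN => hr h0 Dh; exact: rP.
Qed.

Lemma is_pdP D a f x l : is_pd D a f x l <->
  forall e, 0 < e -> exists2 r : R, 0 < r &
    forall h, h != 0 -> `|h| < r -> D (x + h *: delta_mx 0 a) ->
      `|dquot a f x h - l| < e.
Proof.
split.
  move=> /cvgrPdist_lt fl e e0; apply/near_punctured.
  by apply: filterS (fl e e0) => h; rewrite distrC.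
move=> fl; apply/cvgrPdist_lt => e e0; have [r r0 rP] := fl _ e0.
apply/near_punctured; exists r => // h h0 hr Dh.
by rewrite distrC; exact: rP.
Qed.

Lemma is_pd_pderivable D a f x l : is_pd D a f x l -> pderivable D a f x.
Proof. by move=> fl; apply/cvg_ex; exists l. Qed.

Lemma is_pd_pderiv D a f x l : lorthant D -> D x ->
  is_pd D a f x l -> pderiv D a f x = l.
Proof.
by move=> lD Dx fl; apply: cvg_lim => //; exact: punctured_proper.
Qed.

Lemma is_pd_unique D a f x l l' : lorthant D -> D x ->
  is_pd D a f x l -> is_pd D a f x l' -> l = l'.
Proof.
by move=> lD Dx /(is_pd_pderiv lD Dx) <- /(is_pd_pderiv lD Dx).
Qed.

Lemma is_pd_local D D' a f f' x l : D x ->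
  (exists2 r : R, 0 < r & forall y, cube x r y ->
     (D' y -> D y) /\ (D' y -> f y = f' y)) -> f x = f' x ->
  is_pd D a f x l -> is_pd D' a f' x l.
Proof.
move=> Dx [r r0 rP] ffx /is_pdP fl; apply/is_pdP => e e0.
have [s s0 sP] := fl _ e0; exists (Num.min r s); first by rewrite lt_min r0.
move=> h h0; rewrite lt_min => /andP[hr hs] Dh.
have [DD' ff'] := rP _ (cube_shift x a hr).
by have := sP h h0 hs (DD' Dh); rewrite /dquot ff'// ffx.
Qed.

Lemma is_pd_eq D a f f' x l l' : D x -> (forall y, D y -> f y = f' y) ->
  l = l' -> is_pd D a f x l -> is_pd D a f' x l'.
Proof.
move=> Dx ff <-; apply: is_pd_local => //; last exact: ff.
by exists 1 => // y _; split=> // /ff.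
Qed.

Lemma is_pd_cst D a x (c : R) : is_pd D a (cst c) x 0.
Proof.
apply/is_pdP => e e0; exists 1 => // h _ _ _.
by rewrite /dquot /cst subrr mulr0 subrr normr0.
Qed.

Lemma is_pd_coord D a b x : is_pd D a (fun y => y 0 b) x (b == a)%:R.
Proof.
apply/is_pdP => e e0; exists 1 => // h h0 _ _.
by rewrite /dquot shiftE [x 0 b + _]addrC addrK mulKf// subrr normr0.
Qed.

Lemma cvg_punctured_eq D a x (F G : R -> R) (l : R) :
  (forall h, h != 0 -> D (x + h *: delta_mx 0 a) -> F h = G h) ->
  F @ punctured D a x --> l -> G @ punctured D a x --> l.
Proof.
move=> FG; apply: cvg_trans; apply: near_eq_cvg.
suff: \forall h \near punctured D a x, F h = G h by [].
by apply/near_punctured; exists 1 => // h h0 _ Dh; exact: FG.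
Qed.

Lemma is_pd_cvg D a f x l : is_pd D a f x l ->
  (fun h => f (x + h *: delta_mx 0 a)) @ punctured D a x --> f x.
Proof.
move=> fl.
have h0 : (fun h : R => h) @ punctured D a x --> (0 : R).
  apply/cvgrPdist_lt => e e0; apply/near_punctured; exists e => // h _ he _.
  by rewrite sub0r normrN.
have : (fun h => h * dquot a f x h + f x) @ punctured D a x --> 0 * l + f x.
  by apply: cvgD; [exact: cvgM|exact: cvg_cst].
rewrite mul0r add0r.
apply: cvg_punctured_eq => h hn0 _.
by rewrite /= /dquot mulVKf// subrK.
Qed.

Lemma is_pdD D a f g x l k : is_pd D a f x l -> is_pd D a g x k ->
  is_pd D a (fun y => f y + g y) x (l + k).
Proof.
move=> fl gk; apply: (cvg_punctured_eq _ (cvgD fl gk)) => h _ _.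
by rewrite /dquot !fctE; ring.
Qed.

Lemma is_pdN D a f x l : is_pd D a f x l -> is_pd D a (fun y => - f y) x (- l).
Proof.
move=> fl; apply: (cvg_punctured_eq _ (cvgN fl)) => h _ _.
by rewrite /dquot !fctE; ring.
Qed.

Lemma is_pdB D a f g x l k : is_pd D a f x l -> is_pd D a g x k ->
  is_pd D a (fun y => f y - g y) x (l - k).
Proof. by move=> fl /is_pdN; exact: is_pdD. Qed.

Lemma is_pdM D a f g x l k : is_pd D a f x l -> is_pd D a g x k ->
  is_pd D a (fun y => f y * g y) x (l * g x + f x * k).
Proof.
move=> fl gk.
have : (fun h => dquot a f x h * g (x + h *: delta_mx 0 a)
    + f x * dquot a g x h) @ punctured D a x --> l * g x + f x * k.
  apply: cvgD; first by apply: cvgM => //; exact: is_pd_cvg gk.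
  by apply: cvgM => //; exact: cvg_cst.
by apply: cvg_punctured_eq => h _ _; rewrite /dquot; ring.
Qed.

Lemma is_pd_sum D a (I : Type) (r : seq I) (P : pred I)
    (F : I -> 'rV[R]_m -> R) x (L : I -> R) :
  (forall i, P i -> is_pd D a (F i) x (L i)) ->
  is_pd D a (fun y => \sum_(i <- r | P i) F i y) x (\sum_(i <- r | P i) L i).
Proof.
move=> FL; elim: r => [|i r IH].
  rewrite big_nil (_ : (fun _ => _) = cst 0); first exact: is_pd_cst.
  by apply/funext => y; rewrite big_nil.
rewrite big_cons; under [X in is_pd _ _ X]eq_fun do rewrite big_cons.
by case: ifP => // Pi; apply: is_pdD => //; exact: FL.
Qed.

(** The differentiated factor is singled out by its index value, not by its position, whence
    [uniq]. *)
Lemma is_pd_prod D a (I : eqType) (r : seq I) (F : I -> 'rV[R]_m -> R) x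
    (L : I -> R) : uniq r ->
  (forall i, is_pd D a (F i) x (L i)) ->
  is_pd D a (fun y => \prod_(i <- r) F i y) x
    (\sum_(i <- r) \prod_(j <- r) (if j == i then L j else F j x)).
Proof.
move=> + FL; elim: r => [|i r IH] /=.
  rewrite big_nil (_ : (fun _ => _) = cst 1); first by move=> _; exact: is_pd_cst.
  by apply/funext => y; rewrite big_nil.
move=> /andP[ir ur]; under [X in is_pd _ _ X]eq_fun do rewrite big_cons.
have := is_pdM (FL i) (IH ur); rewrite /is_pd; congr (_ @ _ --> _).
rewrite big_cons big_cons eqxx; congr (_ * _ + _).
  rewrite big_seq [RHS]big_seq; apply: eq_bigr => j jr.
  by case: eqP => // ji; rewrite -ji jr in ir.
rewrite mulr_sumr; apply: eq_big_seq => j jr.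
rewrite big_cons; case: eqP => // ij; by rewrite ij jr in ir.
Qed.

Lemma is_pd_comp D a f x l (phi : R -> R) (k : R) : lorthant D -> D x ->
  is_pd D a f x l -> is_derive (f x) 1 phi k ->
  is_pd D a (phi \o f) x (k * l).
Proof.
move=> lD Dx fl phik.
(* Caratheodory's device: the divided difference of [phi], completed by its limit at 0, avoids
   dividing by an increment of [f] that may vanish. *)
pose psi t := if t == 0 then k else t^-1 * (phi (f x + t) - phi (f x)).
have psik : psi @ (0 : R) --> k.
  apply/cvgrPdist_lt => e e0.
  have /cvgrPdist_lt/(_ e e0) : (fun h => h^-1 *: (phi (h *: 1 + f x) - phi (f x)))
      @ (0 : R)^' --> k.
    by have := @ex_derive _ _ _ _ _ _ _ phik; rewrite /derivable -/(derive phi (f x) 1) derive_val.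
  move=> /nbhs_ballP[r /= r0 rP]; apply/nbhs_ballP; exists r => //= t tr.
  rewrite /psi; case: eqVneq => [_|t0]; first by rewrite subrr normr0.
  by have := rP t tr t0; rewrite /GRing.scale /= mulr1 [t + _]addrC.
have t0 : (fun h => f (x + h *: delta_mx 0 a) - f x) @ punctured D a x --> (0 : R).
  rewrite -(subrr (f x)); apply: cvgB; first exact: is_pd_cvg fl.
  exact: cvg_cst.
apply: (cvg_punctured_eq _ (cvgM (cvg_comp _ _ t0 psik) fl)) => h h0 _.
rewrite /dquot /psi !fctE /= [f x + _]addrC subrK subr_eq0.
case: eqVneq => [->|ne]; first by rewrite !subrr !mulr0.
by field; rewrite h0 subr_eq0.
Qed.

End PartialDerivatives.

(** * Functions of class C^k up to the boundary *)

Section SmoothFunctions.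
Context {R : realType} {m : nat}.
Implicit Types (D : set 'rV[R]_m) (f g : 'rV[R]_m -> R) (x y : 'rV[R]_m).
Implicit Types (a b : 'I_m) (e h : R).

Definition wcont D f x := f @ within D (nbhs x) --> f x.

Lemma withinP D f : {within D, continuous f} <-> forall x, D x -> wcont D f x.
Proof. exact: subspace_continuousP. Qed.

Lemma wcontP D f x : wcont D f x <-> forall e, 0 < e ->
  exists2 r : R, 0 < r & forall y, cube x r y -> D y -> `|f y - f x| < e.
Proof.
split.
  move=> /cvgrPdist_lt fx e e0.
  have /nbhs_cubeP[r r0 rP] := fx e e0.
  by exists r => // y yr Dy; rewrite distrC; exact: rP.
move=> fx; apply/cvgrPdist_lt => e e0; have [r r0 rP] := fx e e0.
by apply/nbhs_cubeP; exists r => // y yr Dy; rewrite distrC; exact: rP.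
Qed.

Lemma wcont_local D D' f g x :
  (exists2 r : R, 0 < r & forall y, cube x r y -> D' y -> D y /\ f y = g y) ->
  f x = g x -> wcont D f x -> wcont D' g x.
Proof.
move=> [r r0 rP] fgx /wcontP fx; apply/wcontP => e /fx[s s0 sP].
exists (Num.min r s); first by rewrite lt_min r0.
move=> y yrs Dy; have /rP/(_ Dy)[Dy' <-] : cube x r y.
  by apply: cubeW yrs; rewrite ge_min lexx.
by rewrite -fgx; apply: sP => //; apply: cubeW yrs; rewrite ge_min lexx orbT.
Qed.

Lemma Ck_cont k D f x : Ck k D f -> D x -> wcont D f x.
Proof. by case: k => [|k] [/withinP + _]; exact. Qed.

Lemma Ck_is_pd k D f a x : Ck k.+1 D f -> D x ->
  is_pd D a f x (pderiv D a f x).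
Proof. by move=> [_ /(_ a)[+ _]]; exact. Qed.

Lemma Ck_pderiv k D f a : Ck k.+1 D f -> Ck k D (pderiv D a f).
Proof. by move=> [_ /(_ a)[]]. Qed.

Lemma Ck_ext k D f g : lorthant D -> (forall x, D x -> f x = g x) ->
  Ck k D f -> Ck k D g.
Proof.
move=> lD; elim: k f g => [|k IH] f g fg fk.
  split=> //; apply/withinP => x Dx; apply: wcont_local (Ck_cont fk Dx).
    by exists 1 => // y _ Dy; split=> //; exact: fg.
  exact: fg.
have gpd a x : D x -> is_pd D a g x (pderiv D a f x).
  by move=> Dx; exact: is_pd_eq Dx fg erefl (Ck_is_pd fk Dx).
split.
  apply/withinP => x Dx; apply: wcont_local (Ck_cont fk Dx).
    by exists 1 => // y _ Dy; split=> //; exact: fg.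
  exact: fg.
move=> a; split; first by move=> x Dx; exact: is_pd_pderivable (gpd a x Dx).
apply: IH (Ck_pderiv a fk) => x Dx.
by rewrite (is_pd_pderiv lD Dx (gpd a x Dx)).
Qed.

(** Any family that is correct on [D] may play the gradient, so explicit formulas can stand in for
    [pderiv]. *)
Lemma Ck_intro k D f (df : 'I_m -> 'rV[R]_m -> R) : lorthant D ->
  (forall x, D x -> wcont D f x) ->
  (forall a x, D x -> is_pd D a f x (df a x)) ->
  (forall a, Ck k D (df a)) -> Ck k.+1 D f.
Proof.
move=> lD cf fdf dfk; split; first exact/withinP.
move=> a; split; first by move=> x Dx; exact: is_pd_pderivable (fdf a x Dx).
by apply: Ck_ext (dfk a) => // x Dx; rewrite (is_pd_pderiv lD Dx (fdf a x Dx)).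
Qed.

Lemma CkW k D f : Ck k.+1 D f -> Ck k D f.
Proof.
elim: k f => [|k IH] f; first by case.
move=> [cf fk]; split=> // a; have [df dfk] := fk a; split=> //; exact: IH.
Qed.

Lemma Ck_cst k D (c : R) : lorthant D -> Ck k D (cst c).
Proof.
move=> lD; have cc d x : D x -> wcont D (cst d) x by move=> _; exact: cvg_cst.
elim: k c => [|k IH] c; first by split=> //; apply/withinP; exact: cc.
apply: (@Ck_intro _ _ _ (fun _ => cst 0)) => //; first exact: cc.
by move=> a x Dx; exact: is_pd_cst.
Qed.

Lemma CkD k D f g : lorthant D -> Ck k D f -> Ck k D g ->
  Ck k D (fun x => f x + g x).
Proof.
move=> lD; elim: k f g => [|k IH] f g fk gk; have cfg x : D x ->
    wcont D (fun x => f x + g x) x by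
  move=> Dx; apply: cvgD; [exact: Ck_cont fk _|exact: Ck_cont gk _].
  by split=> //; apply/withinP; exact: cfg.
apply: (@Ck_intro _ _ _ (fun a x => pderiv D a f x + pderiv D a g x)) => //.
  by move=> a x Dx; apply: is_pdD; [exact: Ck_is_pd fk _|exact: Ck_is_pd gk _].
by move=> a; apply: IH; exact: Ck_pderiv.
Qed.

Lemma CkM k D f g : lorthant D -> Ck k D f -> Ck k D g ->
  Ck k D (fun x => f x * g x).
Proof.
move=> lD; elim: k f g => [|k IH] f g fk gk; have cfg x : D x ->
    wcont D (fun x => f x * g x) x by
  move=> Dx; apply: cvgM; [exact: Ck_cont fk _|exact: Ck_cont gk _].
  by split=> //; apply/withinP; exact: cfg.
apply: (@Ck_intro _ _ _
  (fun a x => pderiv D a f x * g x + f x * pderiv D a g x)) => //.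
  by move=> a x Dx; apply: is_pdM; [exact: Ck_is_pd fk _|exact: Ck_is_pd gk _].
by move=> a; apply: CkD => //; apply: IH;
  by [exact: Ck_pderiv|exact: CkW].
Qed.

Lemma CkN k D f : lorthant D -> Ck k D f -> Ck k D (fun x => - f x).
Proof.
move=> lD fk; apply: (Ck_ext lD _ (CkM lD (Ck_cst k (-1) lD) fk)) => x _.
by rewrite /= mulN1r.
Qed.

Lemma Ck_sum k D (I : Type) (r : seq I) (P : pred I)
    (F : I -> 'rV[R]_m -> R) : lorthant D ->
  (forall i, P i -> Ck k D (F i)) -> Ck k D (fun y => \sum_(i <- r | P i) F i y).
Proof.
move=> lD Fk; elim: r => [|i r IH].
  apply: Ck_ext (Ck_cst k 0 lD) => // x _; by rewrite big_nil.
case: (boolP (P i)) => Pi.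
  apply: Ck_ext (CkD lD (Fk i Pi) IH) => // x _; by rewrite big_cons Pi.
by apply: Ck_ext IH => // x _; rewrite big_cons (negbTE Pi).
Qed.

Lemma Ck_prod k D (I : Type) (r : seq I) (P : pred I)
    (F : I -> 'rV[R]_m -> R) : lorthant D ->
  (forall i, P i -> Ck k D (F i)) -> Ck k D (fun y => \prod_(i <- r | P i) F i y).
Proof.
move=> lD Fk; elim: r => [|i r IH].
  apply: Ck_ext (Ck_cst k 1 lD) => // x _; by rewrite big_nil.
case: (boolP (P i)) => Pi.
  apply: Ck_ext (CkM lD (Fk i Pi) IH) => // x _; by rewrite big_cons Pi.
by apply: Ck_ext IH => // x _; rewrite big_cons (negbTE Pi).
Qed.

Lemma Ck_powR k D f (r : R) : lorthant D -> (forall x, D x -> 0 < f x) ->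
  Ck k D f -> Ck k D (fun x => f x `^ r).
Proof.
move=> lD f0; have cfr s x : D x -> wcont D f x ->
    wcont D (fun x => f x `^ s) x.
  move=> Dx cf; have cs : {for f x, continuous (fun t : R => t `^ s)}.
    apply/differentiable_continuous/derivable1_diffP.
    exact/ex_derive/is_derive1_powR/f0.
  exact: (cvg_comp _ _ cf cs).
elim: k f r f0 cfr => [|k IH] f r f0 cfr fk.
  by split=> //; apply/withinP => x Dx; apply: cfr => //; exact: Ck_cont fk _.
apply: (@Ck_intro _ _ _ (fun a x => r * f x `^ (r - 1) * pderiv D a f x)) => //.
- by move=> x Dx; apply: cfr => //; exact: Ck_cont fk _.
- move=> a x Dx; apply: (is_pd_comp (phi := fun t => t `^ r)) => //.
    exact: Ck_is_pd fk _.
  by apply: is_derive1_powR; exact: f0.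
move=> a; apply: CkM => //; last exact: Ck_pderiv.
apply: CkM => //; first exact: Ck_cst.
by apply: IH => //; exact: CkW.
Qed.

Lemma CkV k D f : lorthant D -> (forall x, D x -> f x != 0) ->
  Ck k D f -> Ck k D (fun x => (f x)^-1).
Proof.
move=> lD f0 fk.
have ff0 x : D x -> 0 < f x * f x.
  by move=> Dx; rewrite -expr2 exprn_even_gt0//= f0.
apply: Ck_ext (CkM lD fk (Ck_powR (-1) lD ff0 (CkM lD fk fk))) => // x Dx.
by rewrite powR_inv1 ?ltW ?ff0// invfM mulVKf ?f0.
Qed.

(** This form trades the absolute value for a square, so that powers of |det| are visibly smooth and
    can be differentiated. *)
Lemma normr_powR (t s : R) : `|t| `^ s = (t * t) `^ (s / 2).
Proof.
have -> : t * t = `|t| `^ 2 by rewrite powR_mulrn// -normrX ger0_norm ?sqr_ge0.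
by rewrite -powRrM mulrCA divff ?mulr1// pnatr_eq0.
Qed.

Lemma Ck_norm_powR k D f (r : R) : lorthant D -> (forall x, D x -> f x != 0) ->
  Ck k D f -> Ck k D (fun x => `|f x| `^ r).
Proof.
move=> lD f0 fk.
have ff0 x : D x -> 0 < f x * f x.
  by move=> Dx; rewrite -expr2 exprn_even_gt0//= f0.
apply: Ck_ext (Ck_powR (r / 2) lD ff0 (CkM lD fk fk)) => // x Dx.
by rewrite normr_powR.
Qed.

Lemma Ck_restrict k D D' f : lorthant D -> lorthant D' -> D' `<=` D ->
  Ck k D f -> Ck k D' f.
Proof.
move=> lD lD' D'D; elim: k f => [|k IH] f fk; have cf x : D' x -> wcont D' f x by
  move=> Dx; apply: wcont_local (Ck_cont fk (D'D _ Dx)) => //;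
  exists 1 => // y _ Dy; split=> //; exact: D'D.
  by split=> //; exact/withinP.
apply: (@Ck_intro _ _ _ (pderiv D ^~ f)) => //; last first.
  by move=> a; apply: IH; exact: Ck_pderiv.
move=> a x Dx; apply: is_pd_local (Ck_is_pd fk (D'D _ Dx)) => //; first exact: D'D.
by exists 1 => // y _; split=> // /D'D.
Qed.

Lemma Ck_local k D f : lorthant D ->
  (forall x, D x -> exists2 r : R, 0 < r & exists D',
    [/\ lorthant D', cube x r `&` D `<=` D', D' `<=` D & Ck k D' f]) ->
  Ck k D f.
Proof.
move=> lD; elim: k f => [|k IH] f loc; have cf x : D x -> wcont D f x by
  move=> Dx; have [r r0 [D' [lD' DD' D'D fk]]] := loc x Dx;
  apply: (wcont_local _ _ (Ck_cont fk (DD' x _))) => //;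
    [exists r => // y yr Dy; split=> //; exact: DD'|split=> //; exact: cube_center].
  by split=> //; exact/withinP.
have fpd x a D' : D x -> lorthant D' -> D' x -> D' `<=` D ->
    (exists2 r : R, 0 < r & cube x r `&` D `<=` D') -> Ck k.+1 D' f ->
    is_pd D a f x (pderiv D' a f x).
  move=> Dx lD' D'x D'D [r r0 DD'] fk.
  apply: is_pd_local (Ck_is_pd fk D'x) => //.
  by exists r => // y yr; split=> // Dy; exact: DD'.
split; first exact/withinP.
move=> a; split=> [x Dx|].
  have [r r0 [D' [lD' DD' D'D fk]]] := loc x Dx.
  have D'x : D' x by apply: DD'; split=> //; exact: cube_center.
  by apply: is_pd_pderivable (fpd x a D' _ _ _ _ _ _) => //; exists r.
apply: IH => x Dx.
have [r r0 [D' [lD' DD' D'D fk]]] := loc x Dx.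
have D'x : D' x by apply: DD'; split=> //; exact: cube_center.
(* Outside the cube the derivative relative to [D'] need not be the one relative to [D]; inside it
   the two agree, since there [D'] contains all of [D]. *)
pose D'' := D' `&` cube x r.
have oC : open (cube x r).
  rewrite openE => y /cube_cube[t t0 tr].
  by apply/nbhs_cubeP; exists t.
have lD'' : lorthant D'' by exact: lorthantI.
exists r => //; exists D''; split=> //.
- by move=> y [yr Dy]; split=> //; exact: DD'.
- by move=> y [/D'D].
apply: (@Ck_ext _ _ (pderiv D' a f)) => //.
  move=> y [Dy yr]; apply/esym/(is_pd_pderiv lD (D'D _ Dy)).
  apply: fpd => //; first exact: D'D.
  have [t t0 tr] := cube_cube yr; exists t => // z [zt Dz]; apply: DD'; split=> //.
  exact: tr.
apply: (Ck_restrict lD' lD''); first by move=> y [].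
exact: Ck_pderiv.
Qed.

Lemma Ck_det k D r (F : 'rV[R]_m -> 'M[R]_r) : lorthant D ->
  (forall i j, Ck k D (fun x => F x i j)) -> Ck k D (fun x => \det (F x)).
Proof.
move=> lD Fk; apply: Ck_sum => // s _; apply: CkM => //; first exact: Ck_cst.
exact: Ck_prod.
Qed.

Lemma Ck_invmx k D r (F : 'rV[R]_m -> 'M[R]_r) : lorthant D ->
  (forall x, D x -> F x \in unitmx) ->
  (forall i j, Ck k D (fun x => F x i j)) ->
  forall i j, Ck k D (fun x => (invmx (F x)) i j).
Proof.
move=> lD Fu Fk i j.
apply: (@Ck_ext _ _ (fun x => (\det (F x))^-1 *
   ((-1) ^+ (j + i) * \det (row' j (col' i (F x)))))) => //.
  by move=> x Dx; rewrite /invmx Fu// !mxE.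
apply: CkM => //.
  apply: CkV => //; last exact: Ck_det.
  by move=> x /Fu; rewrite unitmxE unitfE.
apply: CkM => //; first exact: Ck_cst.
apply: Ck_det => // a b; apply: Ck_ext (Fk (lift j a) (lift i b)) => // x _.
by rewrite !mxE.
Qed.

(* Bootstrapping: the equations turn C^k solutions into C^(k+1) ones. *)
Lemma linear_system_smooth D (I : finType) (F : I -> 'rV[R]_m -> R)
    (W : 'I_m -> I -> I -> 'rV[R]_m -> R) : lorthant D ->
  (forall a u v, smooth D (W a u v)) -> (forall u x, D x -> wcont D (F u) x) ->
  (forall a u x, D x -> is_pd D a (F u) x (\sum_v W a u v x * F v x)) ->
  forall u, smooth D (F u).
Proof.
move=> lD Ws cF FW u k; elim: k u => [|k IH] u.
  by split=> //; apply/withinP; exact: cF.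
apply: (@Ck_intro _ _ _ (fun a x => \sum_v W a u v x * F v x)) => //.
- exact: cF.
- by move=> a x; exact: FW.
by move=> a; apply: Ck_sum => // v _; apply: CkM => //; exact: Ws.
Qed.

End SmoothFunctions.

(** * Mean value theorem, Frechet differentiability and symmetry of second derivatives *)

Section MeanValue.
Context {R : realType} {m : nat}.
Implicit Types (D : set 'rV[R]_m) (f g : 'rV[R]_m -> R) (x y : 'rV[R]_m).
Implicit Types (a b : 'I_m) (e h s t : R).

(** The classical theorem for s |-> f (x + s t e_a) on [0, 1]. At the two ends only a one-sided
    derivative is available, but it still gives the continuity required there, so the segment may
    end on the boundary. *)
Lemma pd_MVT D a f (df : 'rV[R]_m -> R) x (t : R) :
  (forall s : R, 0 <= s <= 1 -> D (x + (s * t) *: delta_mx 0 a)) ->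
  (forall s : R, 0 <= s <= 1 -> let y := x + (s * t) *: delta_mx 0 a in
     is_pd D a f y (df y)) ->
  exists2 s : R, 0 <= s <= 1 &
    f (x + t *: delta_mx 0 a) - f x = df (x + (s * t) *: delta_mx 0 a) * t.
Proof.
move=> xD fdf; have [->|t0] := eqVneq t 0.
  by exists 0; [rewrite lexx ler01|rewrite !scale0r !addr0 subrr mulr0].
pose g s := f (x + (s * t) *: delta_mx 0 a).
have shs s h : x + (s * t) *: delta_mx 0 a + (h * t) *: delta_mx 0 a =
    x + ((h + s) * t) *: delta_mx 0 a 
  by rewrite -addrA -scalerDl -mulrDl [h + s]addrC.
have gs s : 0 <= s <= 1 -> forall e, 0 < e -> exists2 r : R, 0 < r &
    forall h, h != 0 -> `|h| < r -> 0 <= h + s <= 1 ->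
      `|h^-1 * (g (h + s) - g s) - t * df (x + (s * t) *: delta_mx 0 a)| < e.
  move=> s01 e e0; have /is_pdP/(_ (e / `|t|)) := fdf s s01.
  rewrite divr_gt0 ?normr_gt0// => /(_ isT)[r r0 rP].
  exists (r / `|t|); first by rewrite divr_gt0 ?normr_gt0.
  move=> h h0; rewrite ltr_pdivlMr ?normr_gt0// -normrM => hr hs.
  have ht0 : h * t != 0 by rewrite mulf_neq0.
  have := rP _ ht0 hr; rewrite shs => /(_ (xD _ hs)).
  rewrite ltr_pdivlMr ?normr_gt0// -normrM; congr (`|_| < e).
  rewrite /dquot shs /g; field; by rewrite h0 t0.
have gd (s : R) : s \in `]0, 1[%R ->
    is_derive s 1 g (t * df (x + (s * t) *: delta_mx 0 a)).
  rewrite in_itv /= => /andP[s0 s1].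
  have s01 : 0 <= s <= 1 by rewrite !ltW.
  have gl : (fun h => h^-1 *: ((g \o shift s) (h *: 1) - g s)) @ (0 : R)^' -->
      t * df (x + (s * t) *: delta_mx 0 a).
    apply/cvgrPdist_lt => e e0; have [r r0 rP] := gs s s01 e e0.
    apply/nbhs_ballP; exists (Num.min r (Num.min s (1 - s))) => /=.
      by rewrite !lt_min r0 s0 subr_gt0.
    move=> h; rewrite /ball /= sub0r normrN !lt_min => /and3P[hr hs hs1] h0.
    rewrite distrC /GRing.scale /= mulr1; apply: rP => //.
    have := ltr_norml h s; rewrite hs => /esym/andP[hs' _].
    have := ltr_norml h (1 - s); rewrite hs1 => /esym/andP[_ hs1'].
    by apply/andP; split; lra.
  split; first by apply/cvg_ex; eexists; exact: gl.
  exact: cvg_lim gl.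
have gc : {within `[0, 1], continuous g}.
  apply/subspace_continuousP => s /=; rewrite in_itv /= => s01.
  apply/cvgrPdist_lt => e e0; have [r r0 rP] := gs s s01 1 ltr01.
  (* [M] bounds the difference quotients near [s], so [e / M] is a modulus of continuity. *)
  pose M := 1 + `|t * df (x + (s * t) *: delta_mx 0 a)|.
  have M0 : 0 < M by rewrite ltr_wpDr.
  apply/nbhs_ballP; exists (Num.min r (e / M)) => /=.
    by rewrite lt_min r0 divr_gt0.
  move=> u; rewrite /ball /= lt_min distrC => /andP[ur ue].
  rewrite in_itv /= => u01.
  have [->|us] := eqVneq u s; first by rewrite subrr normr0.
  have h0 : u - s != 0 by rewrite subr_eq0.
  have := rP _ h0 ur; rewrite subrK => /(_ u01) lt1.
  have q1 : `|(u - s)^-1 * (g u - g s)| < M.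
    rewrite -ltrBlDr; apply: le_lt_trans lt1.
    exact: le_trans (lerB_dist _ _) _.
  rewrite distrC -[g u - g s](mulVKf h0) normrM.
  apply: le_lt_trans (_ : `|u - s| * M < e); first by rewrite ler_wpM2l// ltW.
  by rewrite -ltr_pdivlMr.
have [s] := MVT ltr01 gd gc.
rewrite in_itv /= subr0 mulr1 => /andP[s0 s1] gE.
exists s; first by rewrite !ltW.
by rewrite mulrC -gE /g mul1r mul0r scale0r addr0.
Qed.

Lemma near_within_cube D x (P : 'rV[R]_m -> Prop) :
  (\forall y \near within D (nbhs x), P y) <->
  exists2 r : R, 0 < r & forall y, cube x r y -> D y -> P y.
Proof. by split=> [/nbhs_cubeP[r r0 rP]|[r r0 rP]]; [exists r => // y yr|apply/nbhs_cubeP; exists r => // y yr]; exact: rP. Qed.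

Definition box x y : set 'rV[R]_m :=
  [set z | forall b, exists2 u : R, 0 <= u <= 1 &
     z 0 b = x 0 b + u * (y 0 b - x 0 b)].

(** Coordinates are changed one at a time, so each step is a mean value theorem along an axis and
    the path stays in the box. With [l] the gradient at [x] this yields Frechet differentiability,
    with [l] zero a Lipschitz bound. *)
Lemma box_variation D f (df : 'I_m -> 'rV[R]_m -> R) (l : 'I_m -> R) e x y :
  (forall z, box x y z ->
   D z /\ forall a, is_pd D a f z (df a z) /\ `|df a z - l a| <= e) ->
  `|f y - f x - \sum_a l a * (y 0 a - x 0 a)| <= e * \sum_a `|y 0 a - x 0 a|.
Proof.
move=> Dxy.
pose z k : 'rV[R]_m := \row_b (if (b < k)%N then y 0 b else x 0 b).
have z0 : z 0%N = x by apply/rowP => b; rewrite mxE.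
have zm : z m = y by apply/rowP => b; rewrite mxE ltn_ord.
have zS (k : 'I_m) : z k.+1 = z k + (y 0 k - x 0 k) *: delta_mx 0 k.
  apply/rowP => b; rewrite shiftE !mxE ltnS leq_eqVlt val_eqE.
  case: (eqVneq b k) => [->|_]; last by rewrite mulr0 addr0.
  by rewrite ltnn mulr1 addrC subrK.
have zD (k : 'I_m) s : 0 <= s <= 1 ->
    let w := z k + (s * (y 0 k - x 0 k)) *: delta_mx 0 k in
    D w /\ forall a, is_pd D a f w (df a w) /\ `|df a w - l a| <= e.
  move=> /andP[s0 s1] w; apply: Dxy => b.
  rewrite shiftE !mxE; case: (eqVneq b k) => [->|bk].
    by exists s; rewrite ?s0 ?s1// ltnn mulr1.
  rewrite mulr0 addr0; case: ifP => _.
    by exists 1; rewrite ?lexx ?ler01// mul1r addrC subrK.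
  by exists 0; rewrite ?lexx ?ler01// mul0r addr0.
have zd (k : 'I_m) : `|f (z k.+1) - f (z k) - l k * (y 0 k - x 0 k)| <=
    e * `|y 0 k - x 0 k|.
  rewrite zS.
  have [||s s01 ->] := @pd_MVT D k f (df k) (z k) (y 0 k - x 0 k).
  - by move=> s /(zD k)[].
  - by move=> s /(zD k)[_ /(_ k)[]].
  rewrite -mulrBl normrM ler_wpM2r//.
  by have [_ /(_ k)[]] := zD k s s01.
have -> : f y - f x = \sum_(k < m) (f (z k.+1) - f (z k)).
  by rewrite -{1}zm -{1}z0 -(telescope_sumr (fun k => f (z k)) (leq0n m)) big_mkord.
rewrite -sumrB mulr_sumr; apply: le_trans (ler_norm_sum _ _ _) _.
by apply: ler_sum => k _; exact: zd.
Qed.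

Lemma cube_box x y z w (r : R) : cube x r y -> cube x r z ->
  box y z w -> cube x r w.
Proof.
move=> yr zr wyz b; have [u /andP[u0 u1] ->] := wyz b.
have := yr b; have := zr b; rewrite !ltr_norml => /andP[? ?] /andP[? ?].
by case: (lerP (y 0 b) (z 0 b)) => ?; apply/andP; split; nra.
Qed.

Lemma frechet D f (df : 'I_m -> 'rV[R]_m -> R) x : lorthant D -> D x ->
  (forall a y, D y -> is_pd D a f y (df a y)) ->
  (forall a, wcont D (df a) x) ->
  forall e, 0 < e -> exists2 r : R, 0 < r & forall y, cube x r y -> D y ->
   `|f y - f x - \sum_a df a x * (y 0 a - x 0 a)| <=
     e * \sum_a `|y 0 a - x 0 a|.
Proof.
move=> lD Dx fdf cdf e e0.
have : \forall y \near within D (nbhs x), forall a, `|df a y - df a x| < e.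
  pose P a y := `|df a y - df a x| < e.
  suff dP a : \forall y \near within D (nbhs x), P a y.
    exact: (@filter_forall _ _ P _ _ dP).
  by apply/near_within_cube; have /wcontP := cdf a; exact.
move=> /near_within_cube[r1 r10 r1P].
have [S [Sx [r2 r20 r2P]]] := lorthant_cube lD Dx.
exists (Num.min r1 r2) => [|y]; first by rewrite lt_min r10.
move=> yr Dy.
have yr2 : cube x r2 y by apply: cubeW yr; rewrite ge_min lexx orbT.
have Sy : orthant S y by apply/r2P.
apply: (@box_variation D f df) => z zP.
have zr : cube x (Num.min r1 r2) z.
  by apply: cube_box yr zP; apply: cube_center; rewrite lt_min r10.
have Dz : D z.
  apply/r2P; first by apply: cubeW zr; rewrite ge_min lexx orbT.
  move=> b Sb; have [u /andP[u0 u1] ->] := zP b.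
  have := Sx b Sb; have := Sy b Sb; nra.
split=> // a; split; first exact: fdf.
by apply/ltW/r1P => //; apply: cubeW zr; rewrite ge_min lexx.
Qed.

Lemma schwarz D f fa fb fab fba x a b : lorthant D -> D x ->
  (forall y, D y -> is_pd D a f y (fa y)) ->
  (forall y, D y -> is_pd D b f y (fb y)) ->
  (forall y, D y -> is_pd D b fa y (fab y)) ->
  (forall y, D y -> is_pd D a fb y (fba y)) ->
  wcont D fab x -> wcont D fba x -> fab x = fba x.
Proof.
move=> lD Dx.
(* The mixed second difference, evaluated by two mean value theorems. Only positive increments
   occur, so all points stay in the orthant; comparing the two orders of differentiation then gives
   the claim. *)
have key c d g gc gcd r : (forall y, D y -> is_pd D c g y (gc y)) ->
    (forall y, D y -> is_pd D d gc y (gcd y)) -> 0 < r ->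
    exists2 t, 0 < t < r & forall u, 0 < u <= t -> exists2 y, D y /\ cube x r y &
      g (x + u *: delta_mx 0 c + u *: delta_mx 0 d) - g (x + u *: delta_mx 0 c)
      - (g (x + u *: delta_mx 0 d) - g x) = gcd y * (u * u).
  move=> gP gcP r0; have [S [Sx [s s0 sP]]] := lorthant_cube lD Dx.
  have [h h0 hP] : exists2 h, 0 < h & h < r / 2 /\ h < s / 2.
    exists (Num.min r s / 4); first by rewrite divr_gt0// lt_min r0.
    have : Num.min r s <= r by rewrite ge_min lexx.
    have : Num.min r s <= s by rewrite ge_min lexx orbT.
    have : 0 < Num.min r s by rewrite lt_min r0.
    by move: (Num.min r s) => w; split; lra.
  exists h; first by apply/andP; split=> //; lra.
  move=> u /andP[u0 uh].
  have inD v w : 0 <= v <= 1 -> 0 <= w <= 1 ->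
      let y := x + (v * u) *: delta_mx 0 c + (w * u) *: delta_mx 0 d in
      D y /\ cube x r y.
    move=> /andP[v0 v1] /andP[w0 w1] y.
    have yc t : h < t / 2 -> cube x t y.
      move=> ht e; rewrite !shiftE.
      rewrite (_ : _ - _ = v * u * (e == c)%:R + w * u * (e == d)%:R); last by ring.
      rewrite ger0_norm; last first.
        by rewrite addr_ge0// !mulr_ge0// ltW.
      have : v * u * (e == c)%:R <= u.
        by case: (e == c); rewrite ?mulr1 ?mulr0; nra.
      have : w * u * (e == d)%:R <= u.
        by case: (e == d); rewrite ?mulr1 ?mulr0; nra.
      by lra.
    split; last by apply: yc; case: hP.
    apply/sP; first by apply: yc; case: hP.
    by do 2?[apply: orthant_shift; last by rewrite mulr_ge0// ltW].
  (* The domain on which both terms of the difference [phi] are controlled. *)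
  pose E y := D y /\ D (y + u *: delta_mx 0 d).
  pose phi y := g (y + u *: delta_mx 0 d) - g y.
  have H01 : 0 <= (0 : R) <= 1 by rewrite lexx ler01.
  have H11 : 0 <= (1 : R) <= 1 by rewrite lexx ler01.
  have phiP y : E y -> is_pd E c phi y (gc (y + u *: delta_mx 0 d) - gc y).
    move=> [Dy Dyu]; apply: is_pdB.
      have /is_pdP fl := gP _ Dyu; apply/is_pdP => e /fl[q q0 qP].
      exists q => // t t0 tq [_]; rewrite addrAC => /(qP t t0 tq).
      by rewrite /dquot addrAC.
    apply: is_pd_local (gP y Dy) => //.
    by exists 1 => // z _; split=> // [[]].
  have [||v v01] := @pd_MVT E c phi (fun y => gc (y + u *: delta_mx 0 d) - gc y) x u.
  - move=> v v01; split; first by have [] := inD v 0 v01 H01; rewrite mul0r scale0r addr0.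
    by have [] := inD v 1 v01 H11; rewrite mul1r.
  - move=> v v01 y; apply: phiP.
    split; first by have [] := inD v 0 v01 H01; rewrite mul0r scale0r addr0.
    by have [] := inD v 1 v01 H11; rewrite mul1r.
  rewrite /phi => ->.
  have [||w w01 ->] := @pd_MVT D d gc gcd (x + (v * u) *: delta_mx 0 c) u.
  - by move=> w w01; have [] := inD v w v01 w01.
  - by move=> w w01; apply: gcP; have [] := inD v w v01 w01.
  exists (x + (v * u) *: delta_mx 0 c + (w * u) *: delta_mx 0 d); first exact: inD.
  by rewrite mulrA.
move=> faP fbP fabP fbaP /wcontP cfab /wcontP cfba.
apply/eqP; rewrite -subr_eq0 -normr_le0; apply/ler_addgt0Pr => e e0; rewrite add0r.
have e20 : 0 < e / 2 by rewrite divr_gt0.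
have [r1 r10 r1P] := cfab _ e20; have [r2 r20 r2P] := cfba _ e20.
have [t1 /andP[t10 _] t1P] := key a b f fa fab r1 faP fabP r10.
have [t2 /andP[t20 _] t2P] := key b a f fb fba r2 fbP fbaP r20.
pose u := Num.min t1 t2.
have u0 : 0 < u by rewrite lt_min t10.
have [|y [Dy yr] yE] := t1P u; first by rewrite u0 ge_min lexx.
have [|z [Dz zr] zE] := t2P u; first by rewrite u0 ge_min lexx orbT.
have : fab y * (u * u) = fba z * (u * u).
  rewrite -yE -zE [x + u *: delta_mx 0 b + u *: delta_mx 0 a]addrAC; ring.
move=> /(mulIf _) yz; have {yz}yz : fab y = fba z by apply: yz; rewrite mulf_neq0// gt_eqF.
have /ltW := r1P y yr Dy; have /ltW := r2P z zr Dz.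
rewrite -yz distrC => h1; rewrite distrC => h2.
have -> : fab x - fba x = (fab x - fab y) - (fba x - fab y) by ring.
apply: le_trans (ler_normB _ _) _; rewrite distrC in h1; rewrite distrC in h1; lra.
Qed.

End MeanValue.

Section ChainRule.
Context {R : realType} {m m' : nat}.

Lemma cvg_sumr {T : Type} (F : set_system T) (I : Type) (r : seq I)
    (f : I -> T -> R) (l : I -> R) : Filter F ->
  (forall i, f i @ F --> l i) ->
  (fun x => \sum_(i <- r) f i x) @ F --> \sum_(i <- r) l i.
Proof.
move=> FF fl; elim: r => [|i r IH].
  by rewrite big_nil; under eq_fun do rewrite big_nil; exact: cvg_cst.
by rewrite big_cons; under eq_fun do rewrite big_cons; exact: cvgD.
Qed.

(** Partial derivatives alone do not compose. The continuity of [df] at [phi x] supplies the Frechet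
    expansion of [f], and its remainder [r] is negligible because the difference quotients of [phi]
    stay bounded. *)
Lemma is_pd_chain (D : set 'rV[R]_m) (D' : set 'rV[R]_m')
    (phi : 'rV[R]_m -> 'rV[R]_m') (f : 'rV[R]_m' -> R)
    (df : 'I_m' -> 'rV[R]_m' -> R) (l : 'I_m' -> R) (a : 'I_m) (x : 'rV[R]_m) :
  lorthant D' -> D x -> (forall y, D y -> D' (phi y)) ->
  (forall b, is_pd D a (fun y => phi y 0 b) x (l b)) ->
  (forall b y, D' y -> is_pd D' b f y (df b y)) ->
  (forall b, wcont D' (df b) (phi x)) ->
  is_pd D a (f \o phi) x (\sum_b df b (phi x) * l b).
Proof.
move=> lD' Dx DD' phil fdf cdf.
pose q b h := dquot a (fun y => phi y 0 b) x h.
pose r h := h^-1 * (f (phi (x + h *: delta_mx 0 a)) - f (phi x) -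
  \sum_b df b (phi x) * (phi (x + h *: delta_mx 0 a) 0 b - phi x 0 b)).
have FF : Filter (punctured D a x) by exact: within_filter.
have ql b : q b @ punctured D a x --> l b by exact: phil.
have nq : (fun h => \sum_b `|q b h|) @ punctured D a x --> \sum_b `|l b|.
  by apply: cvg_sumr => b; exact: cvg_norm.
have rl : r @ punctured D a x --> (0 : R).
  apply/cvgrPdist_le => e e0.
  pose M := 1 + \sum_b `|l b|.
  have M0 : 0 < M by rewrite ltr_wpDr// sumr_ge0.
  have [s s0 sP] := frechet lD' (DD' _ Dx) fdf cdf (divr_gt0 e0 M0).
  have nM : \forall h \near punctured D a x, \sum_b `|q b h| < M.
    by apply: cvgr_lt nq _ _; rewrite ltrDr.
  have nc : \forall h \near punctured D a x, cube (phi x) s (phi (x + h *: delta_mx 0 a)).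
    pose P b h := `|phi (x + h *: delta_mx 0 a) 0 b - phi x 0 b| < s.
    suff nP b : \forall h \near punctured D a x, P b h.
      exact: (@filter_forall _ _ P _ FF nP).
    have /cvgrPdist_lt/(_ s s0) := is_pd_cvg (phil b).
    by apply: filterS => h; rewrite distrC.
  have nD : \forall h \near punctured D a x, h != 0 /\ D (x + h *: delta_mx 0 a).
    by apply/near_punctured; exists 1.
  apply: filterS3 nM nc nD => h hM hc [h0 Dh]; rewrite sub0r normrN /r normrM.
  apply: le_trans (ler_wpM2l (normr_ge0 _) (sP _ hc (DD' _ Dh))) _.
  rewrite mulrCA mulr_sumr.
  have -> : \sum_i `|h^-1| * `|phi (x + h *: delta_mx 0 a) 0 i - phi x 0 i| =
      \sum_b `|q b h| by apply: eq_bigr => b _; rewrite -normrM.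
  by rewrite mulrAC ler_pdivrMr// ler_wpM2l// ltW.
have sl : (fun h => \sum_b df b (phi x) * q b h) @ punctured D a x -->
    \sum_b df b (phi x) * l b.
  by apply: cvg_sumr => b; apply: cvgM; [exact: cvg_cst|exact: ql].
have rs : (fun h => r h + \sum_b df b (phi x) * q b h) @ punctured D a x -->
    0 + \sum_b df b (phi x) * l b by exact: cvgD.
rewrite add0r in rs; apply: cvg_punctured_eq rs => h h0 _.
rewrite /r mulrBr mulr_sumr -addrA -sumrN -big_split /= big1 ?addr0// => b _.
by rewrite /q /dquot; ring.
Qed.

End ChainRule.

(** * Passage from the interior to the boundary along the normal *)

Section BoundaryExtension.
Context {R : realType} {n : nat}.
Implicit Types (D : set 'rV[R]_n.+1) (f g : 'rV[R]_n.+1 -> R).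
Implicit Types (x y : 'rV[R]_n.+1) (a b : 'I_n.+1) (e h t : R).

Definition hopen D := exists2 O : set 'rV[R]_n.+1, open O & D = O `&` halfspace.

Definition hint D := D `&` [set x | 0 < x 0 0].

Lemma halfspaceE : @halfspace R n = orthant (pred1 0).
Proof.
by apply/seteqP; split=> x /= Hx => [a /eqP->|]; [exact: Hx|exact: Hx].
Qed.

Lemma hopen_lorthant D : hopen D -> lorthant D.
Proof. by move=> [V oV ->]; exists (pred1 0), V; rewrite halfspaceE. Qed.

Lemma hint_sub D : hint D `<=` D. Proof. by move=> x []. Qed.

Lemma hopen_ge0 D x : hopen D -> D x -> 0 <= x 0 0.
Proof. by move=> [V _ ->] []. Qed.

Lemma open_gt0 : open [set x : 'rV[R]_n.+1 | 0 < x 0 0].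
Proof.
rewrite (_ : [set _ | _] = (fun x : 'rV[R]_n.+1 => x 0 0) @^-1` [set t | 0 < t])//.
apply: open_comp; first by move=> x _; exact: coord_continuous.
exact: open_gt.
Qed.

Lemma lorthant_hint D : hopen D -> lorthant (hint D).
Proof.
by move=> hD; apply: lorthantI; [exact: hopen_lorthant|exact: open_gt0].
Qed.

Lemma hopen_cube D x : hopen D -> D x -> exists2 r : R, 0 < r &
  forall y, cube x r y -> 0 <= y 0 0 -> D y.
Proof.
move=> [V oV ->] [Vx _]; have /nbhs_cubeP[r r0 rV] : nbhs x V.
  exact: open_nbhs_nbhs.
by exists r => // y yr y0; split=> //; exact: rV.
Qed.

Lemma near_up D x (r : R) : hopen D -> D x -> 0 < r ->
  \forall t \near (0 : R)^'+, hint D (x + t *: delta_mx 0 0) /\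
    cube x r (x + t *: delta_mx 0 0).
Proof.
move=> hD Dx r0; have [s s0 sD] := hopen_cube hD Dx.
have x0 := hopen_ge0 hD Dx.
near=> t.
have t0 : 0 < t by near: t; exact: nbhs_right_gt.
split; last by apply: cube_shift; rewrite gtr0_norm//; near: t; exact: nbhs_right_lt.
have xt : 0 < (x + t *: delta_mx 0 0) 0 0 by rewrite shiftE mulr1 ltr_wpDl.
split=> //; apply: sD; last exact: ltW.
by apply: cube_shift; rewrite gtr0_norm//; near: t; exact: nbhs_right_lt.
Unshelve. all: by end_near. Qed.

Lemma up_cvg D f x : hopen D -> D x -> wcont D f x ->
  f (x + t *: delta_mx 0 0) @[t --> (0 : R)^'+] --> f x.
Proof.
move=> hD Dx /wcontP cf; apply/cvgrPdist_lt => e /cf[r r0 rP].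
apply: filterS (near_up hD Dx r0) => t [[Dt _] tr].
by rewrite distrC; exact: rP.
Qed.

Lemma wcont_hint_eq D f g x : hopen D -> D x -> wcont D f x -> wcont D g x ->
  (forall y, hint D y -> f y = g y) -> f x = g x.
Proof.
move=> hD Dx cf cg fg.
have fl := up_cvg hD Dx cf.
have gl : f (x + t *: delta_mx 0 0) @[t --> (0 : R)^'+] --> g x.
  have := up_cvg hD Dx cg; apply: cvg_trans; apply: near_eq_cvg.
  by apply: filterS (near_up hD Dx ltr01) => t [Dt _]; rewrite fg.
by rewrite -(cvg_lim (@Rhausdorff R) fl) -(cvg_lim (@Rhausdorff R) gl).
Qed.

(** The segment from [x] to [x + h e_a] is pushed by [t] into the interior, where the mean value
    theorem applies with a bound independent of [t]; continuity of [f] permits letting [t] tend to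
    0. *)
Lemma is_pd_up D f g a : hopen D -> (forall x, D x -> wcont D f x) ->
  (forall x, D x -> wcont D g x) ->
  (forall x, hint D x -> is_pd (hint D) a f x (g x)) ->
  forall x, D x -> is_pd D a f x (g x).
Proof.
move=> hD cf cg fg x Dx; apply/is_pdP => e e0.
have e20 : 0 < e / 2 by rewrite divr_gt0.
have /wcontP/(_ _ e20)[r1 r10 r1P] := cg x Dx.
have [r2 r20 r2P] := hopen_cube hD Dx.
pose r := Num.min r1 r2.
have r0 : 0 < r by rewrite lt_min r10.
exists (r / 2) => [|h h0 hr Dh]; first by rewrite divr_gt0.
have x0 := hopen_ge0 hD Dx; have xh0 := hopen_ge0 hD Dh.
pose d := f (x + h *: delta_mx 0 a) - f x - g x * h.
suff dh : `|d| <= e / 2 * `|h|.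
  have -> : dquot a f x h - g x = h^-1 * d by rewrite /dquot /d; field.
  have hh : 0 < `|h| by rewrite normr_gt0.
  rewrite normrM normfV mulrC ltr_pdivrMr//; apply: le_lt_trans dh _.
  by rewrite ltr_pM2r//; lra.
pose dt t := f (x + h *: delta_mx 0 a + t *: delta_mx 0 0) -
  f (x + t *: delta_mx 0 0) - g x * h.
have dtl : `|dt t| @[t --> (0 : R)^'+] --> `|d|.
  apply: cvg_norm; apply: cvgB; last exact: cvg_cst.
  by apply: cvgB; [exact: up_cvg (cf _ Dh)|exact: up_cvg (cf _ Dx)].
apply: (cvgr_to_le dtl); near=> t.
have t0 : 0 < t by near: t; exact: nbhs_right_gt.
have tr : t < r / 2 by near: t; apply: nbhs_right_lt; rewrite divr_gt0.
pose y s : 'rV[R]_n.+1 := x + t *: delta_mx 0 0 + (s * h) *: delta_mx 0 a.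
have yD s : 0 <= s <= 1 -> hint D (y s) /\ cube x r (y s).
  move=> /andP[s0 s1].
  have yr : cube x r (y s).
    move=> b; rewrite !shiftE.
    rewrite (_ : _ - _ = t * (b == 0)%:R + s * h * (b == a)%:R); last by ring.
    apply: le_lt_trans (ler_normD _ _) _.
    rewrite !normrM !normr_nat (ger0_norm s0) (gtr0_norm t0).
    have : t * (b == 0)%:R <= t by case: (b == 0); rewrite ?mulr1 ?mulr0// ltW.
    have : s * `|h| * (b == a)%:R <= `|h|.
      case: (b == a); rewrite ?mulr1 ?mulr0//; have := normr_ge0 h; nra.
    by lra.
  have y0 : 0 < y s 0 0.
    rewrite !shiftE mulr1; move: xh0; rewrite shiftE; set k := _%:R.
    by nra.
  split=> //; split=> //; apply: r2P; last exact: ltW.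
  by apply: cubeW yr; rewrite ge_min lexx orbT.
have [||s s01] := @pd_MVT _ _ (hint D) a f g (x + t *: delta_mx 0 0) h.
- by move=> s /yD[].
- by move=> s /yD[Dy _]; exact: fg.
rewrite addrAC /dt => ->; rewrite -mulrBl normrM ler_wpM2r// ltW//.
have [[Dy _] yr] := yD s s01; apply: r1P => //.
by apply: cubeW yr; rewrite ge_min lexx.
Unshelve. all: by end_near. Qed.

End BoundaryExtension.

(** * Boundary extension of solutions of linear systems *)

Section LinearSystemExtension.
Context {R : realType} {n : nat}.
Implicit Types (D : set 'rV[R]_n.+1) (f g : 'rV[R]_n.+1 -> R).
Implicit Types (x y : 'rV[R]_n.+1) (a b : 'I_n.+1) (e h t : R).

(** Boundary values are limits along the normal. The [lim] is meaningful only once convergence is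
    established, for solutions of linear systems in [bext_up_cvg]. *)
Definition bext f x : R :=
  if 0 < x 0 0 then f x
  else lim (f (x + t *: delta_mx 0 0) @[t --> (0 : R)^'+]).

Lemma bext_gt0 f x : 0 < x 0 0 -> bext f x = f x.
Proof. by rewrite /bext => ->. Qed.

Lemma bext_eq D f g x : hopen D -> D x -> wcont D g x ->
  (forall y, hint D y -> f y = g y) -> bext f x = g x.
Proof.
move=> hD Dx cg fg; rewrite /bext; case: ltP => x0; first exact: fg.
apply: cvg_lim => //; have := up_cvg hD Dx cg; apply: cvg_trans.
apply: near_eq_cvg; apply: filterS (near_up hD Dx ltr01) => t [Dt _].
by rewrite fg.
Qed.

Section Extension.
Variables (D : set 'rV[R]_n.+1) (I : finType).
Variables (F : I -> 'rV[R]_n.+1 -> R) (W : 'I_n.+1 -> I -> I -> 'rV[R]_n.+1 -> R).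
Hypothesis hD : hopen D.
Hypothesis Ws : forall a u v, smooth D (W a u v).
Hypothesis cF : forall u x, hint D x -> wcont (hint D) (F u) x.
Hypothesis FW : forall a u x, hint D x ->
  is_pd (hint D) a (F u) x (\sum_v W a u v x * F v x).

Lemma coef_bounded x0 : D x0 -> exists2 r : R, 0 < r & exists2 M : R, 0 <= M &
  forall a u v y, D y -> cube x0 r y -> `|W a u v y| <= M.
Proof.
move=> Dx0.
pose P (i : 'I_n.+1 * I * I) y := `|W i.1.1 i.1.2 i.2 y - W i.1.1 i.1.2 i.2 x0| < 1.
have : \forall y \near within D (nbhs x0), forall i, P i y.
  apply: (@filter_forall _ _ P) => i; apply/near_within_cube.
  have /wcontP := Ck_cont (Ws i.1.1 i.1.2 i.2 0) Dx0; exact.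
move=> /near_within_cube[r r0 rP]; exists r => //.
pose m i := `|W i.1.1 i.1.2 i.2 x0|.
exists (1 + \sum_(i : 'I_n.+1 * I * I) m i).
  by rewrite addr_ge0// sumr_ge0// => i _; exact: normr_ge0.
move=> a u v y Dy /rP/(_ Dy (a, u, v)); rewrite /P /= => h1.
have : m (a, u, v) <= \sum_(i : 'I_n.+1 * I * I) m i.
  rewrite (bigD1 (a, u, v))//= lerDl sumr_ge0// => i _; exact: normr_ge0.
rewrite /m /= => h2.
have := ler_normD (W a u v y - W a u v x0) (W a u v x0).
by rewrite subrK; lra.
Qed.

(* Gronwall's inequality along the normal direction, starting from a slice at
   positive distance from the boundary. *)
Lemma linear_system_bounded x0 : D x0 -> exists2 r : R, 0 < r &
  exists2 C : R, 0 <= C & forall u y, hint D y -> cube x0 r y -> `|F u y| <= C.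
Proof.
move=> Dx0; have x00 := hopen_ge0 hD Dx0.
have [r1 r10 r1D] := hopen_cube hD Dx0.
have [r2 r20 [M M0 MW]] := coef_bounded Dx0.
pose r := Num.min r1 r2.
have r0 : 0 < r by rewrite lt_min r10.
(* The centre of the reference slice. It is an interior point, so [F] is bounded near it by mere
   continuity. *)
pose c := x0 + (r / 2) *: delta_mx 0 0.
have cr : cube x0 r c by apply: cube_shift; rewrite gtr0_norm; lra.
have cD : hint D c.
  have c0 : 0 < c 0 0 by rewrite shiftE mulr1; lra.
  split=> //; apply: r1D; last exact: ltW.
  by apply: cubeW cr; rewrite ge_min lexx.
have [d1 d10 [B B0 BF]] : exists2 d : R, 0 < d & exists2 B : R, 0 <= B &
    forall u y, hint D y -> cube c d y -> `|F u y| <= B.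
  pose P u y := `|F u y - F u c| < 1.
  have : \forall y \near within (hint D) (nbhs c), forall u, P u y.
    apply: (@filter_forall _ _ P) => u; apply/near_within_cube.
    have /wcontP := cF (u := u) cD; exact.
  move=> /near_within_cube[d d0 dP]; exists d => //.
  exists (1 + \sum_u `|F u c|); first by rewrite addr_ge0// sumr_ge0.
  move=> u y Dy /dP/(_ Dy u); rewrite /P /= => h1.
  have : `|F u c| <= \sum_u `|F u c| by rewrite (bigD1 u)//= lerDl sumr_ge0.
  have := ler_normD (F u y - F u c) (F u c).
  by rewrite subrK; lra.
pose d := Num.min d1 (r / 2).
have d0 : 0 < d by rewrite lt_min d10 divr_gt0.
have dr : d <= r / 2 by rewrite ge_min lexx orbT.
have dd1 : d <= d1 by rewrite ge_min lexx.
exists d => //.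
pose N : R := #|I|%:R.
(* Since |d_0 phi| is at most 2 M N phi for phi the sum of squares of [F], the weight exp(K x_0)
   makes [psi] nondecreasing in the normal direction. Values near the boundary are thus dominated by
   those on the slice. *)
pose K : R := 2 * (M * N).
pose phi y := \sum_u F u y * F u y.
pose psi y := phi y * expR (K * y 0 0).
pose dphi y := \sum_u ((\sum_v W 0 u v y * F v y) * F u y +
                       F u y * (\sum_v W 0 u v y * F v y)).
pose dpsi y := dphi y * expR (K * y 0 0) + phi y * (expR (K * y 0 0) * K).
have psiP y : hint D y -> is_pd (hint D) 0 psi y (dpsi y).
  move=> Dy; apply: is_pdM.
    by apply: is_pd_sum => u _; apply: is_pdM; exact: FW.
  apply: (is_pd_comp (phi := expR)) => //; first exact: lorthant_hint.
  have := is_pdM (@is_pd_cst _ _ (hint D) 0 y K) (@is_pd_coord _ _ (hint D) 0 0 y).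
  by rewrite mul0r add0r eqxx mulr1.
have N0 : 0 <= N by rewrite ler0n.
have K0 : 0 <= K by rewrite !mulr_ge0.
have phi0 y : 0 <= phi y.
  by apply: sumr_ge0 => u _; rewrite -expr2 sqr_ge0.
have dpsi0 y : hint D y -> cube x0 r y -> 0 <= dpsi y.
  move=> [Dy y0] yr.
  suff : - dphi y <= K * phi y.
    move=> h; rewrite /dpsi [expR _ * K]mulrC mulrA -mulrDl mulr_ge0 ?expR_ge0//.
    by lra.
  have WF u : - ((\sum_v W 0 u v y * F v y) * F u y) <=
      M * ((\sum_v F v y * F v y) + N * (F u y * F u y)) / 2.
    rewrite mulr_suml -sumrN.
    have -> : M * ((\sum_v F v y * F v y) + N * (F u y * F u y)) / 2 =
        \sum_(v : I) M * (F v y * F v y + F u y * F u y) / 2.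
      rewrite -mulr_suml -mulr_sumr big_split /=; congr (_ * (_ + _) / _).
      by rewrite sumr_const mulr_natl.
    apply: ler_sum => v _.
    have : `|W 0 u v y| <= M by apply: MW => //; apply: cubeW yr; rewrite ge_min lexx orbT.
    rewrite ler_norml => /andP[w1 w2].
    set w := W _ _ _ _ in w1 w2 *; set p := F v y; set q := F u y.
    have h1 : 0 <= (M + w) * ((p + q) * (p + q)).
      by apply: mulr_ge0; [lra|rewrite -expr2 sqr_ge0].
    have h2 : 0 <= (M - w) * ((p - q) * (p - q)).
      by apply: mulr_ge0; [lra|rewrite -expr2 sqr_ge0].
    by rewrite ler_pdivlMr//; lra.
  have : - dphi y <= \sum_u 2 * (M * ((\sum_v F v y * F v y) + N * (F u y * F u y)) / 2).
    rewrite -sumrN; apply: ler_sum => u _; have := WF u.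
    by rewrite [F u y * \sum__ _]mulrC; lra.
  move=> h; apply: le_trans h _.
  rewrite -mulr_sumr -mulr_suml -mulr_sumr big_split /= -mulr_sumr sumr_const.
  rewrite -/(phi y) -mulr_natl -/N /K; lra.
pose C2 := N * (B * B) * expR (K * (x0 0 0 + r)).
(* A bound [C2] on the square of [F] gives 1 + C2 for [F] itself without a square root. *)
exists (1 + C2) => [|u y Dy yd].
  by rewrite addr_ge0// !mulr_ge0// expR_ge0.
(* The normal distance from [y] to the height of [c]. *)
pose h := x0 0 0 + r / 2 - y 0 0.
have y0 : 0 < y 0 0 by case: Dy.
have h0 : 0 < h.
  by have := yd 0; rewrite ltr_norml /h => /andP[_]; lra.
have yh b s : 0 <= s <= 1 -> `|(y + (s * h) *: delta_mx 0 0) 0 b - x0 0 b| < r /\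
    (s = 1 -> `|(y + (s * h) *: delta_mx 0 0) 0 b - c 0 b| < d1).
  move=> /andP[s0 s1]; rewrite !shiftE.
  have := yd b; rewrite !ltr_norml => /andP[e1 e2].
  have [bE|_] := eqVneq b 0; last first.
    by rewrite !mulr0 !addr0; split=> [|_]; apply/andP; split; lra.
  rewrite bE in e1 e2 *; rewrite !mulr1; split=> [|->].
    by rewrite /h in h0 *; apply/andP; split; nra.
  by rewrite mul1r /h; apply/andP; split; lra.
have yhD s : 0 <= s <= 1 -> hint D (y + (s * h) *: delta_mx 0 0).
  move=> s01; have /andP[s0 s1] := s01.
  have Y0 : 0 < (y + (s * h) *: delta_mx 0 0) 0 0.
    by rewrite shiftE mulr1; nra.
  split=> //; apply: r1D; last exact: ltW.
  by move=> b; have [Hb _] := yh b s s01; apply: lt_le_trans Hb _; rewrite ge_min lexx.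
have [||s s01] := @pd_MVT _ _ (hint D) 0 psi dpsi y h.
- exact: yhD.
- by move=> s s01; apply: psiP; exact: yhD.
have : 0 <= dpsi (y + (s * h) *: delta_mx 0 0) * h.
  rewrite mulr_ge0 ?(ltW h0)// dpsi0//; first exact: yhD.
  by move=> b; have [] := yh b s s01.
set q := dpsi _ * h => q0 psiE.
have H11 : 0 <= (1 : R) <= 1 by rewrite ler01 lexx.
have top : psi (y + h *: delta_mx 0 0) <= C2.
  rewrite /psi /C2; apply: ler_pM => //.
    rewrite /phi /N.
    have -> : #|I|%:R * (B * B) = \sum_(i : I) B * B by rewrite sumr_const mulr_natl.
    apply: ler_sum => v _.
    have : `|F v (y + h *: delta_mx 0 0)| <= B.
      apply: BF; first by have := yhD 1 H11; rewrite mul1r.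
      by move=> b; have [_ /(_ erefl)] := yh b 1 H11; rewrite mul1r.
    by rewrite ler_norml => /andP[? ?]; nra.
  rewrite ler_expR ler_wpM2l// shiftE mulr1 /h; lra.
have e1 : 1 <= expR (K * y 0 0).
  by rewrite -expR0 ler_expR mulr_ge0// ltW.
have bot : F u y * F u y <= psi y.
  have : F u y * F u y <= phi y.
    rewrite /phi (bigD1 u)//= lerDl sumr_ge0// => v _.
    by rewrite -expr2 sqr_ge0.
  by have := phi0 y; rewrite /psi; nra.
have : `|F u y| * `|F u y| <= C2.
  by rewrite -normrM ger0_norm -?expr2 ?sqr_ge0// expr2; lra.
by have := normr_ge0 (F u y); nra.
Qed.

(** The system converts bounds on [F] and on the coefficients into bounds on the derivatives; near
    [x0] the box between two interior points stays in the interior. *)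
Lemma linear_system_lipschitz x0 : D x0 -> exists2 r : R, 0 < r &
  exists2 L : R, 0 <= L & forall u x y, hint D x -> hint D y ->
    cube x0 r x -> cube x0 r y ->
    `|F u y - F u x| <= L * \sum_a `|y 0 a - x 0 a|.
Proof.
move=> Dx0.
have [r1 r10 [M M0 MW]] := coef_bounded Dx0.
have [r2 r20 [C C0 FC]] := linear_system_bounded Dx0.
have [r3 r30 r3D] := hopen_cube hD Dx0.
pose r := Num.min r1 (Num.min r2 r3).
have r0 : 0 < r by rewrite !lt_min r10 r20.
exists r => //; exists (#|I|%:R * (M * C)); first by rewrite !mulr_ge0.
move=> u x y [Dx x1] [Dy y1] xr yr.
have := @box_variation _ _ (hint D) (F u) (fun a z => \sum_v W a u v z * F v z)
  (fun _ => 0) (#|I|%:R * (M * C)) x y.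
rewrite big1 ?subr0 => [|? _]; last by rewrite mul0r.
apply=> z zxy; have zr := cube_box xr yr zxy.
have z0 : 0 < z 0 0.
  have [s /andP[s0 s1] ->] := zxy 0; rewrite /= in x1 y1.
  by case: (lerP (x 0 0) (y 0 0)) => ?; nra.
have Dz : D z.
  by apply: r3D; [apply: cubeW zr; rewrite !ge_min lexx !orbT|exact: ltW].
have hz : hint D z by [].
split=> // a; split; first exact: FW.
rewrite subr0; apply: le_trans (ler_norm_sum _ _ _) _.
have -> : #|I|%:R * (M * C) = \sum_(v : I) M * C by rewrite sumr_const mulr_natl.
apply: ler_sum => v _; rewrite normrM ler_pM//.
  by apply: MW => //; apply: cubeW zr; rewrite !ge_min lexx.
by apply: FC => //; apply: cubeW zr; rewrite !ge_min lexx !orbT.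
Qed.

(** At a boundary point the Lipschitz bound makes the values along the normal a Cauchy family. *)
Lemma bext_up_cvg u x : D x ->
  F u (x + t *: delta_mx 0 0) @[t --> (0 : R)^'+] --> bext (F u) x.
Proof.
move=> Dx; have [x0|x0] := ltP 0 (x 0 0).
  have hx : hint D x by [].
  rewrite bext_gt0//; apply/cvgrPdist_lt => e e0.
  have /wcontP/(_ e e0)[r r0 rP] := cF (u := u) hx.
  apply: filterS (near_up hD Dx r0) => t [Dt tr].
  by rewrite distrC; exact: rP.
rewrite /bext ltNge x0 /=.
have [r r0 [L L0 LF]] := linear_system_lipschitz Dx.
suff : cvg (F u (x + t *: delta_mx 0 0) @[t --> (0 : R)^'+]) by [].
apply/cauchy_cvgP/cauchyP => e e0.
have near1 := near_up hD Dx r0.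
have e1 : 0 < e / (2 * L + 1) by rewrite divr_gt0//; lra.
have near2 : \forall t \near (0 : R)^'+, 0 < t < e / (2 * L + 1).
  by near=> t; apply/andP; split; near: t;
    [exact: nbhs_right_gt|exact: nbhs_right_lt].
have [t [[Dt tr] /andP[t0 te]]] := filter_ex (filterI near1 near2).
exists (F u (x + t *: delta_mx 0 0)); rewrite nbhs_simpl /=.
apply: filterS2 near1 near2 => s [Ds sr] /andP[s0 se].
rewrite /ball /=.
have := LF u _ _ Ds Dt sr tr.
rewrite (bigD1 0)//= big1 ?addr0 => [|b b0]; last first.
  by rewrite !shiftE (negbTE b0) !mulr0 subrr normr0.
rewrite !shiftE !mulr1 => h; apply: le_lt_trans h _.
have : `|x 0 0 + t - (x 0 0 + s)| <= e / (2 * L + 1) by rewrite ler_norml; apply/andP; split; lra.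
set q := e / _ in e1 *; have -> : e = q * (2 * L + 1) by rewrite /q; field; lra.
nra.
Unshelve. all: by end_near. Qed.

Lemma bext_wcont u x : D x -> wcont D (bext (F u)) x.
Proof.
move=> Dx; have [r r0 [L L0 LF]] := linear_system_lipschitz Dx.
have oC : forall y, cube x r y -> exists2 s : R, 0 < s & cube y s `<=` cube x r.
  by move=> y; exact: cube_cube.
have lip y : D y -> cube x r y ->
    `|bext (F u) y - bext (F u) x| <= L * \sum_a `|y 0 a - x 0 a|.
  move=> Dy yr; have [s s0 sr] := oC _ yr.
  have cv : `|F u (y + t *: delta_mx 0 0) - F u (x + t *: delta_mx 0 0)|
      @[t --> (0 : R)^'+] --> `|bext (F u) y - bext (F u) x|.
    by apply: cvg_norm; apply: cvgB; exact: bext_up_cvg.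
  apply: (cvgr_to_le cv).
  apply: filterS2 (near_up hD Dy s0) (near_up hD Dx r0) => t [Dyt yts] [Dxt xtr].
  apply: le_trans (LF u _ _ Dxt Dyt xtr (sr _ yts)) _.
  rewrite ler_wpM2l//; apply: ler_sum => a _; rewrite !shiftE.
  by rewrite (_ : _ - _ = y 0 a - x 0 a)//; ring.
apply/wcontP => e e0.
pose d := Num.min r (e / (n.+1%:R * L + 1)).
have q0 : 0 < n.+1%:R * L + 1 by rewrite ltr_wpDl// mulr_ge0.
exists d; first by rewrite lt_min r0 divr_gt0.
move=> y yd Dy; have yr : cube x r y by apply: cubeW yd; rewrite ge_min lexx.
apply: le_lt_trans (lip y Dy yr) _.
have : \sum_a `|y 0 a - x 0 a| <= \sum_(a < n.+1) e / (n.+1%:R * L + 1).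
  by apply: ler_sum => a _; apply/ltW/(lt_le_trans (yd a)); rewrite ge_min lexx orbT.
rewrite sumr_const card_ord; set q := e / _ => h.
apply: le_lt_trans (ler_wpM2l L0 h) _; rewrite -(mulr_natl q).
have q1 : 0 < q by rewrite divr_gt0.
have -> : e = q * (n.+1%:R * L + 1) by rewrite /q divfK// gt_eqF.
have -> : q * (n.+1%:R * L + 1) = L * (n.+1%:R * q) + q by ring.
by rewrite ltrDl.
Qed.

Lemma bext_is_pd a u x : D x ->
  is_pd D a (bext (F u)) x (\sum_v W a u v x * bext (F v) x).
Proof.
move: x; apply: (@is_pd_up _ _ D (bext (F u))
  (fun x => \sum_v W a u v x * bext (F v) x)) => //.
- by move=> x; exact: bext_wcont.
- move=> x Dx; apply: cvg_sumr => v; apply: cvgM; last exact: bext_wcont.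
  exact: (Ck_cont (Ws a u v 0) Dx).
move=> x Dx; have := FW (a := a) (u := u) Dx; apply: is_pd_eq => //.
- by move=> y [_ /bext_gt0].
by apply: eq_bigr => v _; case: Dx => _ /bext_gt0 ->.
Qed.

Lemma bext_smooth u : smooth D (bext (F u)).
Proof.
apply: (linear_system_smooth (F := fun u => bext (F u)) (W := W)) => //.
- exact: hopen_lorthant.
- by move=> v x; exact: bext_wcont.
- by move=> a v x; exact: bext_is_pd.
Qed.

End Extension.
End LinearSystemExtension.

(** * Signature of symmetric matrices *)

Section Signature.
Context {R : realType}.

(** Diagonalization by congruence, not by an orthogonal matrix: a nonzero pivot is split off and the
    rest is handled by induction, so no spectral theorem is involved. *)
Lemma symmetric_diagonalizable k (A : 'M[R]_k) : A^T = A ->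
  exists2 P : 'M[R]_k, P \in unitmx & exists d : 'rV[R]_k, A = P *m diag_mx d *m P^T.
Proof.
elim: k A => [|k IH] A As.
  exists 1%:M; first exact: unitmx1.
  by exists 0; rewrite [A]flatmx0 [RHS]flatmx0.
have pivot (B : 'M[R]_(1 + k)) : B^T = B ->
      B (lshift k 0) (lshift k 0) != 0 ->
    exists2 P : 'M[R]_(1 + k), P \in unitmx &
      exists d : 'rV[R]_(1 + k), B = P *m diag_mx d *m P^T.
  rewrite -[B]submxK => Bs B0.
  set a := ulsubmx B in Bs B0 *; set u := ursubmx B in Bs B0 *.
  set v := dlsubmx B in Bs B0 *; set C := drsubmx B in Bs B0 *.
  move: Bs; rewrite tr_block_mx => /eq_block_mx[_ vu _ Cs].
  have a0 : a 0 0 != 0.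
    by move: B0; rewrite block_mxEul.
  have aE : a = (a 0 0)%:M by rewrite [LHS]mx11_scalar.
  pose b := (a 0 0)^-1.
  (* The Schur complement of the pivot. *)
  have [|P Pu [d Cd]] := IH (C - b *: (v *m v^T)).
    by rewrite linearB /= linearZ /= trmx_mul trmxK Cs.
  exists (block_mx 1%:M 0 (b *: v) P).
    by rewrite unitmxE det_lblock det1 mul1r -unitmxE.
  exists (row_mx a d).
  have -> : diag_mx (row_mx a d) = block_mx a 0 0 (diag_mx d).
    rewrite diag_mx_row; congr block_mx.
    by apply/matrixP => i j; rewrite !mxE !ord1 eqxx mulr1n.
  rewrite tr_block_mx !mulmx_block !mul1mx !mul0mx !mulmx0 !addr0 !trmx1 !mulmx1 !trmx0 !add0r.
  rewrite !mulmx0 !addr0 ?add0r.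
  congr block_mx.
  - by rewrite mul0mx addr0 linearZ /= {1}aE mul_scalar_mx scalerA mulfV// scale1r vu.
  - by rewrite {1}aE mul_mx_scalar scalerA mulfV// scale1r.
  rewrite -Cd linearZ /= {1}aE mul_mx_scalar scalerA mulfV// scale1r -scalemxAr.
  by rewrite addrC subrK.
(* Either the quadratic form vanishes identically and polarization gives A = 0, or an anisotropic
   vector can serve as first basis vector. *)
have [A0|] := pselect (forall w : 'rV[R]_k.+1, (w *m A *m w^T) 0 0 = 0).
  have AE i j : ((delta_mx 0 i : 'rV[R]_k.+1) *m A *m
      (delta_mx 0 j : 'rV[R]_k.+1)^T) 0 0 = A i j.
    by rewrite -rowE trmx_delta -colE !mxE.
  have {A0 AE} -> : A = 0.
    apply/matrixP => i j; rewrite mxE.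
    have := A0 (delta_mx 0 i + delta_mx 0 j).
    have mxD (X Y : 'M[R]_1) : (X + Y) 0 0 = X 0 0 + Y 0 0 by rewrite mxE.
    have := A0 (delta_mx 0 i); have := A0 (delta_mx 0 j).
    rewrite linearD /= !mulmxDl !mulmxDr !mxD !AE => -> ->.
    rewrite add0r addr0; have -> : A j i = A i j by rewrite -{1}As mxE.
    by lra.
  exists 1%:M; first exact: unitmx1.
  by exists 0; rewrite linear0 mulmx0 mul0mx.
move=> /existsNP[w /eqP wA].
have w0 : w != 0 by apply: contraNneq wA => ->; rewrite !mul0mx mxE.
(* An invertible matrix whose first row is proportional to [w], so that the congruent matrix has a
   nonzero pivot. *)
pose Q : 'M[R]_(1 + k) := row_ebase w.
have Qu : Q \in unitmx by exact: row_ebase_unit.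
have [c wE] : exists c : R, w = c *: row (lshift k 0) Q.
  exists (col_ebase w 0 0); rewrite -{1}[w]mulmx_ebase rank_rV w0.
  rewrite {1}[col_ebase w]mx11_scalar -mulmxA mul_scalar_mx; congr (_ *: _).
  rewrite rowE; congr (_ *m _); apply/rowP => j; rewrite !mxE eqxx andbT /=.
  by rewrite eq_sym.
have [||P Pu [d QAQ]] := pivot (Q *m A *m Q^T).
- by rewrite !trmx_mul trmxK As mulmxA.
- have -> : (Q *m A *m Q^T) (lshift k 0) (lshift k 0) =
      (row (lshift k 0) Q *m A *m (row (lshift k 0) Q)^T) 0 0.
    rewrite -row_mul [RHS]mxE [LHS]mxE; apply: eq_bigr => l _.
    by congr (_ * _); rewrite !mxE.
  move: wA; rewrite wE linearZ /= -!scalemxAl -scalemxAr 2!mxE !mulf_eq0 !negb_or.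
  by case/and3P.
exists (invmx Q *m P); first by rewrite unitmx_mul unitmx_inv Qu.
exists d; rewrite trmx_mul.
have -> : A = invmx Q *m (Q *m A *m Q^T) *m (invmx Q)^T.
  rewrite !mulmxA mulVmx// mul1mx -mulmxA -trmx_mul mulVmx// trmx1 mulmx1//.
by rewrite QAQ !mulmxA.
Qed.


Definition npos k (d : 'rV[R]_k) : nat := #|[pred i | 0 < d 0 i]|.

(** Half of Sylvester's law of inertia, stable under perturbation. If [d] had more positive entries
    than [c], a dimension count would give a nonzero [w] supported where [d] is positive with [w Q]
    zero where [c] is positive. Then w N w^T is nonpositive by [c], but positive by [d], since an
    entrywise error [e] costs at most k e |w|^2. *)
Lemma npos_le k (N Q : 'M[R]_k) (c d : 'rV[R]_k) (e : R) :
  N = Q *m diag_mx c *m Q^T ->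
  (forall i, k%:R * e < `|d 0 i|) -> (forall i j, `|N i j - diag_mx d i j| <= e) ->
  (npos d <= npos c)%N.
Proof.
move=> NQ de Ne; rewrite leqNgt /npos; apply/negP => lt_cd.
set Pd := [pred i : 'I_k | 0 < d 0 i] in lt_cd *; set Pc := [pred i : 'I_k | 0 < c 0 i] in lt_cd *.
pose E : 'M[R]_(#|Pd|, k) := \matrix_(i, j) (enum_val i == j)%:R.
pose G : 'M[R]_(k, #|Pc|) := \matrix_(i, j) (enum_val j == i)%:R.
have : kermx (E *m Q *m G) != 0.
  by rewrite kermx_eq0 -row_leq_rank -ltnNge (leq_ltn_trans (rank_leq_col _)).
move=> /rowV0Pn[v /sub_kermxP vE v0].
pose w := v *m E.
have wE i : w 0 (enum_val i) = v 0 i.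
  rewrite mxE (bigD1 i)//= mxE eqxx mulr1 big1 ?addr0// => j ji.
  by rewrite mxE (inj_eq enum_val_inj) (negbTE ji) mulr0.
have wN i : i \notin Pd -> w 0 i = 0.
  move=> iP; rewrite mxE big1// => j _; rewrite mxE.
  by case: eqP => [ji|]; rewrite ?mulr0//; rewrite -ji enum_valP in iP.
have w0 : 0 < \sum_i w 0 i * w 0 i.
  have [i vi] : exists i, v 0 i != 0 by apply/rV0Pn.
  rewrite (bigD1 (enum_val i))//= ltr_pwDl//.
    by rewrite wE -expr2 exprn_even_gt0.
  by apply: sumr_ge0 => j _; rewrite -expr2 sqr_ge0.
have wQ i : i \in Pc -> (w *m Q) 0 i = 0.
  move=> iP; have wG : w *m Q *m G = 0 by rewrite -vE !mulmxA.
  have := congr1 (fun M : 'rV_ _ => M 0 (enum_rank_in iP i)) wG.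
  have GE j : G j (enum_rank_in iP i) = (i == j)%:R by rewrite mxE enum_rankK_in.
  rewrite mxE [RHS]mxE (bigD1 i)//= GE eqxx mulr1.
  by rewrite big1 ?addr0// => j ji; rewrite GE eq_sym (negbTE ji) mulr0.
clearbody w.
have neg : (w *m N *m w^T) 0 0 <= 0.
  have -> : w *m N *m w^T = (w *m Q) *m diag_mx c *m (w *m Q)^T.
    by rewrite NQ [(w *m Q)^T]trmx_mul !mulmxA.
  rewrite mxE; apply: sumr_le0 => i _; rewrite mul_mx_diag [X in X * _]mxE [X in _ * X]mxE.
  have [/wQ -> |iP] := boolP (i \in Pc); first by rewrite !mul0r.
  have : c 0 i <= 0 by move: iP; rewrite inE -leNgt.
  set t := (w *m Q) 0 i; have : 0 <= t * t by rewrite -expr2 sqr_ge0.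
  by nra.
have wNw : (w *m N *m w^T) 0 0 = \sum_i \sum_j w 0 i * N i j * w 0 j.
  rewrite mxE exchange_big /=; apply: eq_bigr => j _; rewrite !mxE mulr_suml.
  by apply: eq_bigr.
have e0 : 0 <= e.
  have [i _] : exists i, v 0 i != 0 by apply/rV0Pn.
  by apply: le_trans (Ne (enum_val i) (enum_val i)).
have pos : \sum_i \sum_j w 0 i * N i j * w 0 j >=
    \sum_i (d 0 i - k%:R * e) * (w 0 i * w 0 i).
  have H i j : w 0 i * N i j * w 0 j >= w 0 i * diag_mx d i j * w 0 j
      - e * (w 0 i * w 0 i + w 0 j * w 0 j) / 2.
    have := Ne i j; rewrite ler_norml => /andP[n1 n2].
    set D := diag_mx d i j in n1 n2 *; set p := w 0 i; set q := w 0 j.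
    have h1 : 0 <= (e + (N i j - D)) * ((p + q) * (p + q)).
      by apply: mulr_ge0; [lra|rewrite -expr2 sqr_ge0].
    have h2 : 0 <= (e - (N i j - D)) * ((p - q) * (p - q)).
      by apply: mulr_ge0; [lra|rewrite -expr2 sqr_ge0].
    lra.
  apply: le_trans (ler_sum _ (fun i _ => ler_sum _ (fun j _ => H i j))).
  have -> : \sum_i \sum_j (w 0 i * diag_mx d i j * w 0 j
      - e * (w 0 i * w 0 i + w 0 j * w 0 j) / 2) =
      \sum_i \sum_j w 0 i * diag_mx d i j * w 0 j -
      \sum_i \sum_j e * (w 0 i * w 0 i + w 0 j * w 0 j) / 2.
    by rewrite -sumrB; apply: eq_bigr => i _; rewrite sumrB.
  have -> : \sum_i \sum_j w 0 i * diag_mx d i j * w 0 j = \sum_i d 0 i * (w 0 i * w 0 i).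
    apply: eq_bigr => i _; rewrite (bigD1 i)//= mxE eqxx mulr1n big1 => [|j ji].
      by rewrite addr0; ring.
    by rewrite mxE eq_sym (negbTE ji) mulr0n mulr0 mul0r.
  have -> : \sum_i \sum_j e * (w 0 i * w 0 i + w 0 j * w 0 j) / 2 =
      \sum_i k%:R * e * (w 0 i * w 0 i).
    have S : \sum_i \sum_(j < k) (w 0 i * w 0 i + w 0 j * w 0 j) =
        2 * (k%:R * \sum_i w 0 i * w 0 i).
      under eq_bigr do rewrite big_split /= sumr_const card_ord.
      rewrite big_split /= sumr_const card_ord -mulr_natl.
      by under eq_bigr do rewrite -mulr_natl; rewrite -mulr_sumr; ring.
    have -> : \sum_i k%:R * e * (w 0 i * w 0 i) = e / 2 *
        \sum_i \sum_(j < k) (w 0 i * w 0 i + w 0 j * w 0 j).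
      by rewrite S -mulr_sumr; field.
    rewrite mulr_sumr; apply: eq_bigr => i _; rewrite mulr_sumr.
    by apply: eq_bigr => j _; field.
  by rewrite -sumrB; apply: ler_sum => i _; rewrite mulrBl.
move: neg; rewrite wNw leNgt => /negP; apply; apply: lt_le_trans pos.
have [i vi] : exists i, v 0 i != 0 by apply/rV0Pn.
have T j : 0 <= (d 0 j - k%:R * e) * (w 0 j * w 0 j).
  have [jP|/wN ->] := boolP (j \in Pd); last by rewrite !mulr0.
  rewrite mulr_ge0//; last by rewrite -expr2 sqr_ge0.
  by rewrite inE in jP; have := de j; rewrite gtr0_norm//; lra.
rewrite (bigD1 (enum_val i))//= ltr_pwDl//; last by apply: sumr_ge0 => j _.
apply: mulr_gt0; last by rewrite wE -expr2 exprn_even_gt0.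
have := enum_valP i; rewrite inE => di.
by have := de (enum_val i); rewrite gtr0_norm//; lra.
Qed.

Lemma npos_split k (d : 'rV[R]_k) : (forall i, d 0 i != 0) ->
  (npos d + npos (- d))%N = k.
Proof.
move=> d0; rewrite -[RHS]card_ord -(cardC [pred i | 0 < d 0 i]); congr addn.
apply: eq_card => i; rewrite !inE !mxE oppr_gt0.
by rewrite -leNgt le_eqVlt (negbTE (d0 i)).
Qed.

(** [has_signature] lists the positive entries first, so a diagonal form has to be permuted into
    that order. *)
Lemma sorting_function k (d : 'rV[R]_k) :
  exists2 f : 'I_k -> 'I_k, injective f & forall i, (0 < d 0 (f i)) = (i < npos d)%N.
Proof.
pose pos := [pred i | 0 < d 0 i].
pose s := seq.filter pos (enum 'I_k) ++ seq.filter (predC pos) (enum 'I_k).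
have sp : size (seq.filter pos (enum 'I_k)) = npos d.
  by rewrite /npos cardE size_filter /enum_mem filter_predT size_filter.
have ps : perm_eq s (enum 'I_k) by exact/permPl/perm_filterC.
have ss : size s = k by rewrite (perm_size ps) size_enum_ord.
have us : uniq s by rewrite (perm_uniq ps) enum_uniq.
exists (fun i => nth i s i) => [i j|i].
  rewrite (set_nth_default i j) ?ss// => /eqP.
  by rewrite nth_uniq ?ss// => /eqP/val_inj.
rewrite nth_cat sp; case: ltnP => ip.
  have : nth i (seq.filter pos (enum 'I_k)) i \in seq.filter pos (enum 'I_k).
    by rewrite mem_nth// sp.
  by rewrite mem_filter => /andP[].
have : nth i (seq.filter (predC pos) (enum 'I_k)) (i - npos d) \in
    seq.filter (predC pos) (enum 'I_k).
  by rewrite mem_nth// ltn_subLR// -sp -size_cat -/s ss.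
by rewrite mem_filter => /andP[/negbTE].
Qed.

Lemma has_signature_diag k (p q : nat) (A P : 'M[R]_k) (d : 'rV[R]_k) :
  A \in unitmx -> A = P *m diag_mx d *m P^T -> (p + q = k)%N -> npos d = p ->
  has_signature p q A.
Proof.
move=> Au AP pqk dp; split=> //.
have d0 i : d 0 i != 0.
  move: Au; rewrite AP !unitmx_mul => /andP[/andP[_ ]].
  by rewrite unitmxE det_diag unitfE => /prodf_neq0/(_ i isT).
have [f finj fP] := sorting_function d; rewrite dp in fP.
pose Q : 'M[R]_k := \matrix_(i, j) (P i (f j) * Num.sqrt `|d 0 (f j)|).
have AQ : A = Q *m diag_mx (\row_(i < k) if (i < p)%N then 1 else -1) *m Q^T.
  rewrite AP; apply/matrixP => i j; rewrite mxE [RHS]mxE.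
  rewrite (reindex_inj finj) /=; apply: eq_bigr => l _.
  rewrite !mul_mx_diag !mxE -fP.
  have {1}-> : d 0 (f l) = (if 0 < d 0 (f l) then 1 else -1) *
      (Num.sqrt `|d 0 (f l)| * Num.sqrt `|d 0 (f l)|).
    rewrite -expr2 sqr_sqrtr//; case: ltP => dl; first by rewrite mul1r gtr0_norm.
    by rewrite ler0_norm// mulN1r opprK.
  by move: (if _ then _ else _) (Num.sqrt _) => sg r; ring.
exists Q => //; move: Au; rewrite AQ !unitmx_mul.
by case/andP => /andP[].
Qed.

Lemma has_signature_unit k (p q : nat) (A : 'M[R]_k) :
  has_signature p q A -> A \in unitmx.
Proof.
move=> [_ [P Pu ->]]; rewrite !unitmx_mul unitmx_tr Pu andbT /= unitmxE det_diag.
rewrite unitfE; apply/prodf_neq0 => i _; rewrite mxE.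
by case: ifP; rewrite ?oner_eq0// oppr_eq0 oner_eq0.
Qed.

Lemma has_signature_sym k (p q : nat) (A : 'M[R]_k) :
  has_signature p q A -> A^T = A.
Proof.
by move=> [_ [P Pu ->]]; rewrite !trmx_mul trmxK tr_diag_mx mulmxA.
Qed.

Lemma has_signature_congr k (p q : nat) (A Q : 'M[R]_k) : Q \in unitmx ->
  has_signature p q A -> has_signature p q (Q *m A *m Q^T).
Proof.
move=> Qu [pq [P Pu ->]]; split=> //; exists (Q *m P).
  by rewrite unitmx_mul Qu.
by rewrite trmx_mul !mulmxA.
Qed.

Lemma has_signature_inv k (p q : nat) (A : 'M[R]_k) :
  has_signature p q A -> has_signature p q (invmx A).
Proof.
move=> As; have Au := has_signature_unit As.
have := has_signature_congr (_ : invmx A \in unitmx) As.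
rewrite unitmx_inv => /(_ Au); rewrite mulVmx// mul1mx.
by rewrite trmx_inv (has_signature_sym As).
Qed.

Lemma has_signature_scale k (p q : nat) (A : 'M[R]_k) (c : R) : 0 < c ->
  has_signature p q A -> has_signature p q (c *: A).
Proof.
move=> c0 As.
have := has_signature_congr (_ : (Num.sqrt c)%:M \in unitmx) As.
rewrite tr_scalar_mx mul_mx_scalar mul_scalar_mx scalerA -expr2 sqr_sqrtr ?ltW//.
apply; rewrite unitmxE det_scalar unitfE expf_neq0// gt_eqF// sqrtr_gt0//.
Qed.

Lemma npos_signature k (p : nat) : (p <= k)%N ->
  npos (\row_(i < k) if (i < p)%N then 1 else -1 : R) = p.
Proof.
move=> pk.
have wi : injective (widen_ord pk) by move=> i j /(congr1 val) /= /val_inj.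
rewrite -[RHS]card_ord -(card_codom wi).
apply: eq_card => i; rewrite !inE mxE; case: ltnP => ip.
  rewrite ltr01; apply/esym/codomP; exists (Ordinal ip); exact: val_inj.
rewrite oppr_gt0 ltNge ler01; apply/esym/negbTE/codomP => -[j ij].
by move: ip; rewrite ij /= leqNgt ltn_ord.
Qed.

(** The metric does not exist on the boundary, so the signature there can only come from nearby
    interior points. In a basis that diagonalizes [A], a close enough [B] is nearly diagonal, and
    [npos_le] compares the positive and the negative entries. *)
Lemma has_signature_limit k (p q : nat) (A : 'M[R]_k) :
  A^T = A -> A \in unitmx ->
  (forall e : R, 0 < e -> exists2 B, has_signature p q B &
    forall i j, `|B i j - A i j| < e) ->
  has_signature p q A.
Proof.
move=> As Au Alim.
have [P Pu [d AP]] := symmetric_diagonalizable As.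
have d0 i : d 0 i != 0.
  move: Au; rewrite AP !unitmx_mul => /andP[/andP[_ ]].
  by rewrite unitmxE det_diag unitfE => /prodf_neq0/(_ i isT).
(* A positive lower bound of all |d_i| that also makes sense for k = 0. *)
pose mu := (1 + \sum_i `|d 0 i|^-1)^-1.
have S0 : 0 < 1 + \sum_i `|d 0 i|^-1.
  by rewrite ltr_pwDl// sumr_ge0// => i _; rewrite invr_ge0.
have mu0 : 0 < mu by rewrite invr_gt0.
have mud i : mu < `|d 0 i|.
  have di : 0 < `|d 0 i| by rewrite normr_gt0.
  rewrite -[X in _ < X]invrK ltf_pV2 ?posrE ?invr_gt0//.
  rewrite (bigD1 i)//= addrCA ltrDl ltr_pwDl//; exact: sumr_ge0.
pose e := mu / (k%:R + 1).
have k1 : 0 < k%:R + 1 :> R by rewrite ltr_wpDl.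
have e0 : 0 < e by rewrite divr_gt0.
have de i : k%:R * e < `|d 0 i|.
  apply: le_lt_trans (mud i); rewrite /e mulrCA ler_piMr ?(ltW mu0)//.
  by rewrite ler_pdivrMr// mul1r lerDl.
pose V := invmx P.
(* Congruence by [V] magnifies an entrywise perturbation at most by [C]. *)
pose C := 1 + (\sum_i \sum_l `|V i l|) * (\sum_i \sum_l `|V i l|).
have sV0 : 0 <= \sum_i \sum_l `|V i l| by do 2?[apply: sumr_ge0 => ? _].
have C0 : 0 < C by rewrite ltr_pwDl// mulr_ge0.
have [B Bs BA] := Alim _ (divr_gt0 e0 C0).
have [pqk [Q Qu BQ]] := Bs.
have Vd : diag_mx d = V *m A *m V^T.
  rewrite AP !mulmxA mulVmx// mul1mx -mulmxA -trmx_mul mulVmx// trmx1.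
  by rewrite mulmx1.
have Ne i j : `|(V *m B *m V^T) i j - diag_mx d i j| <= e.
  have -> : (V *m B *m V^T) i j - diag_mx d i j = (V *m (B - A) *m V^T) i j.
    by rewrite Vd mulmxBr mulmxBl !mxE.
  have rowV i' : \sum_l `|V i' l| <= \sum_i \sum_l `|V i l|.
    by rewrite [leRHS](bigD1 i')//= lerDl sumr_ge0// => l _; rewrite sumr_ge0.
  rewrite mxE; apply: le_trans (ler_norm_sum _ _ _) _.
  apply: le_trans (_ : \sum_l ((\sum_m `|V i m|) * (e / C)) * `|V j l| <= e).
    apply: ler_sum => l _; rewrite normrM [V^T l j]mxE ler_wpM2r//.
    rewrite mxE; apply: le_trans (ler_norm_sum _ _ _) _.
    rewrite mulr_suml; apply: ler_sum => m _; rewrite normrM ler_wpM2l//.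
    by rewrite !mxE ltW.
  rewrite -mulr_sumr mulrAC mulrA ler_pdivrMr// [_ * e]mulrC ler_wpM2l ?(ltW e0)//.
  apply: le_trans (ler_pM _ _ (rowV i) (rowV j)) _; rewrite ?sumr_ge0//.
  by rewrite /C lerDr ler01.
pose c : 'rV[R]_k := \row_(i < k) if (i < p)%N then 1 else -1.
have pk : (p <= k)%N by rewrite -pqk leq_addr.
have NQ : V *m B *m V^T = (V *m Q) *m diag_mx c *m (V *m Q)^T.
  by rewrite BQ trmx_mul !mulmxA.
have le1 := npos_le NQ de Ne.
have diagN (u : 'rV[R]_k) : diag_mx (- u) = - diag_mx u.
  by apply/matrixP => i j; rewrite !mxE mulNrn.
have NQ' : - (V *m B *m V^T) = (V *m Q) *m diag_mx (- c) *m (V *m Q)^T.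
  by rewrite NQ diagN mulmxN mulNmx.
(* The same inequality for the negative entries. As both totals equal k, the two inequalities are
   equalities. *)
have le2 : (npos (- d) <= npos (- c))%N.
  apply: (npos_le (e := e) NQ') => [i|i j]; first by rewrite mxE normrN.
  have mxN (X : 'M[R]_k) : (- X) i j = - X i j by rewrite mxE.
  by rewrite diagN !mxN -opprD normrN.
have c0 i : c 0 i != 0.
  by rewrite mxE; case: ifP; rewrite ?oner_eq0// oppr_eq0 oner_eq0.
have dk := npos_split d0; have ck := npos_split c0.
apply: (has_signature_diag Au AP pqk).
rewrite -(npos_signature pk) -/c.
by move: le1 le2 dk ck; clear; lia.
Qed.

End Signature.

(** * Calculus in charts *)

Section DeterminantDerivative.
Context {R : realType} {m r : nat}.

(** Jacobi's formula: differentiating the Leibniz expansion replaces one row at a time, and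
    expanding along the replaced row produces the adjugate. *)
Lemma is_pd_det (D : set 'rV[R]_m) (a : 'I_m) (F : 'rV[R]_m -> 'M[R]_r)
    (F' : 'M[R]_r) (x : 'rV[R]_m) :
  (forall i j, is_pd D a (fun y => F y i j) x (F' i j)) ->
  is_pd D a (fun y => \det (F y)) x (\tr (F' *m \adj (F x))).
Proof.
move=> FF'.
pose M i : 'M[R]_r := \matrix_(k, l) (if k == i then F' k l else F x k l).
have -> : \tr (F' *m \adj (F x)) = \sum_i \det (M i).
  apply: eq_bigr => i _; rewrite mxE (expand_det_row _ i); apply: eq_bigr => j _.
  rewrite !mxE eqxx; congr (_ * (_ * \det _)).
  by apply/matrixP => k l; rewrite !mxE eq_sym (negbTE (neq_lift _ _)).
rewrite exchange_big; apply: is_pd_sum => s _; rewrite -mulr_sumr.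
set sg : R := (-1) ^+ _.
have := is_pdM (@is_pd_cst _ _ D a x sg)
  (is_pd_prod (index_enum_uniq 'I_r) (fun i => FF' i (perm.fun_of_perm s i))).
rewrite mul0r add0r /cst; congr is_pd; congr (_ * _).
by apply: eq_bigr => i _; apply: eq_bigr => j _; rewrite mxE.
Qed.

End DeterminantDerivative.

(* A smooth atlas, the images of whose charts may have boundary and corners.  It
   covers both the given manifold and its boundary. *)
Section Charts.
Context {R : realType} {m : nat} {T : Type} (A : atlas R m T).
Implicit Types (i j : idx A) (a b c : 'I_m) (p q : T) (f g : T -> R) (W : set T).

(** Openness as seen in the chart [i]. As [T] carries no topology here, the notion also applies to
    the boundary atlas, whose domains are not open in the ambient manifold. *)
Definition copen i W := forall x, img i x -> W (prm i x) ->
  exists2 r : R, 0 < r & forall y, cube x r y -> img i y -> W (prm i y).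

Record smooth_atlas : Prop := SmoothAtlas {
  sa_img : forall i, lorthant (img i);
  sa_crdK : forall i p, dom i p -> prm i (crd i p) = p;
  sa_dom : forall i j, copen i (dom j);
  sa_smooth : forall i j b, smooth_in i (dom j) (fun p => crd j p 0 b) }.

Hypothesis Asm : smooth_atlas.

Lemma img_crd i p : dom i p -> img i (crd i p).
Proof. by move=> ip; exists p. Qed.

Lemma img_prm i x : img i x -> dom i (prm i x) /\ crd i (prm i x) = x.
Proof. by move=> [p ip <-]; rewrite (sa_crdK Asm). Qed.

Definition cimg i W := crd i @` (W `&` dom i).

Lemma cimgP i W x : cimg i W x <-> img i x /\ W (prm i x).
Proof.
split=> [[p [Wp ip] <-]|[ix Wx]].
  by split; [exact: img_crd|rewrite (sa_crdK Asm)].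
by have [ix' xE] := img_prm ix; exists (prm i x).
Qed.

Lemma cimg_crd i W p : W p -> dom i p -> cimg i W (crd i p).
Proof. by move=> Wp ip; exists p. Qed.

Lemma lorthant_cimg i W : copen i W -> lorthant (cimg i W).
Proof.
move=> oW.
pose O := [set x : 'rV[R]_m | \forall y \near x, img i y -> W (prm i y)].
have -> : cimg i W = img i `&` O.
  apply/seteqP; split=> x.
    move=> /cimgP[ix Wx]; split=> //; apply/nbhs_cubeP.
    by have [r r0 rP] := oW x ix Wx; exists r.
  by move=> [ix /nbhs_singleton Wx]; apply/cimgP; split=> //; exact: Wx.
apply: lorthantI; first exact: sa_img.
exact: open_interior.
Qed.

Lemma copenI i W W' : copen i W -> copen i W' -> copen i (W `&` W').
Proof.
move=> oW oW' x ix [Wx Wx'].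
have [r r0 rP] := oW x ix Wx; have [s s0 sP] := oW' x ix Wx'.
exists (Num.min r s) => [|y yrs iy]; first by rewrite lt_min r0.
split; [apply: rP|apply: sP] => //; apply: cubeW yrs;
  by rewrite ge_min lexx ?orbT.
Qed.

Lemma copenT i : copen i setT.
Proof. by move=> x _ _; exists 1. Qed.

Definition ispd i a f p (l : R) := is_pd (img i) a (f \o prm i) (crd i p) l.

Lemma ispd_pd i a f p l : dom i p -> ispd i a f p l -> pd i a f p = l.
Proof.
by move=> ip; apply: is_pd_pderiv; [exact: sa_img|exact: img_crd].
Qed.

Lemma ispd_unique i a f p l l' : dom i p ->
  ispd i a f p l -> ispd i a f p l' -> l = l'.
Proof. by move=> ip /(ispd_pd ip) <- /(ispd_pd ip) <-. Qed.

Lemma ispd_local i a W f g p l : copen i W -> W p -> dom i p ->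
  (forall q, W q -> dom i q -> f q = g q) -> ispd i a f p l -> ispd i a g p l.
Proof.
move=> oW Wp ip fg.
have ix := img_crd ip; have Wx : W (prm i (crd i p)) by rewrite (sa_crdK Asm).
apply: is_pd_local => //; last by rewrite /= (sa_crdK Asm)// fg.
have [r r0 rP] := oW _ ix Wx; exists r => // y yr; split=> // iy.
by apply: fg; [exact: rP|case: (img_prm iy)].
Qed.

Lemma pd_local i a W f g p : copen i W -> W p -> dom i p ->
  (forall q, W q -> dom i q -> f q = g q) -> pd i a f p = pd i a g p.
Proof.
move=> oW Wp ip fg; rewrite /pd /pderiv; congr (lim _).
apply/seteqP; split; apply: near_eq_cvg => /=.
all: have ix := img_crd ip; have Wx : W (prm i (crd i p)) by rewrite (sa_crdK Asm).
all: have [r r0 rP] := oW _ ix Wx.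
all: suff : \forall h \near punctured (img i) a (crd i p),
    dquot a (f \o prm i) (crd i p) h = dquot a (g \o prm i) (crd i p) h by
  apply: filterS => h ->.
all: apply/near_punctured; exists r => // h h0 hr ih; rewrite /dquot /=.
all: rewrite (sa_crdK Asm)// !fg//; first (by apply: rP => //; exact: cube_shift).
all: by case: (img_prm ih).
Qed.

Lemma ispdP i a W f p : copen i W -> W p -> dom i p -> smooth_in i W f ->
  ispd i a f p (pd i a f p).
Proof.
move=> oW Wp ip fs.
have cp : cimg i W (crd i p) by exact: cimg_crd.
have := Ck_is_pd (a := a) (fs 1%N) cp => H.
have : ispd i a f p (pderiv (cimg i W) a (f \o prm i) (crd i p)).
  apply: is_pd_local H => //.
  have [|r r0 rP] := oW _ (img_crd ip); first by rewrite (sa_crdK Asm).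
  by exists r => // y yr; split=> // iy; apply/cimgP; split=> //; exact: rP.
by move=> H'; rewrite (ispd_pd ip H').
Qed.

Lemma smooth_in_ext i W f g : copen i W ->
  (forall q, W q -> dom i q -> f q = g q) -> smooth_in i W f -> smooth_in i W g.
Proof.
move=> oW fg fs k; apply: Ck_ext (fs k); first exact: lorthant_cimg.
by move=> _ [q [Wq iq] <-] /=; rewrite (sa_crdK Asm)// fg.
Qed.

Lemma smooth_in_sub i W W' f : copen i W -> copen i W' -> W' `<=` W ->
  smooth_in i W f -> smooth_in i W' f.
Proof.
move=> oW oW' W'W fs k; apply: (@Ck_restrict _ _ _ (cimg i W)) (fs k).
- exact: lorthant_cimg.
- exact: lorthant_cimg.
by move=> _ [q [Wq iq] <-]; exists q => //; split=> //; exact: W'W.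
Qed.

Lemma smooth_in_pd i a W f : copen i W -> smooth_in i W f ->
  smooth_in i W (pd i a f).
Proof.
move=> oW fs k; apply: (Ck_ext _ _ (Ck_pderiv a (fs k.+1))).
  exact: lorthant_cimg.
move=> _ [q [Wq iq] <-] /=; rewrite (sa_crdK Asm)//.
have H := ispdP (a := a) oW Wq iq fs; apply: is_pd_pderiv; first exact: lorthant_cimg.
  exact: cimg_crd.
apply: is_pd_local H; first exact: img_crd.
- by exists 1 => // y _; split=> // /cimgP[].
- by [].
Qed.

Lemma smooth_in_local i W f : copen i W ->
  (forall p, W p -> dom i p -> exists W',
     [/\ copen i W', W' p & smooth_in i (W `&` W') f]) -> smooth_in i W f.
Proof.
move=> oW loc k; apply: Ck_local; first exact: lorthant_cimg.
move=> _ [p [Wp ip] <-]; have [W' [oW' W'p fs]] := loc p Wp ip.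
have [|r r0 rP] := oW' _ (img_crd ip); first by rewrite (sa_crdK Asm).
exists r => //; exists (cimg i (W `&` W')); split.
- by apply: lorthant_cimg; exact: copenI.
- move=> y [yr /cimgP[iy Wy]]; apply/cimgP; split=> //; split=> //; exact: rP.
- by move=> y /cimgP[iy [Wy _]]; apply/cimgP.
exact: fs.
Qed.

Lemma smooth_in_cst i W (c : R) : copen i W -> smooth_in i W (fun _ => c).
Proof. by move=> oW k; apply: Ck_cst; exact: lorthant_cimg. Qed.

Lemma smooth_inD i W f g : copen i W -> smooth_in i W f -> smooth_in i W g ->
  smooth_in i W (fun p => f p + g p).
Proof.
by move=> oW fs gs k; apply: (CkD _ (fs k) (gs k)); exact: lorthant_cimg.
Qed.

Lemma smooth_inN i W f : copen i W -> smooth_in i W f ->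
  smooth_in i W (fun p => - f p).
Proof. by move=> oW fs k; apply: (CkN _ (fs k)); exact: lorthant_cimg. Qed.

Lemma smooth_inB i W f g : copen i W -> smooth_in i W f -> smooth_in i W g ->
  smooth_in i W (fun p => f p - g p).
Proof. by move=> oW fs gs; apply: smooth_inD => //; exact: smooth_inN. Qed.

Lemma smooth_inM i W f g : copen i W -> smooth_in i W f -> smooth_in i W g ->
  smooth_in i W (fun p => f p * g p).
Proof.
by move=> oW fs gs k; apply: (CkM _ (fs k) (gs k)); exact: lorthant_cimg.
Qed.

Lemma smooth_in_sum i W (I : Type) (r : seq I) (P : pred I) (F : I -> T -> R) :
  copen i W -> (forall u, P u -> smooth_in i W (F u)) ->
  smooth_in i W (fun p => \sum_(u <- r | P u) F u p).
Proof.
move=> oW Fs k.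
by apply: (@Ck_sum _ _ k _ I r P (fun u => F u \o prm i) (lorthant_cimg oW)) => u /Fs.
Qed.

Lemma cimg_forall i W (P : R -> Prop) f :
  (forall p, W p -> dom i p -> P (f p)) ->
  forall x, cimg i W x -> P ((f \o prm i) x).
Proof. by move=> fP _ [p [Wp ip] <-] /=; rewrite (sa_crdK Asm)//; exact: fP. Qed.

Lemma smooth_inV i W f : copen i W -> (forall p, W p -> dom i p -> f p != 0) ->
  smooth_in i W f -> smooth_in i W (fun p => (f p)^-1).
Proof.
move=> oW f0 fs k; apply: (CkV _ _ (fs k)); first exact: lorthant_cimg.
exact: (@cimg_forall i W (fun t => t != 0)).
Qed.

Lemma smooth_in_powR i W f (s : R) : copen i W ->
  (forall p, W p -> dom i p -> 0 < f p) ->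
  smooth_in i W f -> smooth_in i W (fun p => f p `^ s).
Proof.
move=> oW f0 fs k; apply: (Ck_powR _ _ _ (fs k)); first exact: lorthant_cimg.
exact: (@cimg_forall i W (fun t => 0 < t)).
Qed.

Lemma smooth_in_norm_powR i W f (s : R) : copen i W ->
  (forall p, W p -> dom i p -> f p != 0) ->
  smooth_in i W f -> smooth_in i W (fun p => `|f p| `^ s).
Proof.
move=> oW f0 fs k; apply: (Ck_norm_powR _ _ _ (fs k)); first exact: lorthant_cimg.
exact: (@cimg_forall i W (fun t => t != 0)).
Qed.

Lemma smooth_in_det i W r (F : T -> 'M[R]_r) : copen i W -> smooth_mx i W F ->
  smooth_in i W (fun p => \det (F p)).
Proof.
move=> oW Fs k.
by apply: (@Ck_det _ _ k _ r (fun x => F (prm i x)) (lorthant_cimg oW)) => u v; exact: Fs.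
Qed.

Lemma smooth_mx_inv i W r (F : T -> 'M[R]_r) : copen i W ->
  (forall p, W p -> dom i p -> F p \in unitmx) ->
  smooth_mx i W F -> smooth_mx i W (fun p => invmx (F p)).
Proof.
move=> oW Fu Fs u v k.
apply: (@Ck_invmx _ _ k _ r (fun x => F (prm i x)) (lorthant_cimg oW)).
  by move=> _ [p [Wp ip] <-]; rewrite (sa_crdK Asm)//; exact: Fu.
by move=> u' v'; exact: Fs.
Qed.

Lemma smooth_mxM i W r s t (F : T -> 'M[R]_(r, s)) (G : T -> 'M[R]_(s, t)) :
  copen i W -> smooth_mx i W F -> smooth_mx i W G ->
  smooth_mx i W (fun p => F p *m G p).
Proof.
move=> oW Fs Gs u v.
apply: (@smooth_in_ext _ _ (fun p => \sum_j F p u j * G p j v)) => //.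
  by move=> q _ _; rewrite mxE.
by apply: smooth_in_sum => // j _; apply: smooth_inM.
Qed.

Lemma smooth_mx_tr i W r s (F : T -> 'M[R]_(r, s)) : copen i W ->
  smooth_mx i W F -> smooth_mx i W (fun p => (F p)^T).
Proof.
move=> oW Fs u v; apply: (@smooth_in_ext _ _ (fun p => F p v u)) => //.
by move=> q _ _; rewrite mxE.
Qed.

Lemma ispd_cst i a p (c : R) : ispd i a (fun _ => c) p 0.
Proof. exact: is_pd_cst. Qed.

Lemma ispdD i a f g p k l : ispd i a f p k -> ispd i a g p l ->
  ispd i a (fun q => f q + g q) p (k + l).
Proof. exact: is_pdD. Qed.

Lemma ispdN i a f p k : ispd i a f p k -> ispd i a (fun q => - f q) p (- k).
Proof. exact: is_pdN. Qed.

Lemma ispdB i a f g p k l : ispd i a f p k -> ispd i a g p l ->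
  ispd i a (fun q => f q - g q) p (k - l).
Proof. exact: is_pdB. Qed.

Lemma ispdM i a f g p k l : dom i p -> ispd i a f p k -> ispd i a g p l ->
  ispd i a (fun q => f q * g q) p (k * g p + f p * l).
Proof. by move=> ip fk gl; have := is_pdM fk gl; rewrite /= !(sa_crdK Asm). Qed.

Lemma ispd_sum i a (I : Type) (r : seq I) (P : pred I) (F : I -> T -> R) p
    (L : I -> R) : (forall u, P u -> ispd i a (F u) p (L u)) ->
  ispd i a (fun q => \sum_(u <- r | P u) F u q) p (\sum_(u <- r | P u) L u).
Proof. exact: is_pd_sum. Qed.

Lemma ispd_comp i a f p l (phi : R -> R) (k : R) : dom i p ->
  ispd i a f p l -> is_derive (f p) 1 phi k ->
  ispd i a (fun q => phi (f q)) p (k * l).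
Proof.
move=> ip fl phik; apply: (is_pd_comp (phi := phi)) => //; first exact: sa_img.
  exact: img_crd.
by rewrite /= (sa_crdK Asm).
Qed.

Lemma ispdV i a f p l : dom i p -> f p != 0 -> ispd i a f p l ->
  ispd i a (fun q => (f q)^-1) p (- l / (f p * f p)).
Proof.
move=> ip fp fl; have := ispd_comp ip fl (is_deriveV fp (is_derive_id (f p) (1 : R))).
rewrite /GRing.scale /= mulr1 expr2.
by have -> : - (f p * f p)^-1 * l = - l / (f p * f p) by ring.
Qed.

Lemma ispd_powR i a f p l (s : R) : dom i p -> 0 < f p -> ispd i a f p l ->
  ispd i a (fun q => f q `^ s) p (s * f p `^ (s - 1) * l).
Proof. by move=> ip fp fl; exact: (ispd_comp ip fl (is_derive1_powR s fp)). Qed.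

Lemma ispd_det i a r (F : T -> 'M[R]_r) (F' : 'M[R]_r) p : dom i p ->
  (forall u v, ispd i a (fun q => F q u v) p (F' u v)) ->
  ispd i a (fun q => \det (F q)) p (\tr (F' *m \adj (F p))).
Proof.
by move=> ip FF'; have := is_pd_det FF'; rewrite (sa_crdK Asm).
Qed.

Definition mxpd r s i a (F : T -> 'M[R]_(r, s)) p (F' : 'M[R]_(r, s)) :=
  forall u v, ispd i a (fun q => F q u v) p (F' u v).

Lemma mxpd_pdmx r s i a (F : T -> 'M[R]_(r, s)) p F' : dom i p ->
  mxpd i a F p F' -> pdmx i a F p = F'.
Proof.
by move=> ip FF'; apply/matrixP => u v; rewrite mxE; exact: ispd_pd.
Qed.

Lemma mxpdP r s i a W (F : T -> 'M[R]_(r, s)) p : copen i W -> W p -> dom i p ->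
  smooth_mx i W F -> mxpd i a F p (pdmx i a F p).
Proof. by move=> oW Wp ip Fs u v; rewrite mxE; exact: (ispdP oW Wp ip (Fs u v)). Qed.

Lemma mxpd_local r s i a W (F G : T -> 'M[R]_(r, s)) p F' : copen i W -> W p ->
  dom i p -> (forall q, W q -> dom i q -> F q = G q) ->
  mxpd i a F p F' -> mxpd i a G p F'.
Proof.
by move=> oW Wp ip FG FF' u v; apply: (ispd_local oW Wp ip _ (FF' u v)) => q Wq iq; rewrite FG.
Qed.

Lemma mxpd_cst r s i a p (M : 'M[R]_(r, s)) : mxpd i a (fun _ => M) p 0.
Proof. by move=> u v; rewrite mxE; exact: ispd_cst. Qed.

Lemma mxpdM r s t i a (F : T -> 'M[R]_(r, s)) (G : T -> 'M[R]_(s, t)) p F' G' :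
  dom i p -> mxpd i a F p F' -> mxpd i a G p G' ->
  mxpd i a (fun q => F q *m G q) p (F' *m G p + F p *m G').
Proof.
move=> ip FF' GG' u v; rewrite !mxE -big_split /=.
under [X in ispd _ _ X]eq_fun do rewrite mxE.
by apply: ispd_sum => j _; exact: ispdM.
Qed.

Lemma mxpdZ r s i a f (F : T -> 'M[R]_(r, s)) p l F' :
  dom i p -> ispd i a f p l -> mxpd i a F p F' ->
  mxpd i a (fun q => f q *: F q) p (l *: F p + f p *: F').
Proof.
move=> ip fl FF' u v; rewrite !mxE.
under [X in ispd _ _ X]eq_fun do rewrite mxE.
exact: ispdM.
Qed.

Lemma mxpd_tr r s i a (F : T -> 'M[R]_(r, s)) p F' : mxpd i a F p F' ->
  mxpd i a (fun q => (F q)^T) p F'^T.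
Proof.
move=> FF' u v; rewrite mxE; under [X in ispd _ _ X]eq_fun do rewrite mxE.
exact: FF'.
Qed.

Lemma mxpd_block r1 r2 s1 s2 i a (F1 : T -> 'M[R]_(r1, s1))
    (F2 : T -> 'M[R]_(r1, s2)) (F3 : T -> 'M[R]_(r2, s1))
    (F4 : T -> 'M[R]_(r2, s2)) p F1' F2' F3' F4' :
  mxpd i a F1 p F1' -> mxpd i a F2 p F2' -> mxpd i a F3 p F3' ->
  mxpd i a F4 p F4' ->
  mxpd i a (fun q => block_mx (F1 q) (F2 q) (F3 q) (F4 q)) p
    (block_mx F1' F2' F3' F4').
Proof.
move=> H1 H2 H3 H4 u v; case: (fintype.split_ordP u) => u' ->;
  case: (fintype.split_ordP v) => v' ->;
  rewrite ?block_mxEul ?block_mxEur ?block_mxEdl ?block_mxEdr;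
  under [X in ispd _ _ X]eq_fun do
    rewrite ?block_mxEul ?block_mxEur ?block_mxEdl ?block_mxEdr;
  by [exact: H1|exact: H2|exact: H3|exact: H4].
Qed.

(** Smoothness of the inverse gives existence of its derivative; the value then follows by
    differentiating F F^-1 = 1. *)
Lemma mxpd_inv r i a W (F : T -> 'M[R]_r) p F' : copen i W -> W p -> dom i p ->
  (forall q, W q -> dom i q -> F q \in unitmx) -> smooth_mx i W F ->
  mxpd i a F p F' ->
  mxpd i a (fun q => invmx (F q)) p (- (invmx (F p) *m F' *m invmx (F p))).
Proof.
move=> oW Wp ip Fu Fs FF'.
have := mxpdP (a := a) oW Wp ip (smooth_mx_inv oW Fu Fs); set X := pdmx _ _ _ _ => IX.
have := mxpdM ip FF' IX => H1.
have H0 : mxpd i a (fun q => F q *m invmx (F q)) p 0.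
  apply: (mxpd_local oW Wp ip _ (mxpd_cst i a p 1%:M)) => q Wq iq.
  by rewrite mulmxV// Fu.
have E : F' *m invmx (F p) + F p *m X = 0.
  by apply/matrixP => u v; exact: ispd_unique (H1 u v) (H0 u v).
suff -> : - (invmx (F p) *m F' *m invmx (F p)) = X by [].
have -> : X = invmx (F p) *m (F p *m X) by rewrite mulmxA mulVmx ?mul1mx// Fu.
by rewrite (_ : F p *m X = - (F' *m invmx (F p))) ?mulmxN ?mulmxA//; apply/eqP; rewrite -addr_eq0 addrC E.
Qed.

Lemma chain_rule i j a W f p : copen i W -> copen j W -> W p -> dom i p ->
  dom j p -> smooth_in j W f ->
  ispd i a f p (\sum_b jac i j p a b * pd j b f p).
Proof.
move=> oiW ojW Wp ip jp fs.
have oWj : copen i (W `&` dom j) by apply: copenI => //; exact: (sa_dom Asm).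
pose D := cimg i (W `&` dom j); pose D' := cimg j W.
pose phi x := crd j (prm i x).
have Dx : D (crd i p) by apply: cimg_crd.
have phix : phi (crd i p) = crd j p by rewrite /phi (sa_crdK Asm).
have DD' y : D y -> D' (phi y) by move=> /cimgP[iy [Wy jy]]; exact: cimg_crd.
have lD' : lorthant D' by exact: lorthant_cimg.
have phil b : is_pd D a (fun y => phi y 0 b) (crd i p) (jac i j p a b).
  have := ispdP (a := a) (sa_dom Asm (i := i) (j := j)) jp ip (sa_smooth Asm i j b).
  rewrite mxE; apply: is_pd_local => //; first exact: img_crd.
  by exists 1 => // y _; split=> // /cimgP[].
pose df b y := pd j b f (prm j y).
have fdf b y : D' y -> is_pd D' b (f \o prm j) y (df b y).
  move=> /[dup] D'y /cimgP[jy Wy]; have [jy' yE] := img_prm jy.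
  have := ispdP (a := b) ojW Wy jy' fs; rewrite /ispd yE; apply: is_pd_local => //.
  by exists 1 => // z _; split=> // /cimgP[].
have cdf b : wcont D' (df b) (phi (crd i p)).
  have := smooth_in_pd b ojW fs => /(_ 0%N)/Ck_cont; apply.
  by rewrite phix; exact: cimg_crd.
have := is_pd_chain lD' Dx DD' phil fdf cdf => H.
have -> : \sum_b jac i j p a b * pd j b f p =
    \sum_b df b (phi (crd i p)) * jac i j p a b.
  by apply: eq_bigr => b _; rewrite mulrC /df phix (sa_crdK Asm).
apply: is_pd_local H => //.
- have [|r r0 rP] := oWj _ (img_crd ip); first by rewrite (sa_crdK Asm).
  exists r => // y yr; split=> iy; first by apply/cimgP; split=> //; exact: rP.
  by rewrite /= /phi (sa_crdK Asm)//; case: (rP _ yr iy).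
- by rewrite /= phix !(sa_crdK Asm).
Qed.

Lemma grad_chain i j W f p : copen i W -> copen j W -> W p -> dom i p ->
  dom j p -> smooth_in j W f -> grad i f p = jac i j p *m grad j f p.
Proof.
move=> oiW ojW Wp ip jp fs; apply/matrixP => a b; rewrite !mxE.
rewrite (ispd_pd ip (chain_rule oiW ojW Wp ip jp fs)).
by apply: eq_bigr => c _; rewrite !mxE.
Qed.

Lemma ispd_crd i a b p : dom i p -> ispd i a (fun q => crd i q 0 b) p (b == a)%:R.
Proof.
move=> ip; apply: is_pd_eq (@is_pd_coord _ _ (img i) a b (crd i p)) => //.
  exact: img_crd.
by move=> y /img_prm[_ /= ->].
Qed.

Lemma jacK i j p : dom i p -> dom j p -> jac i j p *m jac j i p = 1%:M.
Proof.
move=> ip jp; apply/matrixP => a c; rewrite !mxE.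
have H := chain_rule (a := a) (sa_dom Asm (i := i) (j := i))
  (sa_dom Asm (i := j) (j := i)) ip ip jp (sa_smooth Asm j i c).
have := ispd_unique ip H (ispd_crd (a := a) (b := c) ip); rewrite eq_sym => <-.
by apply: eq_bigr => b _; rewrite [jac j i p b c]mxE.
Qed.

Lemma jac_unit i j p : dom i p -> dom j p -> jac i j p \in unitmx.
Proof. by move=> ip jp; case/mulmx1_unit: (jacK ip jp). Qed.

Lemma jac_smooth i j : smooth_mx i (dom j) (jac i j).
Proof.
move=> a b; apply: (@smooth_in_ext i (dom j) (pd i a (fun q => crd j q 0 b))).
- exact: (sa_dom Asm).
- by move=> q _ _; rewrite mxE.
by apply: smooth_in_pd; [exact: (sa_dom Asm)|exact: (sa_smooth Asm)].
Qed.

Lemma dens_trans_smooth i j : smooth_in i (dom j) (dens_trans i j).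
Proof.
apply: smooth_in_norm_powR; first exact: (sa_dom Asm).
- by move=> p jp ip; rewrite -unitfE -unitmxE jac_unit.
- by apply: smooth_in_det; [exact: (sa_dom Asm)|exact: jac_smooth].
Qed.

Lemma dens_trans_gt0 i j p : dom i p -> dom j p -> 0 < dens_trans i j p.
Proof.
move=> ip jp; rewrite /dens_trans powR_gt0// normr_gt0.
by rewrite -unitfE -unitmxE jac_unit.
Qed.

Lemma schwarz_pd i a b W f p : copen i W -> W p -> dom i p -> smooth_in i W f ->
  pd i a (pd i b f) p = pd i b (pd i a f) p.
Proof.
move=> oW Wp ip fs; have lD := lorthant_cimg oW.
have sub g c (q : 'rV[R]_m) : smooth_in i W g -> cimg i W q ->
    is_pd (cimg i W) c (g \o prm i) q (pd i c g (prm i q)).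
  move=> gs /[dup] Dq /cimgP[iq Wq]; have [iq' qE] := img_prm iq.
  have := ispdP (a := c) oW Wq iq' gs; rewrite /ispd qE; apply: is_pd_local => //.
  by exists 1 => // y _; split=> // /cimgP[].
have cp : cimg i W (crd i p) by exact: cimg_crd.
have E (g : T -> R) : (g \o prm i) (crd i p) = g p by rewrite /= (sa_crdK Asm).
rewrite -(E (pd i a (pd i b f))) -(E (pd i b (pd i a f))); apply/esym.
apply: (@schwarz _ _ (cimg i W) (f \o prm i) (pd i a f \o prm i)
  (pd i b f \o prm i) _ _ (crd i p) a b lD cp).
- by move=> y; exact: sub.
- by move=> y; exact: sub.
- by move=> y; apply: sub; exact: smooth_in_pd.
- by move=> y; apply: sub; exact: smooth_in_pd.
- by apply: Ck_cont cp; apply: (smooth_in_pd b oW (smooth_in_pd a oW fs) 0).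
- by apply: Ck_cont cp; apply: (smooth_in_pd a oW (smooth_in_pd b oW fs) 0).
Qed.

End Charts.

(** * Manifolds with boundary *)

Section DerivativeSign.
Context {R : realType} {m : nat}.
Implicit Types (D : set 'rV[R]_m) (f g : 'rV[R]_m -> R) (x : 'rV[R]_m).

(** The first order condition at a minimum is split by sides, because at a boundary point only one
    of them may be available. *)
Lemma is_pd_ge0 D a f x (l : R) : lorthant D -> D x -> is_pd D a f x l ->
  (forall h : R, 0 < h -> D (x + h *: delta_mx 0 a) ->
     f x <= f (x + h *: delta_mx 0 a)) -> 0 <= l.
Proof.
move=> lD Dx /is_pdP fl fx; rewrite leNgt; apply/negP => l0.
have [|r r0 rP] := fl (- l); first by rewrite oppr_gt0.
have [s s0 sP] := lorthant_shift a lD Dx.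
pose h := Num.min r s / 2.
have m0 : 0 < Num.min r s by rewrite lt_min r0.
have h0 : 0 < h by rewrite divr_gt0.
have [hr hs] : h < r /\ h < s.
  have : Num.min r s <= r by rewrite ge_min lexx.
  have : Num.min r s <= s by rewrite ge_min lexx orbT.
  by rewrite /h; lra.
have Dh : D (x + h *: delta_mx 0 a) by apply: sP; rewrite (ltW h0).
have := rP h; rewrite gt_eqF// gtr0_norm// => /(_ isT hr Dh).
rewrite ltr_norml => /andP[_].
have : 0 <= dquot a f x h.
  by rewrite mulr_ge0 ?invr_ge0 ?(ltW h0)// subr_ge0 fx.
by lra.
Qed.

Lemma is_pd_le0 D a f x (l : R) r : 0 < r ->
  (forall h : R, - r < h < 0 -> D (x + h *: delta_mx 0 a)) -> is_pd D a f x l ->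
  (forall h : R, h < 0 -> D (x + h *: delta_mx 0 a) ->
     f x <= f (x + h *: delta_mx 0 a)) -> l <= 0.
Proof.
move=> r0 Dr /is_pdP fl fx; rewrite leNgt; apply/negP => l0.
have [s s0 sP] := fl l l0.
pose h := - (Num.min r s / 2).
have m0 : 0 < Num.min r s by rewrite lt_min r0.
have h0 : h < 0 by rewrite oppr_lt0 divr_gt0.
have [hr hs] : - r < h /\ - h < s.
  have : Num.min r s <= r by rewrite ge_min lexx.
  have : Num.min r s <= s by rewrite ge_min lexx orbT.
  by rewrite /h; lra.
have Dh : D (x + h *: delta_mx 0 a) by apply: Dr; rewrite hr.
have := sP h; rewrite lt_eqF// ltr0_norm// => /(_ isT hs Dh).
rewrite ltr_norml => /andP[+ _].
have : dquot a f x h <= 0.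
  by rewrite /dquot mulr_le0_ge0 ?invr_le0 ?(ltW h0)// subr_ge0 fx.
by lra.
Qed.

Lemma is_pd_line_eq D D' a f g x (l : R) :
  (forall h : R, D' (x + h *: delta_mx 0 a) ->
     D (x + h *: delta_mx 0 a) /\
     f (x + h *: delta_mx 0 a) = g (x + h *: delta_mx 0 a)) ->
  f x = g x -> is_pd D a f x l -> is_pd D' a g x l.
Proof.
move=> fg fgx /is_pdP fl; apply/is_pdP => e /fl[r r0 rP].
exists r => // h h0 hr D'h; have [Dh fgh] := fg h D'h.
by have := rP h h0 hr Dh; rewrite /dquot fgh fgx.
Qed.

End DerivativeSign.

(** * Restriction to the boundary hyperplane *)

Section BoundaryEmbedding.
Context {R : realType} {n : nat}.
Implicit Types (D : set 'rV[R]_n.+1) (f : 'rV[R]_n.+1 -> R) (y z : 'rV[R]_n).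

Definition emb y : 'rV[R]_n.+1 := row_mx (0 : 'M[R]_1) y : 'rV_(1 + n).

Lemma emb_lift y (a : 'I_n) : emb y 0 (lift ord0 a) = y 0 a.
Proof.
rewrite /emb (_ : lift ord0 a = rshift 1 a); last exact: val_inj.
by rewrite (@row_mxEr _ 1 1 n).
Qed.

Lemma emb0 y : emb y 0 0 = 0.
Proof.
rewrite /emb (_ : (0 : 'I_n.+1) = lshift n (0 : 'I_1)); last exact: val_inj.
by rewrite (@row_mxEl _ 1 1 n) mxE.
Qed.

Lemma emb_inj (x : 'rV[R]_n.+1) : x 0 0 = 0 ->
  emb (\row_a x 0 (lift ord0 a)) = x.
Proof.
move=> x0; apply/rowP => b; case: (unliftP ord0 b) => [a ->|->].
  by rewrite emb_lift mxE.
by rewrite emb0.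
Qed.

Lemma emb_shift y (h : R) (a : 'I_n) :
  emb (y + h *: delta_mx 0 a) = emb y + h *: delta_mx 0 (lift ord0 a).
Proof.
apply/rowP => b; rewrite shiftE; case: (unliftP ord0 b) => [c ->|->].
  by rewrite !emb_lift shiftE (inj_eq lift_inj).
by rewrite !emb0 (negbTE (neq_lift _ _)) mulr0 addr0.
Qed.

Lemma cube_emb y z (r : R) : 0 < r -> cube y r z -> cube (emb y) r (emb z).
Proof.
move=> r0 yz b; case: (unliftP ord0 b) => [a ->|->].
  by rewrite !emb_lift; exact: yz.
by rewrite !emb0 subrr normr0.
Qed.

Definition demb D : set 'rV[R]_n := [set y | D (emb y)].

Lemma lorthant_demb D : hopen D -> lorthant (demb D).
Proof.
move=> hD; exists pred0, (demb D); split; last first.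
  by apply/seteqP; split=> [y Dy|y [] //]; split=> // a.
rewrite openE => y Dy; apply/nbhs_cubeP.
have [r r0 rP] := hopen_cube hD Dy; exists r => // z yz.
by apply: rP; [exact: cube_emb|rewrite emb0].
Qed.

Lemma is_pd_emb D (D' : set 'rV[R]_n) (a : 'I_n) f y (l : R) : (forall z, D' z -> D (emb z)) ->
  is_pd D (lift ord0 a) f (emb y) l -> is_pd D' a (f \o emb) y l.
Proof.
move=> DD' /is_pdP fl; apply/is_pdP => e /fl[r r0 rP]; exists r => // h h0 hr.
by move=> /DD'; rewrite /dquot /= !emb_shift => Dh; exact: rP.
Qed.

Lemma wcont_emb D f y : wcont D f (emb y) -> wcont (demb D) (f \o emb) y.
Proof.
move=> /wcontP cf; apply/wcontP => e /cf[r r0 rP]; exists r => // z yz Dz.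
by apply: rP => //; exact: cube_emb.
Qed.

Lemma Ck_emb k D f : hopen D -> Ck k D f -> Ck k (demb D) (f \o emb).
Proof.
move=> hD; elim: k f => [|k IH] f fk.
  by split=> //; apply/withinP => y Dy; apply: wcont_emb; exact: Ck_cont fk _.
apply: (@Ck_intro _ _ _ _ _ (fun a => pderiv D (lift ord0 a) f \o emb)).
- exact: lorthant_demb.
- by move=> y Dy; apply: wcont_emb; exact: Ck_cont fk _.
- by move=> a y Dy; apply: is_pd_emb (Ck_is_pd fk Dy).
by move=> a; apply: IH; exact: Ck_pderiv.
Qed.

End BoundaryEmbedding.

Section ManifoldWithBoundary.
Context {R : realType} {n : nat} {T : topologicalType} (A : atlas R n.+1 T).
Hypothesis Amfd : manifold_with_boundary A.
Implicit Types (i j : idx A) (a b c : 'I_n.+1) (p q : T) (f g : T -> R) (W : set T).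

Lemma hopen_img i : hopen (img i).
Proof. by have [V oV ->] := mwb_img Amfd i; exists V. Qed.

Lemma copen_open i W : open W -> copen i W.
Proof.
move=> oW x ix Wx.
have cp : {within img i, continuous (prm i)} by exact: (mwb_prm_cont Amfd).
move/subspace_continuousP/(_ x ix)/(_ W) : cp; rewrite nbhs_simpl /= => H.
have /nbhs_cubeP[r r0 rP] := H (open_nbhs_nbhs (conj oW Wx)).
by exists r => // y /rP.
Qed.

Lemma mwb_smooth_atlas : smooth_atlas A.
Proof.
split.
- by move=> i; apply: hopen_lorthant; exact: hopen_img.
- exact: (mwb_crdK Amfd).
- by move=> i j; apply: copen_open; exact: (mwb_open Amfd).
- exact: (mwb_smooth Amfd).
Qed.
Let Asm := mwb_smooth_atlas.

Lemma crd_ge0 i p : dom i p -> 0 <= crd i p 0 0.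
Proof. by move=> ip; apply: (hopen_ge0 (hopen_img i)); exact: img_crd. Qed.

Lemma hopen_cimg i W : copen i W -> hopen (cimg i W).
Proof.
move=> oW; have [V oV imgE] := hopen_img i.
pose O := [set x : 'rV[R]_n.+1 | \forall y \near x, img i y -> W (prm i y)].
exists (V `&` O); first by apply: openI => //; exact: open_interior.
rewrite setIAC -imgE; apply/seteqP; split=> x.
  move=> /(cimgP Asm)[ix Wx]; split=> //; apply/nbhs_cubeP.
  by have [r r0 rP] := oW x ix Wx; exists r.
by move=> [ix /nbhs_singleton Wx]; apply/(cimgP Asm); split=> //; exact: Wx.
Qed.

(* The coordinate 0 of a chart around an interior point attains its minimum at a
   boundary point, where its differential would vanish. *)
Lemma bdry_crd i p : dom i p -> bdry A p <-> crd i p 0 0 = 0.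
Proof.
move=> ip; split=> [[j jp jp0]|]; last by exists i.
apply/eqP; apply: contraT => i0.
have ip0 : 0 < crd i p 0 0 by rewrite lt_def i0 crd_ge0.
have oW : copen i (dom j) by exact: (sa_dom Asm).
pose D := cimg i (dom j).
have Dx : D (crd i p) by exact: cimg_crd.
have [r1 r10 r1P] := hopen_cube (hopen_cimg oW) Dx.
have J0 b : jac i j p b 0 = 0.
  have H : is_pd D b ((fun q => crd j q 0 0) \o prm i) (crd i p) (jac i j p b 0).
    have := ispdP Asm (a := b) oW jp ip (sa_smooth Asm i j 0).
    rewrite mxE; apply: is_pd_local => //; first exact: img_crd.
    by exists 1 => // y _; split=> // /(cimgP Asm)[].
  have fx h : D (crd i p + h *: delta_mx 0 b) ->
      ((fun q => crd j q 0 0) \o prm i) (crd i p) <=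
      ((fun q => crd j q 0 0) \o prm i) (crd i p + h *: delta_mx 0 b).
    move=> /(cimgP Asm)[_ jy]; rewrite /= (sa_crdK Asm)// jp0.
    exact: crd_ge0.
  apply/eqP; rewrite eq_le; apply/andP; split; last first.
    by apply: (is_pd_ge0 _ Dx H) => [|h _]; [exact: lorthant_cimg|exact: fx].
  apply: (@is_pd_le0 _ _ D b ((fun q => crd j q 0 0) \o prm i) (crd i p) _
    (Num.min r1 (crd i p 0 0))) => //.
  - by rewrite lt_min r10.
  - move=> h; rewrite ltrNl lt_min => /andP[/andP[hr hc] h0]; apply: r1P.
      by apply: cube_shift; rewrite ltr0_norm.
    rewrite shiftE; case: (0 == b); rewrite ?mulr1 ?mulr0 ?addr0 ?(ltW ip0)//.
    by rewrite addrC -subr_ge0 ?opprK in hc *; lra.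
  - by move=> h _; exact: fx.
have := congr1 (fun M : 'M[R]_n.+1 => M 0 0) (jacK Asm jp ip).
rewrite !mxE big1 => [/eqP|b _]; last by rewrite J0 mulr0.
by rewrite eq_sym oner_eq0.
Qed.

Lemma minterior_crd i p : dom i p -> minterior A p <-> 0 < crd i p 0 0.
Proof.
move=> ip; rewrite lt_def crd_ge0// andbT.
by split=> [/(bdry_crd ip)/eqP //|/eqP Hx /(bdry_crd ip)].
Qed.

Lemma cimg_minterior i W : cimg i (W `&` minterior A) = hint (cimg i W).
Proof.
apply/seteqP; split=> x.
  move=> [p [[Wp mp] ip] <-]; split; first exact: cimg_crd.
  by apply/(minterior_crd ip).
move=> [[p [Wp ip] <-]] xp; exists p => //; split=> //; split=> //.
exact/(minterior_crd ip).
Qed.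

Lemma copen_minterior i : copen i (minterior A).
Proof.
move=> x ix mx; have [ip xE] := img_prm Asm ix.
have /(minterior_crd ip) := mx; rewrite xE => x0.
exists (x 0 0) => // y yx iy; have [iyp yE] := img_prm Asm iy.
apply/(minterior_crd iyp); rewrite yE.
by have := yx 0; rewrite ltr_norml => /andP[+ _]; lra.
Qed.

Lemma interior_eq i W f g : copen i W ->
  (forall p, W p -> dom i p -> wcont (cimg i W) (f \o prm i) (crd i p)) ->
  (forall p, W p -> dom i p -> wcont (cimg i W) (g \o prm i) (crd i p)) ->
  (forall p, W p -> minterior A p -> dom i p -> f p = g p) ->
  forall p, W p -> dom i p -> f p = g p.
Proof.
move=> oW cf cg fg p Wp ip.
have := @wcont_hint_eq _ _ (cimg i W) (f \o prm i) (g \o prm i) (crd i p)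
  (hopen_cimg oW) (cimg_crd Wp ip) (cf p Wp ip) (cg p Wp ip).
rewrite /= !(sa_crdK Asm)//; apply=> y.
rewrite -cimg_minterior => -[q [[Wq mq] iq] <-] /=.
by rewrite (sa_crdK Asm)// fg.
Qed.

Lemma smooth_in_wcont i W f p : W p -> dom i p -> smooth_in i W f ->
  wcont (cimg i W) (f \o prm i) (crd i p).
Proof. by move=> Wp ip fs; apply: Ck_cont (fs 0%N) (cimg_crd Wp ip). Qed.

Lemma interior_eq_smooth i W f g : copen i W -> smooth_in i W f ->
  smooth_in i W g ->
  (forall p, W p -> minterior A p -> dom i p -> f p = g p) ->
  forall p, W p -> dom i p -> f p = g p.
Proof.
move=> oW fs gs; apply: interior_eq => // p Wp ip; exact: smooth_in_wcont.
Qed.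

Lemma tangential_pd i (a : 'I_n) W f p l : copen i W -> W p -> bdry A p -> dom i p ->
  (forall q, W q -> bdry A q -> dom i q -> f q = 0) ->
  ispd i (lift ord0 a) f p l -> l = 0.
Proof.
move=> oW Wp bp ip f0 fl.
have x0 : crd i p 0 0 = 0 by apply/(bdry_crd ip).
have [|r r0 rP] := oW _ (img_crd ip); first by rewrite (sa_crdK Asm).
have lD : lorthant (cimg i W) by exact: lorthant_cimg.
apply: (is_pd_unique lD (cimg_crd Wp ip)) (@is_pd_cst _ _ _ (lift ord0 a) _ 0).
apply: is_pd_line_eq fl => [h /(cimgP Asm)[iy Wy]|]; last first.
  by rewrite /= (sa_crdK Asm)// f0.
split=> //=; have [iq qE] := img_prm Asm iy; rewrite f0//.
apply/(bdry_crd iq); rewrite qE shiftE (negbTE (neq_lift _ _)).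
by rewrite mulr0 addr0.
Qed.

Lemma normal_pd_ge0 i W f p l : copen i W -> W p -> bdry A p -> dom i p ->
  f p = 0 -> (forall q, W q -> dom i q -> 0 <= f q) ->
  ispd i ord0 f p l -> 0 <= l.
Proof.
move=> oW Wp bp ip fp f0 fl.
have lD : lorthant (cimg i W) by exact: lorthant_cimg.
apply: (is_pd_ge0 lD (cimg_crd Wp ip)).
  apply: is_pd_local fl; first exact: img_crd.
  - by exists 1 => // y _; split=> // /(cimgP Asm)[].
  - by [].
move=> h _ /(cimgP Asm)[iy Wy]; rewrite /= (sa_crdK Asm)// fp.
by apply: f0 => //; case: (img_prm Asm iy).
Qed.

Lemma jac_tangential i j p (a : 'I_n) : bdry A p -> dom i p -> dom j p ->
  jac i j p (lift ord0 a) 0 = 0.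
Proof.
move=> bp ip jp; rewrite mxE.
have oW : copen i (dom j) by exact: (sa_dom Asm).
have := ispdP Asm (a := lift ord0 a) oW jp ip (sa_smooth Asm i j 0).
by apply: tangential_pd oW jp bp ip _ => q jq bq iq; apply/(bdry_crd jq).
Qed.

Lemma jac_normal i j p : bdry A p -> dom i p -> dom j p -> 0 < jac i j p 0 0.
Proof.
move=> bp ip jp; rewrite lt_def; apply/andP; split.
  apply/eqP => J0; have := congr1 (fun M : 'M[R]_n.+1 => M 0 0) (jacK Asm jp ip).
  rewrite !mxE big1 => [/eqP|b _]; first by rewrite eq_sym oner_eq0.
  case: (unliftP ord0 b) => [a ->|->]; last by rewrite J0 mulr0.
  by rewrite jac_tangential// mulr0.
have oW : copen i (dom j) by exact: (sa_dom Asm).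
have := ispdP Asm (a := 0) oW jp ip (sa_smooth Asm i j 0); rewrite mxE => H.
apply: (normal_pd_ge0 oW jp bp ip _ _ H); first by apply/(bdry_crd jp).
by move=> q jq iq; exact: crd_ge0.
Qed.

Local Notation B := (bdry_atlas A).

Lemma crd_bdry i p : bdry A p -> dom i p -> crd i p = emb (@crd _ _ _ B i p).
Proof.
by move=> bp ip; rewrite /= emb_inj//; apply/(bdry_crd ip).
Qed.

Lemma cimg_bdry i W : @cimg _ _ _ B i W = demb (cimg i W).
Proof.
apply/seteqP; split=> y.
  move=> [p [Wp [ip bp]] <-]; rewrite /demb /= -(crd_bdry bp ip).
  exact: cimg_crd.
move=> [p [Wp ip] pE]; have bp : bdry A p.
  by apply/(bdry_crd ip); rewrite pE emb0.
exists p => //; apply/rowP => a.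
by rewrite /= mxE pE emb_lift.
Qed.

Lemma img_bdry i : @img _ _ _ B i = demb (img i).
Proof.
have cT m (A' : atlas R m T) (k : idx A') : cimg k setT = img k.
  by rewrite /cimg setTI.
by rewrite -!cT cimg_bdry.
Qed.

Lemma copen_bdry i W : copen i W -> @copen _ _ _ B i W.
Proof.
move=> oW y; rewrite img_bdry => iy Wy.
have [r r0 rP] := oW _ iy Wy; exists r => // z yz iz.
by apply: rP => //; exact: cube_emb.
Qed.

Lemma smooth_in_bdry i W f : copen i W -> smooth_in i W f ->
  @smooth_in _ _ _ B i W f.
Proof.
move=> oW fs k; have := Ck_emb (hopen_cimg oW) (fs k).
by rewrite -cimg_bdry.
Qed.

Lemma ispd_bdry i (a : 'I_n) f p l : bdry A p -> dom i p ->
  ispd i (lift ord0 a) f p l -> @ispd _ _ _ B i a f p l.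
Proof.
move=> bp ip fl.
have := @is_pd_emb _ _ (img i) (@img _ _ _ B i) a (f \o prm i) (@crd _ _ _ B i p) l.
rewrite -(crd_bdry bp ip); apply=> //.
by move=> z; rewrite img_bdry.
Qed.

Lemma bdry_smooth_atlas : smooth_atlas B.
Proof.
split.
- move=> i; rewrite img_bdry; apply: lorthant_demb; exact: hopen_img.
- move=> i p [ip bp] /=.
  by rewrite -/(emb _) -(crd_bdry bp ip) (sa_crdK Asm).
- move=> i j y iy [jy by_].
  have /copen_bdry/(_ y iy jy)[r r0 rP] : @copen _ _ _ A i (@dom _ _ _ A j).
    exact: (sa_dom Asm).
  exists r => // z yz iz; split; first exact: rP.
  move: iz => [q [iq bq] <-] /=.
  by rewrite -/(emb _) -(crd_bdry bq iq) (sa_crdK Asm).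
- move=> i j b.
  have H : @smooth_in _ _ _ B i (@dom _ _ _ A j)
      (fun p => @crd _ _ _ A j p 0 (lift ord0 b)).
    by apply: smooth_in_bdry; [exact: (sa_dom Asm)|exact: (sa_smooth Asm)].
  move=> k; have := H k; congr (Ck k _ _).
    apply/seteqP; split=> y [q [jq [iq bq]] qE]; exists q => //.
    by split=> //; case: jq.
  by apply/funext => y; rewrite /= mxE.
Qed.
Let Bsm := bdry_smooth_atlas.

Lemma pd_bdry i (a : 'I_n) W f p : copen i W -> W p -> bdry A p -> dom i p ->
  smooth_in i W f -> @pd _ _ _ B i a f p = pd i (lift ord0 a) f p.
Proof.
move=> oW Wp bp ip fs; apply: (ispd_pd Bsm); first by split.
by apply: ispd_bdry => //; exact: (ispdP Asm oW Wp ip fs).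
Qed.

Lemma jac_bdry i j p (a b : 'I_n) : bdry A p -> dom i p -> dom j p ->
  @jac _ _ _ B i j p a b = jac i j p (lift ord0 a) (lift ord0 b).
Proof.
move=> bp ip jp; rewrite !mxE.
have -> : (fun q => @crd _ _ _ B j q 0 b) = (fun q => crd j q 0 (lift ord0 b)).
  by apply/funext => q; rewrite /= mxE.
by apply: pd_bdry (sa_smooth Asm _ _ _) => //; exact: (sa_dom Asm).
Qed.

(** Changes of charts are block triangular along the boundary. The positive normal entry is the
    discrepancy between ambient and boundary densities that [bdry_factor] has to absorb. *)
Lemma det_jac_bdry i j p : bdry A p -> dom i p -> dom j p ->
  \det (jac i j p) = jac i j p 0 0 * \det (@jac _ _ _ B i j p).
Proof.
move=> bp ip jp; rewrite (expand_det_col _ 0) big_ord_recl big1 => [|a _].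
  rewrite addr0 /cofactor expr0 mul1r; congr (_ * \det _).
  by apply/matrixP => a b; rewrite jac_bdry// !mxE.
by rewrite jac_tangential// mul0r.
Qed.

End ManifoldWithBoundary.

(** * Projective changes and the tractor connection *)

Section ProjectiveChange.
Context {R : realType} {m : nat} {T : Type} (A : atlas R m T).
Hypothesis Asm : smooth_atlas A.
Implicit Types (i j : idx A) (a b c d e : 'I_m) (p q : T) (W : set T).
Implicit Types (G : conn A) (w : oneform A).

Lemma sum_delta (F : 'I_m -> R) b : \sum_e F e * (b == e)%:R = F b.
Proof.
rewrite (bigD1 b)//= eqxx mulr1 big1 ?addr0// => e eb.
by rewrite eq_sym (negbTE eb) mulr0.
Qed.

Lemma theta_change G w i p a : theta (proj_change G w) i p a 0 =
  theta G i p a 0 + w i p a 0.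
Proof.
rewrite !mxE /proj_change !big_split /=.
under [X in _ + X + _]eq_bigr do rewrite eqxx mulr1.
rewrite sumr_const card_ord sum_delta -mulr_natl.
have m0 : m.+1%:R != 0 :> R by rewrite pnatr_eq0.
by rewrite !mulrDr -addrA; congr (_ + _); rewrite -natr1 in m0 *; field.
Qed.

(** Thomas' projective parameters. Subtracting [theta] removes the trace chart by chart, so the
    result does not transform as a connection; in exchange it is a projective invariant
    ([thomas_change]). *)
Definition thomas G : conn A := proj_change G (fun i p => - theta G i p).

Lemma thomasE G i p c a b : thomas G i p c a b =
  G i p c a b - theta G i p a 0 * (b == c)%:R - theta G i p b 0 * (a == c)%:R.
Proof.
have mxN (X : 'cV[R]_m) u : (- X) u 0 = - X u 0 by rewrite mxE.
by rewrite /thomas /proj_change !mxN; ring.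
Qed.

Lemma thomas_change G w i p c a b :
  thomas (proj_change G w) i p c a b = thomas G i p c a b.
Proof. by rewrite !thomasE !theta_change /proj_change; ring. Qed.

(** Pure index calculus, with [dG] and [dw] in place of derivatives. Symmetry of [dw], that is,
    closedness of the one-form, turns the derivative terms of [E1] into a multiple of m - 1; [E2]
    and [E3] are the two quadratic contractions. *)
Lemma ricci_change_alg (G : 'I_m -> 'I_m -> 'I_m -> R)
    (dG : 'I_m -> 'I_m -> 'I_m -> 'I_m -> R) (w : 'I_m -> R)
    (dw : 'I_m -> 'I_m -> R) a b :
  let G' c a b := G c a b + w a * (b == c)%:R + w b * (a == c)%:R in
  let dG' d c a b := dG d c a b + dw d a * (b == c)%:R + dw d b * (a == c)%:R in
  (forall c a b, G c a b = G c b a) -> (forall a b, dw a b = dw b a) ->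
  \sum_c (dG' c c a b - dG' a c c b +
    \sum_e (G' c c e * G' e a b - G' c a e * G' e c b)) =
  \sum_c (dG c c a b - dG a c c b +
    \sum_e (G c c e * G e a b - G c a e * G e c b)) -
  (m%:R - 1) * (dw a b - \sum_c G c a b * w c - w a * w b).
Proof.
move=> G' dG' Gsym dws.
pose t e := \sum_c G c c e.
pose Gw := \sum_c G c a b * w c.
have E1 : \sum_c (dG' c c a b - dG' a c c b) =
    \sum_c (dG c c a b - dG a c c b) - (m%:R - 1) * dw a b.
  rewrite /dG' !sumrB !big_split /= !sum_delta.
  under [X in _ - (_ + X)]eq_bigr do rewrite eqxx mulr1.
  by rewrite sumr_const card_ord -mulr_natl (dws b a); ring.
have E2 : \sum_c \sum_e G' c c e * G' e a b =
    \sum_c \sum_e G c c e * G e a b + t b * w a + t a * w b +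
    (m%:R + 1) * (Gw + 2 * (w a * w b)).
  rewrite exchange_big [in RHS]exchange_big /=.
  have tr e : \sum_c G' c c e = t e + (m%:R + 1) * w e.
    rewrite /G' !big_split /= sum_delta.
    under [X in _ + _ + X]eq_bigr do rewrite eqxx mulr1.
    by rewrite sumr_const card_ord -mulr_natl /t; ring.
  under eq_bigr do rewrite -mulr_suml tr /G'.
  under [in RHS]eq_bigr do rewrite -mulr_suml -/(t _).
  have -> : \sum_e (t e + (m%:R + 1) * w e) *
      (G e a b + w a * (b == e)%:R + w b * (a == e)%:R) =
      \sum_e (t e * G e a b + (m%:R + 1) * (G e a b * w e) +
       ((t e + (m%:R + 1) * w e) * w a) * (b == e)%:R +
       ((t e + (m%:R + 1) * w e) * w b) * (a == e)%:R).
    by apply: eq_bigr => e _; ring.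
  by rewrite !big_split /= !sum_delta -mulr_sumr -/Gw; ring.
have E3 : \sum_c \sum_e G' c a e * G' e c b =
    \sum_c \sum_e G c a e * G e c b + 2 * Gw + t a * w b + t b * w a +
    (m%:R + 3) * (w a * w b).
  have inner c : \sum_e G' c a e * G' e c b = \sum_e G c a e * G e c b +
      G c a b * w c + G c a c * w b + w a * G c c b + w a * w c * (b == c)%:R +
      w a * w b + (\sum_e w e * G e c b + 2 * (w b * w c)) * (a == c)%:R.
    have -> : \sum_e G' c a e * G' e c b = \sum_e (G c a e * G e c b +
        (G c a e * w c) * (b == e)%:R + (G c a e * w b) * (c == e)%:R +
        (w a * G e c b) * (c == e)%:R + (w a * w c * (b == e)%:R) * (c == e)%:R +
        (w a * w b * (c == e)%:R) * (c == e)%:R +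
        (w e * G e c b) * (a == c)%:R + (w e * w c * (a == c)%:R) * (b == e)%:R +
        (w e * w b * (a == c)%:R) * (c == e)%:R).
      by apply: eq_bigr => e _; rewrite /G' [e == c]eq_sym; ring.
    rewrite !big_split /= !sum_delta -mulr_suml eqxx /=.
    ring.
  under eq_bigr do rewrite inner.
  rewrite !big_split /= !sum_delta sumr_const card_ord -mulr_natl.
  rewrite -!mulr_sumr -!mulr_suml -/Gw.
  have -> : \sum_c G c a c = t a by apply: eq_bigr => c _; rewrite Gsym.
  have -> : \sum_e w e * G e a b = Gw by apply: eq_bigr => e _; rewrite mulrC.
  by rewrite -/(t b); ring.
have split (H : 'I_m -> 'I_m -> 'I_m -> R) (dH : 'I_m -> 'I_m -> 'I_m -> 'I_m -> R) :
    \sum_c (dH c c a b - dH a c c b + \sum_e (H c c e * H e a b - H c a e * H e c b)) =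
    \sum_c (dH c c a b - dH a c c b) + \sum_c \sum_e H c c e * H e a b -
    \sum_c \sum_e H c a e * H e c b.
  rewrite big_split /= -addrA; congr (_ + _); rewrite -sumrB.
  by apply: eq_bigr => c _; rewrite sumrB.
rewrite (split G' dG') (split G dG) E1 E2 E3 -/Gw; ring.
Qed.

Lemma ricci_change G w i p (dG : 'I_m -> 'I_m -> 'I_m -> 'I_m -> R)
    (dw : 'I_m -> 'I_m -> R) : dom i p ->
  (forall d c a b, ispd i d (fun q => G i q c a b) p (dG d c a b)) ->
  (forall d a, ispd i d (fun q => w i q a 0) p (dw d a)) ->
  (forall c a b, G i p c a b = G i p c b a) -> (forall a b, dw a b = dw b a) ->
  forall a b, ricci (proj_change G w) i p a b = ricci G i p a b -
    (m%:R - 1) * (dw a b - \sum_c G i p c a b * w i p c 0 - w i p a 0 * w i p b 0).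
Proof.
move=> ip GdG wdw Gsym dws a b.
have Gd d c a' b' : ispd i d (fun q => proj_change G w i q c a' b') p
    (dG d c a' b' + dw d a' * (b' == c)%:R + dw d b' * (a' == c)%:R).
  rewrite /proj_change; apply: ispdD; first apply: ispdD => //.
    have := ispdM Asm ip (wdw d a') (@ispd_cst _ _ _ _ i d p (b' == c)%:R).
    by rewrite mulr0 addr0.
  have := ispdM Asm ip (wdw d b') (@ispd_cst _ _ _ _ i d p (a' == c)%:R).
  by rewrite mulr0 addr0.
have H := ricci_change_alg dG (fun a => w i p a 0) a b Gsym dws.
rewrite [LHS]mxE [ricci G i p a b]mxE.
rewrite (_ : \sum_c (pd i c (fun q => G i q c a b) p - _ + _) =
  \sum_c (dG c c a b - dG a c c b +
    \sum_e (G i p c c e * G i p e a b - G i p c a e * G i p e c b))).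
  rewrite -H; apply: eq_bigr => c _; congr (_ - _ + _).
  - by rewrite (ispd_pd Asm ip (Gd c c a b)).
  - by rewrite (ispd_pd Asm ip (Gd a c c b)).
by apply: eq_bigr => c _; congr (_ - _ + _); apply: (ispd_pd Asm ip).
Qed.

(* The tractor connection form of a connection preserving |dx|, written for the
   trace-free representative P of the projective class in a chart. *)
Definition thomas_form (P : conn A) i a p : 'M[R]_(1 + m) :=
  block_mx 0 (- delta_mx 0 a) (\col_b (m.-1%:R^-1 * ricci P i p a b))
    (\matrix_(b, c) - P i p c a b).

(** Returning from the splitting to the jet frame amounts to the projective change by [- theta].
    Since [G] preserves a density, [theta] is a constant times a logarithmic differential, hence
    closed, and [ricci_change] gives the lower left block. *)
Lemma jet_form_thomas W G i a p : (1 < m)%N -> copen i W -> is_conn W G ->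
  special W G -> W p -> dom i p ->
  jet_form G i a p = thomas_form (thomas G) i a p.
Proof.
move=> m1 oW [Gs Gsym _] [v [vs v0 _] vG] Wp ip.
have m1' : m.-1%:R = m%:R - 1 :> R by rewrite -{2}(prednK (ltnW m1)) -natr1 addrK.
have m0 : m.+1%:R != 0 :> R by rewrite pnatr_eq0.
have ts b : smooth_in i W (fun q => theta G i q b 0).
  apply: (@smooth_in_ext _ _ _ _ Asm _ _ (fun q => m.+1%:R^-1 * \sum_c G i q c b c)) => //.
    by move=> q _ _; rewrite mxE.
  apply: smooth_inM => //; first exact: smooth_in_cst.
  by apply: smooth_in_sum.
have tv b q : W q -> dom i q -> theta G i q b 0 = m.+1%:R^-1 * (pd i b (v i) q / v i q).
  move=> Wq iq; rewrite mxE; have /eqP := vG i q b Wq iq; rewrite subr_eq0 => /eqP ->.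
  by rewrite mulfK// gt_eqF// v0.
pose dt d b := pd i d (fun q => theta G i q b 0) p.
have tdt d b : ispd i d (fun q => theta G i q b 0) p (dt d b).
  exact: (ispdP Asm oW Wp ip (ts b)).
have dts d b : dt d b = dt b d.
  have vp : v i p != 0 by rewrite gt_eqF// v0.
  have H c e : dt c e = m.+1%:R^-1 * (pd i c (pd i e (v i)) p * (v i p)^-1 +
      pd i e (v i) p * (- pd i c (v i) p / (v i p * v i p))).
    apply: (ispd_pd Asm ip).
    apply: (ispd_local Asm oW Wp ip (f := fun q => m.+1%:R^-1 * (pd i e (v i) q / v i q))).
      by move=> q Wq iq; rewrite tv.
    have pv := ispdP Asm (a := c) oW Wp ip (smooth_in_pd Asm e oW (vs i)).
    have iv := ispdV Asm ip vp (ispdP Asm (a := c) oW Wp ip (vs i)).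
    have := ispdM Asm ip (@ispd_cst _ _ _ _ i c p m.+1%:R^-1) (ispdM Asm ip pv iv).
    by rewrite mul0r add0r.
  by rewrite !H (schwarz_pd Asm d b oW Wp ip (vs i)); congr (_ * (_ + _)); ring.
pose dG d c a' b' := pd i d (fun q => G i q c a' b') p.
have GdG d c a' b' : ispd i d (fun q => G i q c a' b') p (dG d c a' b').
  exact: (ispdP Asm oW Wp ip (Gs i c a' b')).
have tN d b : ispd i d (fun q => (- theta G i q) b 0) p (- dt d b).
  by under [X in ispd _ _ X]eq_fun do rewrite mxE; exact: ispdN.
have dtNs d b : - dt d b = - dt b d by rewrite dts.
have Gsym' c a' b' : G i p c a' b' = G i p c b' a' by exact: Gsym.
have Q b : m.-1%:R^-1 * ricci (thomas G) i p a b = schouten G i p a b + dt a b -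
    \sum_c G i p c a b * theta G i p c 0 + theta G i p a 0 * theta G i p b 0.
  have mm : m%:R - 1 != 0 :> R by rewrite -m1' pnatr_eq0 -lt0n -ltnS prednK// ltnW.
  rewrite (ricci_change ip GdG (w := fun i p => - theta G i p) tN Gsym' dtNs).
  have mxN (X : 'cV[R]_m) u : (- X) u 0 = - X u 0 by rewrite mxE.
  rewrite !mxN [schouten _ _ _ _ _]mxE m1'; under eq_bigr do rewrite mxN mulrN.
  by rewrite sumrN; field.
have Si : invmx (splitting G i p) = block_mx 1%:M 0 (- theta G i p) 1%:M.
  have SS : splitting G i p *m block_mx 1%:M 0 (- theta G i p) 1%:M = 1%:M.
    by rewrite mulmx_block !mul1mx !mul0mx !mulmx1 !mulmx0 !addr0 add0r addrN -scalar_mx_block.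
  have Su : splitting G i p \in unitmx by case/mulmx1_unit: SS.
  by rewrite -[LHS]mulmx1 -SS mulmxA mulVmx// mul1mx.
have Sd : pdmx i a (splitting G i) p = block_mx 0 0 (\col_b dt a b) 0.
  apply: (mxpd_pdmx Asm ip); apply: mxpd_block; try exact: mxpd_cst.
  by move=> b c; rewrite mxE ord1; exact: tdt.
rewrite /jet_form Si Sd /split_form /splitting mulmx_block add_block_mx mulmx_block.
rewrite !mul1mx !mul0mx !mulmx0 !mulmx1 !addr0 !add0r /thomas_form.
have ea : - delta_mx 0 a *m theta G i p = - (theta G i p a 0)%:M :> 'M[R]_1.
  rewrite mulNmx; congr (- _); apply/matrixP => u u'; rewrite !ord1 mxE [RHS]mxE mulr1n.
  rewrite (bigD1 a)//= big1 => [|c ca]; first by rewrite mxE !eqxx mul1r addr0.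
  by rewrite mxE (negbTE ca) andbF mul0r.
have mxF (f : 'I_m -> 'I_m -> R) b c : (\matrix_(b, c) f b c) b c = f b c by rewrite mxE.
rewrite ea addrN mulmx0 add0r; congr block_mx.
- apply/matrixP => b u; rewrite !ord1 [RHS]mxE Q.
  have mxD (X Y : 'cV[R]_m) v' : (X + Y) v' 0 = X v' 0 + Y v' 0 by rewrite mxE.
  have mxC (f : 'I_m -> R) v' : (\col_b0 f b0) v' 0 = f v' by rewrite mxE.
  have mxMu (X : 'M[R]_m) (Y : 'cV[R]_m) v' : (X *m Y) v' 0 = \sum_c X v' c * Y c 0.
    by rewrite mxE.
  rewrite !mxD (mxC (fun b0 => schouten G i p a b0)) (mxC (dt a)) mxMu.
  rewrite (eq_bigr (fun c => theta G i p a 0 * theta G i p c 0 * (b == c)%:R -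
      G i p c a b * theta G i p c 0)) => [|c _]; last first.
    by rewrite mxF; ring.
  by rewrite sumrB sum_delta; ring.
apply/matrixP => b c.
have ec : (- theta G i p *m - delta_mx 0 a) b c = theta G i p b 0 * (a == c)%:R.
  by rewrite mulNmx mulmxN opprK mxE big_ord1 [X in _ * X]mxE eqxx eq_sym.
have mxDD (X Y : 'M[R]_m) u u' : (X + Y) u u' = X u u' + Y u u' by rewrite mxE.
by rewrite mxDD ec !mxF thomasE; ring.
Qed.

End ProjectiveChange.

(** * Ricci flat metrics *)

Section MatrixEntries.
Context {R : pzRingType}.

Lemma addmx_entry r s (X Y : 'M[R]_(r, s)) u v : (X + Y) u v = X u v + Y u v.
Proof. by rewrite mxE. Qed.

Lemma mulmx_entry r s t (X : 'M[R]_(r, s)) (Y : 'M[R]_(s, t)) u v :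
  (X *m Y) u v = \sum_k X u k * Y k v.
Proof. by rewrite mxE. Qed.

Lemma scalemx_entry r s (c : R) (X : 'M[R]_(r, s)) u v : (c *: X) u v = c * X u v.
Proof. by rewrite mxE. Qed.

End MatrixEntries.

Section SmoothMatrices.
Context {R : realType} {m : nat} {T : Type} (A : atlas R m T).
Hypothesis Asm : smooth_atlas A.
Implicit Types (i : idx A) (W : set T).

Lemma grad_smooth i W f : copen i W -> smooth_in i W f -> smooth_mx i W (grad i f).
Proof.
move=> oW fs a u; apply: (@smooth_in_ext _ _ _ _ Asm i W (pd i a f)) => //.
  by move=> y _ _; rewrite mxE.
exact: smooth_in_pd.
Qed.

Lemma smooth_mx_col i W (f : T -> R) (F : T -> 'cV[R]_m) : copen i W ->
  smooth_in i W f ->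
  smooth_mx i W F -> smooth_mx i W (fun y => col_mx (f y)%:M (F y) : 'cV_(1 + m)).
Proof.
move=> oW fs Fs u v; case: (fintype.split_ordP u) => u' ->.
  apply: (@smooth_in_ext _ _ _ _ Asm i W f) => // y _ _.
  by rewrite col_mxEu !ord1 mxE eqxx mulr1n.
apply: (@smooth_in_ext _ _ _ _ Asm i W (fun y => F y u' v)) => // y _ _.
by rewrite col_mxEd.
Qed.

Lemma smooth_mx_block i W r1 r2 s1 s2 (F1 : T -> 'M[R]_(r1, s1))
    (F2 : T -> 'M[R]_(r1, s2)) (F3 : T -> 'M[R]_(r2, s1)) (F4 : T -> 'M[R]_(r2, s2)) :
  copen i W -> smooth_mx i W F1 -> smooth_mx i W F2 -> smooth_mx i W F3 -> smooth_mx i W F4 ->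
  smooth_mx i W (fun y => block_mx (F1 y) (F2 y) (F3 y) (F4 y)).
Proof.
move=> oW H1 H2 H3 H4 u v; case: (fintype.split_ordP u) => u' ->;
  case: (fintype.split_ordP v) => v' ->;
  under [X in smooth_in _ _ X]eq_fun do
    rewrite ?block_mxEul ?block_mxEur ?block_mxEdl ?block_mxEdr;
  by [exact: H1|exact: H2|exact: H3|exact: H4].
Qed.

Lemma smooth_mx_cst i W r s (M : 'M[R]_(r, s)) : copen i W ->
  smooth_mx i W (fun _ => M).
Proof. by move=> oW u v; exact: smooth_in_cst. Qed.

End SmoothMatrices.

Section RicciFlat.
Context {R : realType} {m : nat} {T : Type} (A : atlas R m T).
Variables (W : set T) (p q : nat) (g : tensor2 A) (G : conn A).
Hypothesis Asm : smooth_atlas A.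
Hypothesis m1 : (1 < m)%N.
Hypothesis oW : forall i : idx A, copen i W.
Hypothesis gm : is_metric p q W g.
Hypothesis gG : levi_civita W g G.
Hypothesis Gflat : forall i x, W x -> dom i x -> ricci G i x = 0.
Implicit Types (i j : idx A) (a b c : 'I_m) (x y : T).

Definition gammx i x a : 'M[R]_m := \matrix_(b, c) G i x c a b.

Let gs i : smooth_mx i W (g i). Proof. by have [] := gm. Qed.

Lemma metric_unit i x : W x -> dom i x -> g i x \in unitmx.
Proof. by have [_ H _] := gm => Wx ix; exact: has_signature_unit (H i x Wx ix). Qed.

Lemma metric_sym i x : W x -> dom i x -> (g i x)^T = g i x.
Proof. by have [_ H _] := gm => Wx ix; exact: has_signature_sym (H i x Wx ix). Qed.

Lemma det_metric_neq0 i x : W x -> dom i x -> \det (g i x) != 0.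
Proof. by move=> Wx ix; rewrite -unitfE -unitmxE metric_unit. Qed.

Lemma metric_deriv i a x : W x -> dom i x ->
  mxpd i a (g i) x (gammx i x a *m g i x + g i x *m (gammx i x a)^T).
Proof.
move=> Wx ix; have := mxpdP Asm (a := a) (@oW i) Wx ix (@gs i).
suff -> : pdmx i a (g i) x = gammx i x a *m g i x + g i x *m (gammx i x a)^T by [].
apply/matrixP => b c; have := gG.2 i x Wx ix a b c.
rewrite mxE addmx_entry !mulmx_entry => /eqP.
rewrite -addrA -opprD subr_eq0 => /eqP ->; congr (_ + _).
  by apply: eq_bigr => d _; rewrite mxE.
by apply: eq_bigr => d _; rewrite !mxE mulrC.
Qed.

Lemma trace_gammx i x a : \tr (gammx i x a) = m.+1%:R * theta G i x a 0.
Proof.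
rewrite mxE mulrA mulfV ?pnatr_eq0// mul1r; apply: eq_bigr => b _.
by rewrite mxE.
Qed.

Lemma det_metric_deriv i a x : W x -> dom i x ->
  ispd i a (fun y => \det (g i y)) x
    (2 * m.+1%:R * theta G i x a 0 * \det (g i x)).
Proof.
move=> Wx ix; have := ispd_det Asm ix (metric_deriv (a := a) Wx ix).
have -> : \tr ((gammx i x a *m g i x + g i x *m (gammx i x a)^T) *m \adj (g i x)) =
    2 * (\det (g i x) * \tr (gammx i x a)).
  rewrite mulmxDl mxtraceD -[gammx i x a *m _ *m _]mulmxA mul_mx_adj.
  rewrite [\tr (g i x *m _ *m _)]mxtrace_mulC mulmxA mul_adj_mx.
  by rewrite mul_mx_scalar mul_scalar_mx !mxtraceZ mxtrace_tr; ring.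
by rewrite trace_gammx; congr ispd; ring.
Qed.

(** The factor 1/2 stems from the volume density, the square root of |det g|. *)
Definition dens_exp : R := - m.+1%:R^-1 / 2.

Lemma scaleE i x : scale g i x = `|\det (g i x)| `^ dens_exp.
Proof.
by rewrite /scale -powR12_sqrt// -powRrM /dens_exp mulrC.
Qed.

Lemma scale_gt0 i x : W x -> dom i x -> 0 < scale g i x.
Proof.
by move=> Wx ix; rewrite scaleE powR_gt0// normr_gt0 det_metric_neq0.
Qed.

Lemma norm_det_smooth i (s : R) :
  smooth_in i W (fun x => `|\det (g i x)| `^ s).
Proof.
apply: smooth_in_norm_powR => //; first exact: det_metric_neq0.
exact: smooth_in_det.
Qed.

Lemma scale_smooth i : smooth_in i W (scale g i).
Proof.
rewrite (_ : scale g i = (fun x => `|\det (g i x)| `^ dens_exp)).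
  exact: norm_det_smooth.
by apply/funext => x; exact: scaleE.
Qed.

Lemma norm_det_deriv i a x (s : R) : W x -> dom i x ->
  ispd i a (fun y => `|\det (g i y)| `^ s) x
    (2 * s * m.+1%:R * theta G i x a 0 * `|\det (g i x)| `^ s).
Proof.
move=> Wx ix.
have -> : (fun y => `|\det (g i y)| `^ s) =
    (fun y => (\det (g i y) * \det (g i y)) `^ (s / 2)).
  by apply/funext => y; rewrite normr_powR.
have dg := det_metric_deriv (a := a) Wx ix.
have d0 := det_metric_neq0 Wx ix.
have dd0 : 0 < \det (g i x) * \det (g i x).
  by rewrite -expr2 exprn_even_gt0.
have := ispd_powR Asm (s := s / 2) ix dd0 (ispdM Asm ix dg dg).
rewrite normr_powR; set u := \det (g i x) in d0 dd0 *.
have -> : (u * u) `^ (s / 2) = (u * u) `^ (s / 2 - 1) * (u * u).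
  rewrite -{3}(powRr1 (ltW dd0)) -powRD ?subrK//.
  by apply/implyP => _; rewrite gt_eqF.
by congr ispd; field.
Qed.

Lemma scale_deriv i a x : W x -> dom i x ->
  ispd i a (scale g i) x (- theta G i x a 0 * scale g i x).
Proof.
move=> Wx ix; have := norm_det_deriv (a := a) (s := dens_exp) Wx ix.
rewrite (_ : scale g i = (fun x => `|\det (g i x)| `^ dens_exp)); last first.
  by apply/funext => y; exact: scaleE.
congr ispd; rewrite /dens_exp.
have m0 : m.+1%:R != 0 :> R by rewrite pnatr_eq0.
rewrite [in LHS](_ : 2 * _ * _ = - 1); first by ring.
by move: (m.+1%:R) m0 => M M0; field.
Qed.

Lemma scale_trans i j x : overlap W i j x ->
  scale g i x = dens_trans i j x * scale g j x.
Proof.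
move=> ov; have [Wx ix jx] := ov; have [_ _ gt] := gm.
rewrite !scaleE (gt i j x ov) !det_mulmx det_tr !normrM.
rewrite powRM ?mulr_ge0// powRM// /dens_trans mulrAC -powRD.
  by congr (_ `^ _ * _); rewrite /dens_exp; move: (m.+1%:R^-1) => M; field.
by apply/implyP => _; rewrite normr_eq0 -unitfE -unitmxE (jac_unit Asm).
Qed.

Lemma levi_civita_special : special W G.
Proof.
exists (fun i x => `|\det (g i x)| `^ 2^-1).
  split.
  - by move=> i; exact: norm_det_smooth.
  - by move=> i x Wx ix; rewrite powR_gt0// normr_gt0 det_metric_neq0.
  - move=> i j x ov; have [Wx ix jx] := ov; have [_ _ gt] := gm.
    rewrite (gt i j x ov) !det_mulmx det_tr !normrM.
    rewrite powRM ?mulr_ge0// powRM// mulrAC -powRD.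
      by rewrite (_ : 2^-1 + 2^-1 = 1) ?powRr1//; field.
    by apply/implyP => _; rewrite normr_eq0 -unitfE -unitmxE (jac_unit Asm).
move=> i x a Wx ix; rewrite (ispd_pd Asm ix (norm_det_deriv (a := a) (s := 2^-1) Wx ix)).
rewrite mxE; apply/eqP; rewrite subr_eq0; apply/eqP.
have m0 : m.+1%:R != 0 :> R by rewrite pnatr_eq0.
by move: (m.+1%:R) m0 => M M0; field.
Qed.

Lemma levi_civita_jet_form i a x : W x -> dom i x ->
  jet_form G i a x = thomas_form (thomas G) i a x.
Proof.
move=> Wx ix; apply: (jet_form_thomas Asm _ m1 (@oW i) _ levi_civita_special) => //.
exact: gG.1.
Qed.

Lemma grad_scale i x : W x -> dom i x ->
  grad i (scale g i) x = - (scale g i x *: theta G i x).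
Proof.
move=> Wx ix; apply/matrixP => a u.
have tE : theta G i x a u = theta G i x a 0 by rewrite ord1.
rewrite mxE (ispd_pd Asm ix (scale_deriv (a := a) Wx ix)).
rewrite [RHS](_ : _ = - (scale g i x * theta G i x a u)); last first.
  by rewrite mxE [X in - X]mxE.
by rewrite tE; ring.
Qed.

Definition scale_jet i x : 'cV[R]_(1 + m) :=
  col_mx (scale g i x)%:M (grad i (scale g i) x).

(** The density [scale] is parallel for the Levi-Civita connection, so its jet has no one-form
    component in the splitting. *)
Lemma splitting_scale_jet i x : W x -> dom i x ->
  splitting G i x *m scale_jet i x = col_mx (scale g i x)%:M 0.
Proof.
move=> Wx ix; rewrite /splitting /scale_jet mul_block_col grad_scale//.
rewrite !mul1mx mul0mx addr0 mul_mx_scalar addrN //.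
Qed.

Lemma scale_jet_smooth i : smooth_mx i W (scale_jet i).
Proof.
apply: smooth_mx_col => //; first exact: scale_smooth.
by apply: grad_smooth => //; exact: scale_smooth.
Qed.

Lemma scale_jet_trans i j x : overlap W i j x ->
  scale_jet i x = jet_trans i j x *m scale_jet j x.
Proof.
move=> ov; have [Wx ix jx] := ov.
rewrite /scale_jet /jet_trans mul_block_col mul0mx addr0.
congr col_mx; first by rewrite -scalar_mxM (scale_trans ov).
have oWj : copen i (W `&` dom j) by apply: copenI => //; exact: (sa_dom Asm).
apply/matrixP => a u; rewrite addmx_entry mul_mx_scalar -scalemxAl.
rewrite -(grad_chain Asm (@oW i) (@oW j) Wx ix jx (scale_smooth j)).
suff H : pd i a (scale g i) x = scale g j x * pd i a (dens_trans i j) x +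
    dens_trans i j x * pd i a (scale g j) x.
  rewrite [LHS]mxE H; congr (_ + _); rewrite [RHS]mxE; congr (_ * _);
    by rewrite [RHS]mxE.
apply: (ispd_pd Asm ix).
apply: (ispd_local Asm oWj (conj Wx jx) ix (f := fun y => dens_trans i j y * scale g j y)).
  by move=> y [Wy jy] iy; rewrite (@scale_trans i j).
have dd := ispdP Asm (a := a) (sa_dom Asm (i := i) (j := j)) jx ix (dens_trans_smooth Asm i j).
have sd := chain_rule Asm (a := a) (@oW i) (@oW j) Wx ix jx (scale_smooth j).
rewrite (ispd_pd Asm ix sd).
by have := ispdM Asm ix dd sd; rewrite mulrC.
Qed.

Lemma theta_smooth i : smooth_mx i W (theta G i).
Proof.
have [[Gs _ _] _] := gG.
move=> b u; apply: (@smooth_in_ext _ _ _ _ Asm i W (fun y => m.+1%:R^-1 * \sum_c G i y c b c)) => //.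
  by move=> y _ _; rewrite mxE.
apply: smooth_inM => //; first exact: smooth_in_cst.
by apply: smooth_in_sum => // c _; exact: Gs.
Qed.

Lemma splitting_unit i x : splitting G i x \in unitmx.
Proof. by rewrite unitmxE det_lblock !det1 mulr1 unitr1. Qed.

Lemma splitting_deriv i a x : W x -> dom i x ->
  mxpd i a (splitting G i) x (pdmx i a (splitting G i) x).
Proof.
move=> Wx ix; have td := mxpdP Asm (a := a) (@oW i) Wx ix (@theta_smooth i).
have H : mxpd i a (splitting G i) x (block_mx 0 0 (pdmx i a (theta G i) x) 0).
  by apply: mxpd_block; try exact: mxpd_cst.
by rewrite (mxpd_pdmx Asm ix H).
Qed.

Lemma split_form_flat i a x : W x -> dom i x ->
  split_form G i a x = block_mx (theta G i x a 0)%:M (- delta_mx 0 a) 0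
    ((theta G i x a 0)%:M - gammx i x a).
Proof.
move=> Wx ix; rewrite /split_form; congr block_mx.
  by apply/matrixP => b u; rewrite mxE [RHS]mxE /schouten Gflat// scaler0 mxE.
apply/matrixP => b c; rewrite [LHS]mxE addmx_entry; congr (_ + _).
  by rewrite [RHS]mxE mulr_natl.
by rewrite [RHS]mxE; congr (- _); rewrite [RHS]mxE.
Qed.

Lemma jet_form_splitting i a x : splitting G i x *m jet_form G i a x =
  split_form G i a x *m splitting G i x + pdmx i a (splitting G i) x.
Proof. by rewrite /jet_form mulmxA mulmxV ?mul1mx// splitting_unit. Qed.

(** In the splitting the section is (sigma, 0). Ricci flatness kills the Schouten term, the only one
    that could create a one-form component, and the remaining term is the derivative of sigma. *)
Lemma scale_jet_deriv i a x : W x -> dom i x ->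
  mxpd i a (scale_jet i) x (- (jet_form G i a x *m scale_jet i x)).
Proof.
move=> Wx ix; have Ld := mxpdP Asm (a := a) (@oW i) Wx ix (@scale_jet_smooth i).
set L' := pdmx _ _ _ _ in Ld.
suff -> : - (jet_form G i a x *m scale_jet i x) = L' by [].
set v' : 'cV[R]_(1 + m) := col_mx (- theta G i x a 0 * scale g i x)%:M 0.
have SL : mxpd i a (fun y => splitting G i y *m scale_jet i y) x v'.
  apply: (mxpd_local Asm (@oW i) Wx ix (F := fun y => col_mx (scale g i y)%:M 0)).
    by move=> y Wy iy; rewrite splitting_scale_jet.
  move=> u w; rewrite /v'; case: (fintype.split_ordP u) => u' ->.
    under [X in ispd _ _ X]eq_fun do rewrite col_mxEu !ord1 mxE eqxx mulr1n.
    by rewrite col_mxEu !ord1 mxE eqxx mulr1n; exact: scale_deriv.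
  under [X in ispd _ _ X]eq_fun do rewrite col_mxEd mxE.
  by rewrite col_mxEd mxE; exact: ispd_cst.
have E := mxpdM Asm ix (splitting_deriv (a := a) Wx ix) Ld.
have {E}E : v' = pdmx i a (splitting G i) x *m scale_jet i x + splitting G i x *m L'.
  by rewrite -(mxpd_pdmx Asm ix SL) (mxpd_pdmx Asm ix E).
apply: (can_inj (mulKmx (splitting_unit i x))).
rewrite mulmxN mulmxA jet_form_splitting mulmxDl -mulmxA splitting_scale_jet//.
have -> : splitting G i x *m L' = v' - pdmx i a (splitting G i) x *m scale_jet i x.
  by rewrite E addrC addKr.
rewrite opprD; congr (_ + _).
rewrite split_form_flat// mul_block_col mulmx0 mul0mx mulmx0 !addr0.
by rewrite -scalar_mxM /v' opp_col_mx oppr0 mulNr raddfN.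
Qed.

(* The inverse metric with values in E(-2), which is parallel for G. *)
Definition inv_metric i x : 'M[R]_m := (scale g i x) ^- 2 *: invmx (g i x).

Lemma inv_metric_deriv i a x : W x -> dom i x ->
  mxpd i a (inv_metric i) x
    (((theta G i x a 0)%:M - gammx i x a)^T *m inv_metric i x +
      inv_metric i x *m ((theta G i x a 0)%:M - gammx i x a)).
Proof.
move=> Wx ix.
have s0 : scale g i x != 0 by rewrite gt_eqF// scale_gt0.
have ss0 : scale g i x * scale g i x != 0 by rewrite mulf_neq0.
have sd := scale_deriv (a := a) Wx ix.
have s2 : ispd i a (fun y => (scale g i y) ^- 2) x
    (2 * theta G i x a 0 * (scale g i x) ^- 2).
  have -> : (fun y => (scale g i y) ^- 2) = (fun y => (scale g i y * scale g i y)^-1).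
    by apply/funext => y; rewrite expr2.
  have := ispdV Asm ix ss0 (ispdM Asm ix sd sd).
  have -> // : forall t s : R, s != 0 ->
      - (- t * s * s + s * (- t * s)) / (s * s * (s * s)) = 2 * t * s ^- 2.
  by move=> t s s1; field.
have gd := mxpd_inv Asm (@oW i) Wx ix (@metric_unit i) (@gs i) (metric_deriv (a := a) Wx ix).
have gu := metric_unit Wx ix.
have := mxpdZ Asm ix s2 gd; congr mxpd.
rewrite /inv_metric; set t := theta G i x a 0; set s := _ ^- 2; set B := invmx _.
have -> : B *m (gammx i x a *m g i x + g i x *m (gammx i x a)^T) *m B =
    B *m gammx i x a + (gammx i x a)^T *m B.
  by rewrite mulmxDr mulmxDl /B !mulmxA mulmxK// mulVmx// mul1mx.
rewrite linearB /= tr_scalar_mx mulmxBl mulmxBr mul_scalar_mx mul_mx_scalar.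
rewrite -!scalemxAl -!scalemxAr; move: (B *m _) (_ *m B) => X Y.
by apply/matrixP => b c; rewrite !mxE; ring.
Qed.

Definition split_metric i x : 'M[R]_(1 + m) := block_mx 0 0 0 (inv_metric i x).

Lemma metric_cotractor_formE i x : metric_cotractor_form g G i x =
  (splitting G i x)^T *m split_metric i x *m splitting G i x.
Proof. by []. Qed.

Lemma inv_metric_smooth i : smooth_mx i W (inv_metric i).
Proof.
have s2 : smooth_in i W (fun y => (scale g i y) ^- 2).
  apply: smooth_inV => //.
    by move=> y Wy iy; rewrite expf_neq0// gt_eqF// scale_gt0.
  have -> : (fun y => (scale g i y) ^+ 2) = (fun y => scale g i y * scale g i y).
    by apply/funext => y; rewrite expr2.
  by apply: smooth_inM => //; exact: scale_smooth.
have gi := smooth_mx_inv Asm (@oW i) (@metric_unit i) (@gs i).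
move=> b c; apply: (@smooth_in_ext _ _ _ _ Asm i W
  (fun y => (scale g i y) ^- 2 * invmx (g i y) b c)) => //.
  by move=> y _ _; rewrite scalemx_entry.
by apply: smooth_inM => //; exact: gi.
Qed.

Lemma splitting_smooth i : smooth_mx i W (splitting G i).
Proof.
by apply: smooth_mx_block => //; try exact: smooth_mx_cst; exact: theta_smooth.
Qed.

Lemma metric_form_smooth i : smooth_mx i W (metric_cotractor_form g G i).
Proof.
apply: smooth_mxM => //; last exact: splitting_smooth.
apply: smooth_mxM => //; first by apply: smooth_mx_tr => //; exact: splitting_smooth.
by apply: smooth_mx_block => //; try exact: smooth_mx_cst; exact: inv_metric_smooth.
Qed.

Lemma inv_metric_sym i x : W x -> dom i x -> (inv_metric i x)^T = inv_metric i x.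
Proof. by move=> Wx ix; rewrite /inv_metric linearZ /= trmx_inv metric_sym. Qed.

Lemma metric_form_sym i x : W x -> dom i x ->
  (metric_cotractor_form g G i x)^T = metric_cotractor_form g G i x.
Proof.
move=> Wx ix; rewrite metric_cotractor_formE !trmx_mul trmxK mulmxA.
congr (_ *m _ *m _); rewrite /split_metric tr_block_mx (inv_metric_sym Wx ix).
by rewrite !trmx0.
Qed.

(** The product rule for S^T N S with S the splitting: N is parallel in the split frame by Ricci
    flatness, and the derivative of S is precisely the gauge term of [jet_form]. *)
Lemma metric_form_deriv i a x : W x -> dom i x ->
  mxpd i a (metric_cotractor_form g G i) x
    ((jet_form G i a x)^T *m metric_cotractor_form g G i x +
      metric_cotractor_form g G i x *m jet_form G i a x).
Proof.
move=> Wx ix; have Sd := splitting_deriv (a := a) Wx ix.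
have Bd := inv_metric_deriv (a := a) Wx ix.
have c0 r s : mxpd i a (fun _ => 0 : 'M[R]_(r, s)) x 0 by exact: mxpd_cst.
have Nd : mxpd i a (split_metric i) x
    ((split_form G i a x)^T *m split_metric i x +
     split_metric i x *m split_form G i a x).
  have := mxpd_block (c0 1%N 1%N) (c0 1%N m) (c0 m 1%N) Bd; congr mxpd.
  rewrite split_form_flat// /split_metric tr_block_mx !mulmx_block.
  by rewrite !(trmx0, mulmx0, mul0mx, addr0, add0r) add_block_mx !(addr0, add0r).
have := mxpdM Asm ix (mxpdM Asm ix (mxpd_tr Sd) Nd) Sd; congr mxpd.
rewrite metric_cotractor_formE.
have E := jet_form_splitting i a x.
rewrite -!mulmxA E !mulmxDr.
have E' : (jet_form G i a x)^T *m (splitting G i x)^T =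
    (splitting G i x)^T *m (split_form G i a x)^T + (pdmx i a (splitting G i) x)^T.
  by rewrite -!trmx_mul E linearD.
rewrite [in RHS]mulmxA E' !mulmxDl !mulmxA -!addrA.
by rewrite addrCA.
Qed.

Lemma metric_form_scale_jet i x : W x -> dom i x ->
  metric_cotractor_form g G i x *m scale_jet i x = 0.
Proof.
move=> Wx ix; rewrite metric_cotractor_formE -!mulmxA splitting_scale_jet//.
by rewrite /split_metric mul_block_col !(mul0mx, mulmx0, addr0) col_mx0 mulmx0.
Qed.

Lemma metric_form_kernel i x (V : 'cV[R]_(1 + m)) : W x -> dom i x ->
  metric_cotractor_form g G i x *m V = 0 -> exists c : R, V = c *: scale_jet i x.
Proof.
move=> Wx ix; rewrite metric_cotractor_formE -!mulmxA => HV.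
have St : (splitting G i x)^T \in unitmx by rewrite unitmx_tr splitting_unit.
have {HV} : split_metric i x *m (splitting G i x *m V) = 0.
  by apply: (can_inj (mulKmx St)); rewrite HV mulmx0.
rewrite -[splitting G i x *m V]vsubmxK; set U := usubmx _; set D := dsubmx _.
rewrite /split_metric mul_block_col !mul0mx !add0r -col_mx0 => /eq_col_mx[_ BD].
have s0 : scale g i x != 0 by rewrite gt_eqF// scale_gt0.
have D0 : D = 0.
  have Bu : inv_metric i x \in unitmx.
    rewrite /inv_metric unitmxZ ?unitmx_inv ?metric_unit// unitfE invr_eq0.
    by rewrite expf_neq0.
  by apply: (can_inj (mulKmx Bu)); rewrite BD mulmx0.
exists (U 0 0 / scale g i x).
apply: (can_inj (mulKmx (splitting_unit i x))).
rewrite -scalemxAr splitting_scale_jet// -[LHS]vsubmxK -/U -/D D0.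
rewrite scale_col_mx scaler0; congr col_mx.
by rewrite [LHS]mx11_scalar scale_scalar_mx mulfVK.
Qed.

Lemma splitting_trans i j x : overlap W i j x ->
  splitting G i x *m jet_trans i j x =
  block_mx (dens_trans i j x)%:M 0 0 (dens_trans i j x *: jac i j x) *m
    splitting G j x.
Proof.
move=> ov; have [Wx ix jx] := ov; have ji : overlap W j j x by split.
have s0 : scale g j x != 0 by rewrite gt_eqF// scale_gt0.
rewrite /splitting /jet_trans !mulmx_block.
rewrite !mul1mx !mul0mx !mulmx0 !mulmx1 !addr0 !add0r; congr block_mx.
(* The transformation law of [theta] is read off from the jet of [scale], because d scale = - scale
   theta. *)
have := scale_jet_trans ov.
rewrite /scale_jet /jet_trans mul_block_col mul0mx addr0 => /eq_col_mx[_].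
rewrite !grad_scale// (scale_trans ov) !mul_mx_scalar mulmxN -scalemxAr.
move: (theta G i x) (grad i (dens_trans i j) x) (_ *: jac i j x *m theta G j x).
move=> X Y Z E; apply: (scalerI s0); rewrite scalerDr.
by rewrite scalerA mulrC -[_ *: X]opprK E opprD opprK addrC addrA addrN add0r.
Qed.

Lemma metric_form_trans i j x : overlap W i j x ->
  metric_cotractor_form g G j x =
  (jet_trans i j x)^T *m metric_cotractor_form g G i x *m jet_trans i j x.
Proof.
move=> ov; have [Wx ix jx] := ov; have [_ _ gt] := gm.
have d0 : dens_trans i j x != 0 by rewrite gt_eqF// (dens_trans_gt0 Asm).
have s0 : scale g j x != 0 by rewrite gt_eqF// scale_gt0.
have Ju := jac_unit Asm ix jx.
rewrite !metric_cotractor_formE.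
rewrite -mulmxA -mulmxA -mulmxA (splitting_trans ov) !mulmxA -trmx_mul.
rewrite (splitting_trans ov) trmx_mul -!mulmxA; congr (_ *m _); rewrite !mulmxA.
congr (_ *m _); rewrite /split_metric tr_block_mx !mulmx_block.
rewrite !(trmx0, mulmx0, mul0mx, addr0, add0r); congr block_mx.
rewrite /inv_metric (scale_trans ov) (gt i j x ov).
have -> : (dens_trans i j x *: jac i j x)^T = dens_trans i j x *: (jac i j x)^T.
  exact: linearZ.
rewrite !(=^~ scalemxAl, =^~ scalemxAr) !scalerA.
have gu := metric_unit Wx jx.
have -> : (jac i j x)^T *m invmx (jac i j x *m g j x *m (jac i j x)^T) *m jac i j x =
    invmx (g j x).
  have JT : (jac i j x)^T \in unitmx by rewrite unitmx_tr.
  rewrite -[LHS](mulmxK gu) -[RHS]mul1mx; congr (_ *m _).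
  rewrite -[LHS](mulmxK JT) -[RHS](mulmxK JT); congr (_ *m _).
  rewrite mul1mx -!mulmxA [jac i j x *m (_ *m _)]mulmxA mulVmx ?mulmx1//.
  by rewrite !unitmx_mul Ju gu.
congr (_ *: _); field; by rewrite d0 s0.
Qed.

End RicciFlat.

Section ConnectionSmooth.
Context {R : realType} {m : nat} {T : Type} (A : atlas R m T).
Hypothesis Asm : smooth_atlas A.
Implicit Types (i : idx A) (a b c : 'I_m) (x : T) (W : set T) (G P : conn A).

Definition smooth_conn i W G := forall c a b, smooth_in i W (fun x => G i x c a b).

Lemma ricci_smooth i W G a b : copen i W -> smooth_conn i W G ->
  smooth_in i W (fun x => ricci G i x a b).
Proof.
move=> oW Gs.
apply: (@smooth_in_ext _ _ _ _ Asm i W (fun x => \sum_c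
    (pd i c (fun q => G i q c a b) x - pd i a (fun q => G i q c c b) x
     + \sum_e (G i x c c e * G i x e a b - G i x c a e * G i x e c b)))) => //.
  by move=> x _ _; rewrite mxE.
apply: smooth_in_sum => // c _; apply: smooth_inD => //.
  by apply: smooth_inB => //; apply: smooth_in_pd => //; exact: Gs.
by apply: smooth_in_sum => // e _; apply: smooth_inB => //; apply: smooth_inM => //; exact: Gs.
Qed.

Lemma theta_smooth_in i W G a u : copen i W -> smooth_conn i W G ->
  smooth_in i W (fun x => theta G i x a u).
Proof.
move=> oW Gs.
apply: (@smooth_in_ext _ _ _ _ Asm _ _ (fun y => m.+1%:R^-1 * \sum_c G i y c a c)) => //.
  by move=> y _ _; rewrite mxE.
apply: smooth_inM => //; first exact: smooth_in_cst.
by apply: smooth_in_sum.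
Qed.

Lemma thomas_smooth i W G : copen i W -> smooth_conn i W G ->
  smooth_conn i W (thomas G).
Proof.
move=> oW Gs c a b.
apply: (@smooth_in_ext _ _ _ _ Asm i W (fun x => G i x c a b -
    theta G i x a 0 * (b == c)%:R - theta G i x b 0 * (a == c)%:R)) => //.
  by move=> x _ _; rewrite thomasE.
apply: smooth_inB => //; first apply: smooth_inB => //.
  by apply: smooth_inM => //; [exact: theta_smooth_in|exact: smooth_in_cst].
by apply: smooth_inM => //; [exact: theta_smooth_in|exact: smooth_in_cst].
Qed.

Lemma thomas_form_smooth i W P a : copen i W -> smooth_conn i W P ->
  smooth_mx i W (thomas_form P i a).
Proof.
move=> oW Ps; apply: smooth_mx_block => //; try exact: smooth_mx_cst.
  move=> b u; apply: (@smooth_in_ext _ _ _ _ Asm i W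
    (fun x => m.-1%:R^-1 * ricci P i x a b)) => //.
    by move=> x _ _; rewrite [RHS]mxE.
  by apply: smooth_inM => //; [exact: smooth_in_cst|exact: ricci_smooth].
move=> b c; apply: (@smooth_in_ext _ _ _ _ Asm i W (fun x => - P i x c a b)) => //.
  by move=> x _ _; rewrite mxE.
exact: smooth_inN.
Qed.

Lemma ricci_local i W P P' x a b : copen i W -> W x -> dom i x ->
  (forall y c a b, W y -> dom i y -> P i y c a b = P' i y c a b) ->
  ricci P i x a b = ricci P' i x a b.
Proof.
move=> oW Wx ix PP; rewrite !mxE; apply: eq_bigr => c _; congr (_ - _ + _).
- by apply: (pd_local Asm _ oW Wx ix) => y Wy iy; exact: PP.
- by apply: (pd_local Asm _ oW Wx ix) => y Wy iy; exact: PP.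
by apply: eq_bigr => e _; rewrite !PP.
Qed.

Lemma thomas_form_local i W P P' x a : copen i W -> W x -> dom i x ->
  (forall y c a b, W y -> dom i y -> P i y c a b = P' i y c a b) ->
  thomas_form P i a x = thomas_form P' i a x.
Proof.
move=> oW Wx ix PP; congr block_mx; apply/matrixP => b c; rewrite !mxE.
  by congr (_ * _); have := ricci_local a b oW Wx ix PP; rewrite !mxE => ->.
by rewrite PP.
Qed.

Lemma thomas_pointwise (C C' : conn A) i x c a b :
  (forall c a b, C i x c a b = C' i x c a b) ->
  thomas C i x c a b = thomas C' i x c a b.
Proof.
move=> CC; have tt d : theta C i x d 0 = theta C' i x d 0.
  by rewrite !mxE; congr (_ * _); apply: eq_bigr.
by rewrite !thomasE CC !tt.
Qed.


End ConnectionSmooth.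

(** * Projective compactness *)

Section Compactification.
Context {R : realType} {n : nat} {T : topologicalType} (A : atlas R n.+1 T).
Variables (g : tensor2 A) (nabla : conn A).
Hypothesis n_gt1 : (1 < n)%N.
Hypothesis Amfd : manifold_with_boundary A.
Hypothesis gG : levi_civita (minterior A) g nabla.
Hypothesis Gflat : forall i x, minterior A x -> dom i x -> ricci nabla i x = 0.
Implicit Types (i j : idx A) (a b c : 'I_n.+1) (x y : T) (U : set T).
Let Asm := mwb_smooth_atlas Amfd.

Definition hess (C : conn A) rho i x a b : R :=
  pd i a (pd i b rho) x - \sum_c C i x c a b * pd i c rho x.

Lemma copenIm i U : copen i U -> copen i (U `&` minterior A).
Proof. by move=> oU; apply: copenI => //; exact: copen_minterior. Qed.

Section Order.
Variables (U : set T) (rho : T -> R) (C : conn A) (alpha : R).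
Hypothesis oU : open U.
Hypothesis rhod : defining_function A U rho.
Hypothesis Cc : is_conn U C.
Hypothesis alpha0 : 0 < alpha.
Hypothesis CE : conn_eq (U `&` minterior A) C
  (proj_change nabla (fun i q => (alpha * rho q)^-1 *: grad i rho q)).

Let rhos i : smooth_in i U rho. Proof. by case: rhod. Qed.
Let oUi i : copen i U. Proof. exact: copen_open. Qed.
Let Cs i : smooth_conn i U C. Proof. by have [] := Cc => + _ _ c a b; exact. Qed.

Lemma rho_gt0 x : U x -> minterior A x -> 0 < rho x.
Proof.
move=> Ux mx; have [_ r0 rb _] := rhod.
rewrite lt_def r0// andbT; apply/eqP => /(rb x Ux); exact: mx.
Qed.

Let nablas i : smooth_conn i (minterior A) nabla.
Proof. by have [[+ _ _] _] := gG => + c a b; exact. Qed.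

Lemma ricci_hess_interior i x a b : U x -> minterior A x -> dom i x ->
  alpha ^+ 2 * rho x ^+ 2 * ricci C i x a b =
  - n%:R * (alpha * rho x * hess C rho i x a b +
            (1 - alpha) * (pd i a rho x * pd i b rho x)).
Proof.
move=> Ux mx ix; have r0 := rho_gt0 Ux mx.
pose w : oneform A := fun i q => (alpha * rho q)^-1 *: grad i rho q.
have oUm := copenIm (@oUi i); have Um : (U `&` minterior A) x by [].
have rn : alpha * rho x != 0 by rewrite mulf_neq0// gt_eqF.
have wE y a' : w i y a' 0 = (alpha * rho y)^-1 * pd i a' rho y.
  by rewrite /w !mxE.
rewrite (@ricci_local _ _ _ _ Asm i _ C (proj_change nabla w) x a b oUm Um ix); last first.
  by move=> y c a' b' Uy iy; exact: CE.
pose dG d c a' b' := pd i d (fun q => nabla i q c a' b') x.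
(* The derivative of d rho / (alpha rho). Its symmetry reflects that this form is d (log rho) /
   alpha. *)
pose dw d a' := (alpha * rho x)^-1 * pd i d (pd i a' rho) x -
  (alpha * rho x ^+ 2)^-1 * (pd i d rho x * pd i a' rho x).
have GdG d c a' b' : ispd i d (fun q => nabla i q c a' b') x (dG d c a' b').
  apply: (ispdP Asm (@copen_minterior _ _ _ _ Amfd i) mx ix); exact: nablas.
have wdw d a' : ispd i d (fun q => w i q a' 0) x (dw d a').
  have -> : (fun q => w i q a' 0) = (fun q => (alpha * rho q)^-1 * pd i a' rho q).
    by apply/funext => y.
  have dr := ispdP Asm (a := d) (@oUi i) Ux ix (@rhos i).
  have ddr := ispdP Asm (a := d) (@oUi i) Ux ix (smooth_in_pd Asm a' (@oUi i) (@rhos i)).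
  have ar := ispdM Asm ix (@ispd_cst _ _ _ _ i d x alpha) dr.
  have := ispdM Asm ix (ispdV Asm ix rn ar) ddr; congr ispd.
  rewrite /dw; field; by rewrite !gt_eqF.
have nsym c a' b' : nabla i x c a' b' = nabla i x c b' a'.
  by have [[_ + _] _] := gG; apply.
have dws a' b' : dw a' b' = dw b' a'.
  by rewrite /dw (schwarz_pd Asm a' b' (@oUi i) Ux ix (@rhos i)); congr (_ - _ * _); rewrite mulrC.
rewrite (ricci_change Asm ix GdG wdw nsym dws) Gflat// mxE.
have -> : n.+1%:R - 1 = n%:R :> R by rewrite -natr1 addrK.
(* The singular [nabla] is traded for C = nabla + w, which changes the quadratic term in [w]. This
   is where the coefficient 1 - alpha originates. *)
have -> : \sum_c nabla i x c a b * w i x c 0 =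
    \sum_c C i x c a b * w i x c 0 - 2 * (w i x a 0 * w i x b 0).
  have E c : nabla i x c a b * w i x c 0 = C i x c a b * w i x c 0 -
      w i x a 0 * w i x c 0 * (b == c)%:R - w i x b 0 * w i x c 0 * (a == c)%:R.
    have -> : C i x c a b = nabla i x c a b + w i x a 0 * (b == c)%:R +
      w i x b 0 * (a == c)%:R by exact: CE.
    by ring.
  by under eq_bigr do rewrite E; rewrite !sumrB !sum_delta; ring.
have -> : \sum_c C i x c a b * w i x c 0 =
    (alpha * rho x)^-1 * \sum_c C i x c a b * pd i c rho x.
  by rewrite mulr_sumr; apply: eq_bigr => c _; rewrite wE; ring.
rewrite !wE /dw /hess; field; by rewrite !gt_eqF.
Qed.

Lemma hess_smooth i a b : smooth_in i U (fun x => hess C rho i x a b).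
Proof.
apply: smooth_inB => //; first by do 2?[apply: smooth_in_pd => //].
apply: smooth_in_sum => // c _; apply: smooth_inM => //; first exact: Cs.
exact: smooth_in_pd.
Qed.

(* The behaviour of the Ricci tensor under projective changes, multiplied by
   rho^2, is an identity that extends to the boundary, where only the term
   (1 - alpha) d rho d rho survives. *)
Lemma ricci_hess i x a b : U x -> dom i x ->
  alpha ^+ 2 * rho x ^+ 2 * ricci C i x a b =
  - n%:R * (alpha * rho x * hess C rho i x a b +
            (1 - alpha) * (pd i a rho x * pd i b rho x)).
Proof.
move=> Ux ix.
have pds d : smooth_in i U (pd i d rho) by exact: smooth_in_pd.
have cs (k : R) : smooth_in i U (fun _ => k) by exact: smooth_in_cst.
apply: (@interior_eq_smooth _ _ _ _ Amfd i U (fun x => alpha ^+ 2 * rho x ^+ 2 * ricci C i x a b)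
  (fun x => - n%:R * (alpha * rho x * hess C rho i x a b +
            (1 - alpha) * (pd i a rho x * pd i b rho x)))) => //.
- apply: smooth_inM => //; last by apply: ricci_smooth.
  apply: (smooth_inM Asm (@oUi i) (cs _)).
  apply: (@smooth_in_ext _ _ _ _ Asm i U (fun x => rho x * rho x)) => //.
  exact: smooth_inM.
- apply: (smooth_inM Asm (@oUi i) (cs _)).
  apply: smooth_inD => //; last first.
    by apply: (smooth_inM Asm (@oUi i) (cs _)); exact: smooth_inM.
  apply: smooth_inM => //; last exact: hess_smooth.
  exact: (smooth_inM Asm (@oUi i) (cs _)).
by move=> y Uy my iy; exact: ricci_hess_interior.
Qed.

Lemma order_eq1 x : U x -> bdry A x -> alpha = 1.
Proof.
move=> Ux bx; have [_ _ rb gr] := rhod.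
have [i ix _] := bx; have /matrix0Pn[a [u]] := gr i x Ux bx ix.
rewrite mxE => a0; have r0 : rho x = 0 by apply/(rb x Ux).
have := ricci_hess a a Ux ix; rewrite r0 expr0n /= !(mulr0, mul0r) add0r => /esym/eqP.
rewrite !mulf_eq0 oppr_eq0 pnatr_eq0 (negbTE a0) !orbF subr_eq0 => /orP[/eqP n0|/eqP <-//].
by move: n_gt1; rewrite n0.
Qed.

Lemma tangential_rho i x (a : 'I_n) : U x -> bdry A x -> dom i x ->
  pd i (lift ord0 a) rho x = 0.
Proof.
move=> Ux bx ix; have [_ _ rb _] := rhod.
apply: (tangential_pd Amfd (@oUi i) Ux bx ix _
  (ispdP Asm (@oUi i) Ux ix (@rhos i))) => y Uy by_ iy; exact/(rb y Uy).
Qed.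

Lemma normal_rho i x : U x -> bdry A x -> dom i x -> 0 < pd i ord0 rho x.
Proof.
move=> Ux bx ix; have [_ r0 rb gr] := rhod.
rewrite lt_def; apply/andP; split.
  have /matrix0Pn[a [u]] := gr i x Ux bx ix; rewrite mxE.
  by case: (unliftP ord0 a) => [a' ->|->//]; rewrite tangential_rho// eqxx.
apply: (normal_pd_ge0 Amfd (@oUi i) Ux bx ix _ _ (ispdP Asm (@oUi i) Ux ix (@rhos i))).
  exact/(rb x Ux).
by move=> y Uy iy; exact: r0.
Qed.

(** Along the boundary the Hessian of rho vanishes, and so do the first and second tangential
    derivatives of rho. What is left is the product of this Christoffel symbol with the positive
    normal derivative of rho. *)
Lemma conn_tangential i x (a b : 'I_n) : alpha = 1 -> U x -> bdry A x -> dom i x ->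
  C i x ord0 (lift ord0 a) (lift ord0 b) = 0.
Proof.
move=> a1 Ux bx ix; have [_ _ rb _] := rhod.
have H0 : hess C rho i x (lift ord0 a) (lift ord0 b) = 0.
  suff H : - n%:R * hess C rho i x (lift ord0 a) (lift ord0 b) =
      rho x * ricci C i x (lift ord0 a) (lift ord0 b).
    move/eqP: H; have -> : rho x = 0 by apply/(rb x Ux).
    by rewrite mul0r mulf_eq0 oppr_eq0 pnatr_eq0 (gtn_eqF (ltnW n_gt1)) => /eqP.
  apply: (@interior_eq_smooth _ _ _ _ Amfd i U
    (fun y => - n%:R * hess C rho i y (lift ord0 a) (lift ord0 b))
    (fun y => rho y * ricci C i y (lift ord0 a) (lift ord0 b))) => //.
  - by apply: smooth_inM => //; [exact: smooth_in_cst|exact: hess_smooth].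
  - by apply: smooth_inM => //; apply: ricci_smooth.
  move=> y Uy my iy; have r0 := rho_gt0 Uy my.
  have := ricci_hess (lift ord0 a) (lift ord0 b) Uy iy; rewrite a1 => E.
  have rn : rho y != 0 by rewrite gt_eqF.
  apply: (mulfI rn); rewrite -[RHS]mul1r.
  have -> : 1 * (rho y * (rho y * ricci C i y (lift ord0 a) (lift ord0 b))) =
    1 ^+ 2 * rho y ^+ 2 * ricci C i y (lift ord0 a) (lift ord0 b) by ring.
  by rewrite E; ring.
have P0 : pd i (lift ord0 a) (pd i (lift ord0 b) rho) x = 0.
  have := ispdP Asm (a := lift ord0 a) (@oUi i) Ux ix
    (smooth_in_pd Asm (lift ord0 b) (@oUi i) (@rhos i)).
  apply: (tangential_pd Amfd (@oUi i) Ux bx ix) => y Uy by_ iy.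
  exact: tangential_rho.
move/eqP: H0; rewrite /hess P0 sub0r oppr_eq0 (bigD1 ord0)//= big1 ?addr0.
  by rewrite mulf_eq0 [X in _ || X]gt_eqF ?orbF ?normal_rho// => /eqP.
move=> c; case: (unliftP ord0 c) => [c' ->|->//] _.
by rewrite tangential_rho// mulr0.
Qed.

End Order.

End Compactification.

(** * Extension of matrix valued solutions in a chart *)

Section MatrixExtension.
Context {R : realType} {n : nat} {T : topologicalType} (A : atlas R n.+1 T).
Hypothesis Amfd : manifold_with_boundary A.
Implicit Types (i j : idx A) (a b c : 'I_n.+1) (x y : T) (W : set T) (f : T -> R).
Let Asm := mwb_smooth_atlas Amfd.

Definition mext i f x : R := bext (f \o prm i) (crd i x).

Lemma mext_interior i f x : dom i x -> minterior A x -> mext i f x = f x.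
Proof.
move=> ix mx; rewrite /mext bext_gt0 ?(sa_crdK Asm)//=; last exact/(minterior_crd Amfd ix).
by rewrite (sa_crdK Asm).
Qed.

Lemma cimg_interior i W z : hint (cimg i W) z ->
  [/\ W (prm i z), minterior A (prm i z), dom i (prm i z) & crd i (prm i z) = z].
Proof.
rewrite -(cimg_minterior Amfd) => /(cimgP Asm)[iz [Wz mz]].
by have [] := img_prm Asm iz.
Qed.

Lemma mext_eq i W f g x : copen i W -> W x -> dom i x ->
  wcont (cimg i W) (g \o prm i) (crd i x) ->
  (forall y, W y -> minterior A y -> dom i y -> f y = g y) -> mext i f x = g x.
Proof.
move=> oW Wx ix gx fg.
rewrite /mext (bext_eq (hopen_cimg Amfd oW) (cimg_crd Wx ix) gx) ?/=.
  by rewrite (sa_crdK Asm).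
by move=> z /cimg_interior[Wz mz iz _]; exact: fg.
Qed.

Section System.
Variables (i : idx A) (W : set T) (I : finType) (F : I -> T -> R).
Variable (K : 'I_n.+1 -> I -> I -> T -> R).
Hypothesis oW : copen i W.
Hypothesis Ks : forall a u v, smooth_in i W (K a u v).
Hypothesis Fs : forall u, smooth_in i (W `&` minterior A) (F u).
Hypothesis FK : forall a u x, W x -> minterior A x -> dom i x ->
  ispd i a (F u) x (\sum_v K a u v x * F v x).

Let hD := hopen_cimg Amfd oW.

Let cF u z : hint (cimg i W) z -> wcont (hint (cimg i W)) (F u \o prm i) z.
Proof.
move=> /cimg_interior[Wz mz iz zE].
rewrite -(cimg_minterior Amfd) -zE.
exact: (@smooth_in_wcont _ _ _ _ i (W `&` minterior A) (F u) (prm i z)).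
Qed.

Let FK' a u z : hint (cimg i W) z -> is_pd (hint (cimg i W)) a (F u \o prm i) z
  (\sum_v (K a u v \o prm i) z * (F v \o prm i) z).
Proof.
move=> hz; have [Wz mz iz zE] := cimg_interior hz.
have := @FK a u _ Wz mz iz; rewrite /ispd zE; apply: is_pd_local => //.
  by rewrite -zE; exact: img_crd.
exists 1 => // y _; split=> // hy.
by have [_ _ + <-] := cimg_interior hy; exact: img_crd.
Qed.

Lemma mext_system_smooth u : smooth_in i W (mext i (F u)).
Proof.
move=> k; have := bext_smooth hD Ks cF FK' u k.
apply: Ck_ext; first exact: lorthant_cimg.
by move=> z /(cimgP Asm)[iz Wz] /=; rewrite /mext; have [_ ->] := img_prm Asm iz.
Qed.

Lemma mext_system_pd a u x : W x -> dom i x ->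
  ispd i a (mext i (F u)) x (\sum_v K a u v x * mext i (F v) x).
Proof.
move=> Wx ix.
have := @bext_is_pd _ _ _ _ _ _ hD Ks cF FK' a u _ (cimg_crd Wx ix).
rewrite (_ : \sum_v _ = \sum_v K a u v x * mext i (F v) x); last first.
  by apply: eq_bigr => v _ /=; rewrite (sa_crdK Asm).
have Wx' : W (prm i (crd i x)) by rewrite (sa_crdK Asm).
have [r r0 rW] := oW (img_crd ix) Wx'.
apply: is_pd_local; first exact: cimg_crd.
  exists r => // z rz; split=> iz; first by apply/(cimgP Asm); split=> //; exact: rW.
  by rewrite /= /mext; have [_ ->] := img_prm Asm iz.
by rewrite /= /mext (sa_crdK Asm).
Qed.

End System.

Definition mxext r s i (F : T -> 'M[R]_(r, s)) x : 'M[R]_(r, s) :=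
  \matrix_(u, v) mext i (fun y => F y u v) x.

Lemma mxext_interior r s i (F : T -> 'M[R]_(r, s)) x : dom i x -> minterior A x ->
  mxext i F x = F x.
Proof. by move=> ix mx; apply/matrixP => u v; rewrite mxE mext_interior. Qed.

Section MatrixSystem.
Variables (i : idx A) (W : set T) (r s : nat) (F : T -> 'M[R]_(r, s)).
Variables (L : 'I_n.+1 -> T -> 'M[R]_r) (M : 'I_n.+1 -> T -> 'M[R]_s).
Hypothesis oW : copen i W.
Hypothesis Ls : forall a, smooth_mx i W (L a).
Hypothesis Ms : forall a, smooth_mx i W (M a).
Hypothesis Fs : smooth_mx i (W `&` minterior A) F.
Hypothesis FLM : forall a x, W x -> minterior A x -> dom i x ->
  mxpd i a F x (L a x *m F x + F x *m M a x).

(** The matrix of F |-> L F + F M acting on pairs of indices, that is, of L (x) 1 + 1 (x) M^T. *)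
Let K a (u v : 'I_r * 'I_s) x : R :=
  L a x u.1 v.1 * (v.2 == u.2)%:R + (v.1 == u.1)%:R * M a x v.2 u.2.

Let KE a (X : 'M[R]_(r, s)) u x :
  \sum_v K a u v x * X v.1 v.2 = (L a x *m X + X *m M a x) u.1 u.2.
Proof.
rewrite -(pair_bigA _ (fun k l => K a u (k, l) x * X k l)) /= addmx_entry !mulmx_entry.
under eq_bigr do under eq_bigr do rewrite /K /= mulrDl.
under eq_bigr do rewrite big_split /=.
rewrite big_split /=; congr (_ + _).
  apply: eq_bigr => k _; rewrite (bigD1 u.2)//= eqxx mulr1 big1 ?addr0// => l lu.
  by rewrite (negbTE lu) mulr0 mul0r.
rewrite (bigD1 u.1)//= [X in _ + X]big1 ?addr0; last first.
  by move=> k ku; rewrite big1// => l _; rewrite (negbTE ku) !mul0r.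
by apply: eq_bigr => l _; rewrite eqxx mul1r mulrC.
Qed.

Let Ks a u v : smooth_in i W (K a u v).
Proof.
have cs (k : R) : smooth_in i W (fun _ => k) by exact: smooth_in_cst.
apply: smooth_inD => //.
  by apply: (fun H => smooth_inM Asm oW H (cs _)); exact: Ls.
by apply: (smooth_inM Asm oW (cs _)); exact: Ms.
Qed.

Let F' (u : 'I_r * 'I_s) x := F x u.1 u.2.

Let FK a u x : W x -> minterior A x -> dom i x ->
  ispd i a (F' u) x (\sum_v K a u v x * F' v x).
Proof. by move=> Wx mx ix; rewrite KE; exact: FLM. Qed.

Lemma mxext_smooth : smooth_mx i W (mxext i F).
Proof.
move=> u v; have := mext_system_smooth oW Ks (fun u => Fs u.1 u.2) FK (u, v).
by apply: smooth_in_ext => // y _ _; rewrite mxE.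
Qed.

Lemma mxext_pd a x : W x -> dom i x ->
  mxpd i a (mxext i F) x (L a x *m mxext i F x + mxext i F x *m M a x).
Proof.
move=> Wx ix u v.
have := @mext_system_pd i W _ F' K oW Ks (fun u => Fs u.1 u.2) FK a (u, v) x Wx ix.
rewrite (_ : \sum_v _ = (L a x *m mxext i F x + mxext i F x *m M a x) u v).
  by apply: (ispd_local Asm oW Wx ix) => y _ _; rewrite mxE.
by rewrite -(KE a _ (u, v)); apply: eq_bigr => k _; rewrite mxE.
Qed.

End MatrixSystem.

End MatrixExtension.

Section ChartContinuity.
Context {R : realType} {n : nat} {T : topologicalType} (A : atlas R n.+1 T).
Hypothesis Amfd : manifold_with_boundary A.
Implicit Types (i j : idx A) (x y : T) (W : set T).
Let Asm := mwb_smooth_atlas Amfd.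

Definition cont_mx r s i W (F : T -> 'M[R]_(r, s)) := forall u v x, W x -> dom i x ->
  wcont (cimg i W) ((fun y => F y u v) \o prm i) (crd i x).

Lemma smooth_cont_mx r s i W (F : T -> 'M[R]_(r, s)) :
  smooth_mx i W F -> cont_mx i W F.
Proof. by move=> Fs u v x Wx ix; apply: smooth_in_wcont => //; exact: Fs. Qed.

Lemma cont_mxM r s t i W (F : T -> 'M[R]_(r, s)) (G : T -> 'M[R]_(s, t)) :
  cont_mx i W F -> cont_mx i W G -> cont_mx i W (fun y => F y *m G y).
Proof.
move=> cF cG u v x Wx ix; rewrite /wcont /=.
rewrite (_ : _ \o _ = fun z => \sum_k F (prm i z) u k * G (prm i z) k v); last first.
  by apply/funext => z /=; rewrite mxE.
rewrite mxE; apply: cvg_sumr => k; apply: cvgM; [exact: cF|exact: cG].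
Qed.

Lemma cont_mx_tr r s i W (F : T -> 'M[R]_(r, s)) :
  cont_mx i W F -> cont_mx i W (fun y => (F y)^T).
Proof.
move=> cF u v x Wx ix; have := cF v u x Wx ix; apply: wcont_local => /=.
  by exists 1 => // y _ hy; rewrite mxE.
by rewrite mxE.
Qed.

Lemma interior_eq_mx r s i W (F G : T -> 'M[R]_(r, s)) : copen i W ->
  cont_mx i W F -> cont_mx i W G ->
  (forall x, W x -> minterior A x -> dom i x -> F x = G x) ->
  forall x, W x -> dom i x -> F x = G x.
Proof.
move=> oW cF cG FG x Wx ix; apply/matrixP => u v.
apply: (interior_eq Amfd (f := fun y => F y u v) (g := fun y => G y u v) oW _ _ _ Wx ix).
- by move=> y Wy iy; exact: cF.
- by move=> y Wy iy; exact: cG.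
by move=> y Wy my iy; rewrite FG.
Qed.

(** Continuity is all that comparison with the interior requires, and it passes from one chart to
    another by plain composition. *)
Lemma wcont_chart i j f x : dom i x -> dom j x -> smooth_in j setT f ->
  wcont (cimg i (dom j)) (f \o prm i) (crd i x).
Proof.
move=> ix jx fs; have := @smooth_in_wcont _ _ _ _ j setT f x I jx fs => /wcontP fc.
apply/wcontP => e e0; have [r r0 fr] := fc e e0.
have : \forall z \near within (cimg i (dom j)) (nbhs (crd i x)),
    forall b, `|crd j (prm i z) 0 b - crd j (prm i (crd i x)) 0 b| < r.
  apply: filter_forall => b.
  have := @smooth_in_wcont _ _ _ _ i (dom j) _ x jx ix (sa_smooth Asm i j b) => /wcontP/(_ r r0)[s s0 sb].
  by apply/near_within_cube; exists s => // z; exact: sb.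
move/near_within_cube => [s s0 sb]; exists s => // z sz Dz.
have [iz jz] := (cimgP Asm _ _ _).1 Dz; have := sb z sz Dz.
rewrite (sa_crdK Asm)// => zx.
have := fr (crd j (prm i z)) zx (cimg_crd I jz).
by rewrite /= !(sa_crdK Asm).
Qed.

Lemma cont_mx_chart r s i j (F : T -> 'M[R]_(r, s)) :
  smooth_mx j setT F -> cont_mx i (dom j) F.
Proof. by move=> Fs u v x jx ix; apply: wcont_chart => //; exact: Fs. Qed.

Lemma jet_trans_smooth i j : smooth_mx i (dom j) (jet_trans i j).
Proof.
have oj : copen i (dom j) by exact: sa_dom.
apply: smooth_mx_block => //.
- move=> u v; apply: (@smooth_in_ext _ _ _ _ Asm i _ (dens_trans i j)) => //.
    by move=> y _ _; rewrite !ord1 mxE eqxx mulr1n.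
  exact: dens_trans_smooth.
- exact: smooth_mx_cst.
- by apply: grad_smooth => //; exact: dens_trans_smooth.
move=> u v; apply: (@smooth_in_ext _ _ _ _ Asm i _ (fun y => dens_trans i j y * jac i j y u v)) => //.
  by move=> y _ _; rewrite scalemx_entry.
by apply: smooth_inM => //; [exact: dens_trans_smooth|exact: jac_smooth].
Qed.

Lemma smooth_mx_local r s i (F : T -> 'M[R]_(r, s)) :
  (forall x, dom i x -> exists U, [/\ copen i U, U x & smooth_mx i U F]) ->
  smooth_mx i setT F.
Proof.
move=> H u v; apply: (smooth_in_local Asm); first exact: copenT.
by move=> x _ ix; have [U [oU Ux Us]] := H x ix; exists U; split; rewrite ?setTI.
Qed.

Lemma smooth_mx_sub r s i W W' (F : T -> 'M[R]_(r, s)) :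
  copen i W -> copen i W' -> W' `<=` W -> smooth_mx i W F -> smooth_mx i W' F.
Proof. by move=> oW oW' WW Fs u v; apply: (smooth_in_sub Asm oW). Qed.

End ChartContinuity.

(** * The projective class near the boundary *)

Section ProjectiveExtension.
Context {R : realType} {n : nat} {T : topologicalType} (A : atlas R n.+1 T).
Variables (p q : nat) (g : tensor2 A) (nabla : conn A).
Hypothesis n_gt1 : (1 < n)%N.
Hypothesis Amfd : manifold_with_boundary A.
Hypothesis gm : is_metric p q (minterior A) g.
Hypothesis gG : levi_civita (minterior A) g nabla.
Hypothesis Gflat : forall i x, minterior A x -> dom i x -> ricci nabla i x = 0.
Hypothesis gC : proj_compact nabla.
Implicit Types (i j : idx A) (a b c : 'I_n.+1) (x y : T) (U : set T) (C : conn A).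
Let Asm := mwb_smooth_atlas Amfd.
Let m_gt1 : (1 < n.+1)%N := ltnW n_gt1.
Let oI i : copen i (minterior A) := copen_minterior Amfd (i := i).

(** What the tractor equations use of a representative: smoothness up to the boundary and the right
    trace-free part in the interior. Members of [ext_class] and the representatives supplied by
    projective compactness both qualify. *)
Definition thomas_ext U C := [/\ forall i, copen i U, forall i, smooth_conn i U C &
  forall i x c a b, U x -> minterior A x -> dom i x ->
    thomas C i x c a b = thomas nabla i x c a b].

Lemma thomas_ext_change U C w : open U -> is_conn U C ->
  conn_eq (U `&` minterior A) C (proj_change nabla w) -> thomas_ext U C.
Proof.
move=> oU [Cs _ _] CE; split=> [i|i c a b|i x c a b Ux mx ix].
- exact: copen_open.
- exact: Cs.
rewrite -(thomas_change nabla w); apply: thomas_pointwise => c' a' b'.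
exact: CE.
Qed.

Lemma ext_class_thomas U C : ext_class nabla U C -> thomas_ext U C.
Proof. by move=> [oU Cc [w _ CE]]; exact: thomas_ext_change CE. Qed.

(** The factor 1 keeps the literal shape of [proj_compact_order] at order one. *)
Definition log_grad rho : oneform A := fun i x => (1 * rho x)^-1 *: grad i rho x.

Lemma boundary_rep x : bdry A x -> exists U rho C,
  [/\ open U, U x, defining_function A U rho, is_conn U C &
      conn_eq (U `&` minterior A) C (proj_change nabla (log_grad rho))].
Proof.
have [alpha a0 aC] := gC => bx; have [U [rho [oU Ux rd [C Cc CE]]]] := aC x bx.
exists U, rho, C; split=> //.
by have a1 := order_eq1 n_gt1 Amfd gG Gflat oU rd Cc a0 CE Ux bx; move: CE; rewrite a1.
Qed.

Lemma compact_order1 : proj_compact_order 1 nabla.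
Proof.
move=> x /boundary_rep[U [rho [C [oU Ux rd Cc CE]]]].
by exists U, rho; split=> //; exists C.
Qed.

Lemma compact_order_unique alpha : bdry A !=set0 -> 0 < alpha ->
  proj_compact_order alpha nabla -> alpha = 1.
Proof.
move=> [x bx] a0 /(_ x bx)[U [rho [oU Ux rd [C Cc CE]]]].
exact: (order_eq1 n_gt1 Amfd gG Gflat oU rd Cc a0 CE Ux bx).
Qed.

Lemma local_rep x : exists U C, U x /\ thomas_ext U C.
Proof.
have [bx|mx] := pselect (bdry A x).
  have [U [rho [C [oU Ux rd Cc CE]]]] := boundary_rep bx.
  by exists U, C; split=> //; exact: thomas_ext_change CE.
exists (minterior A), nabla; split=> //; split=> // i c a b.
by have [[]] := gG.
Qed.

Lemma thomas_ext_unique U C U' C' i x c a b : thomas_ext U C -> thomas_ext U' C' ->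
  U x -> U' x -> dom i x -> thomas C i x c a b = thomas C' i x c a b.
Proof.
move=> [oU Cs CE] [oU' Cs' CE'] Ux Ux' ix.
have oUU := copenI (oU i) (oU' i).
apply: (@interior_eq_smooth _ _ _ _ Amfd i (U `&` U') (fun x => thomas C i x c a b)
  (fun x => thomas C' i x c a b)) => //.
- apply: (@thomas_smooth _ _ _ _ Asm) => // c' a' b'.
  by apply: (smooth_in_sub Asm (oU i) oUU) => [y []//|]; exact: Cs.
- apply: (@thomas_smooth _ _ _ _ Asm) => // c' a' b'.
  by apply: (smooth_in_sub Asm (oU' i) oUU) => [y []//|]; exact: Cs'.
by move=> y [Uy Uy'] my iy; rewrite CE// CE'.
Qed.

Lemma thomas_tangential C i x (a b : 'I_n) :
  thomas C i x ord0 (lift ord0 a) (lift ord0 b) = C i x ord0 (lift ord0 a) (lift ord0 b).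
Proof. by rewrite thomasE !(mulr0n, mulr0) !subr0. Qed.

(** The trace corrections only affect components whose upper index equals a lower one, so this
    component is the same for all representatives and can be computed with the one attached to a
    defining function. *)
Lemma thomas_ext_tangential U C i x (a b : 'I_n) : thomas_ext U C ->
  U x -> bdry A x -> dom i x -> C i x ord0 (lift ord0 a) (lift ord0 b) = 0.
Proof.
move=> Ce Ux bx ix; have [U' [rho [C' [oU' Ux' rd Cc' CE']]]] := boundary_rep bx.
have Ce' := thomas_ext_change oU' Cc' CE'.
rewrite -thomas_tangential (thomas_ext_unique _ _ _ Ce Ce')// thomas_tangential.
exact: (conn_tangential n_gt1 Amfd gG Gflat oU' rd Cc' ltr01 CE').
Qed.

Lemma ext_class_totally_geodesic : totally_geodesic (ext_class nabla).
Proof.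
move=> U C /ext_class_thomas Ce X Y Xv Yv X0 Y0 i x Ux bx ix.
have [oU _ _] := Ce; rewrite mxE big1// => a _.
case: (unliftP ord0 a) => [a' ->|->]; last by rewrite X0// mul0r.
have -> : pd i (lift ord0 a') (fun y => Y i y 0 0) x = 0.
  apply: (tangential_pd Amfd (f := fun y => Y i y 0 0) (oU i) Ux bx ix).
    by move=> y Uy by_ iy; exact: Y0.
  by apply: (ispdP Asm (oU i) Ux ix); exact: Yv.1.
rewrite add0r big1 ?mulr0// => b _.
case: (unliftP ord0 b) => [b' ->|->]; last by rewrite Y0// mulr0.
by rewrite (thomas_ext_tangential _ _ Ce)// mul0r.
Qed.

(** The bridge to the extension theorem: the coefficients formed from the singular [nabla] are
    restrictions of functions smooth up to the boundary. *)
Lemma thomas_ext_form U C i x a : thomas_ext U C -> U x -> minterior A x -> dom i x ->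
  jet_form nabla i a x = thomas_form (thomas C) i a x.
Proof.
move=> [oU _ CE] Ux mx ix.
rewrite (levi_civita_jet_form Asm m_gt1 oI gm gG)//.
apply: (thomas_form_local Asm (W := U `&` minterior A)) => //; first exact: copenI.
by move=> y c a' b [Uy my] iy; rewrite CE.
Qed.

Lemma ext_class_form U C i x a : ext_class nabla U C -> special U C -> U x -> dom i x ->
  jet_form C i a x = thomas_form (thomas C) i a x.
Proof.
by move=> [oU Cc _] Cv Ux ix; apply: (jet_form_thomas Asm a m_gt1 _ Cc Cv) => //; exact: copen_open.
Qed.

End ProjectiveExtension.

Section ThomasForm.
Context {R : realType} {m : nat} {T : Type} (A : atlas R m T).

Lemma thomas_form_top (P : conn A) i a x r (V : 'M[R]_(1 + m, r)) v :
  (thomas_form P i a x *m V) (lshift m 0) v = - V (rshift 1 a) v.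
Proof.
rewrite mulmx_entry big_split_ord /= big_ord1 block_mxEul mxE mul0r add0r.
rewrite (bigD1 a)//= block_mxEur !mxE !eqxx mulN1r big1 ?addr0// => c ca.
by rewrite block_mxEur !mxE (negbTE ca) andbF oppr0 mul0r.
Qed.

End ThomasForm.

(** * Extension of the parallel tractors *)

Section TractorExtension.
Context {R : realType} {n : nat} {T : topologicalType} (A : atlas R n.+1 T).
Variables (p q : nat) (g : tensor2 A) (nabla : conn A).
Hypothesis n_gt1 : (1 < n)%N.
Hypothesis Amfd : manifold_with_boundary A.
Hypothesis gm : is_metric p q (minterior A) g.
Hypothesis gG : levi_civita (minterior A) g nabla.
Hypothesis Gflat : forall i x, minterior A x -> dom i x -> ricci nabla i x = 0.
Hypothesis gC : proj_compact nabla.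
Implicit Types (i j : idx A) (a b c : 'I_n.+1) (x y : T) (U : set T) (C : conn A).
Let Asm := mwb_smooth_atlas Amfd.
Let oI i : copen i (minterior A) := copen_minterior Amfd (i := i).

Local Notation thomas_ext := (thomas_ext nabla).

Definition ext_jet i x : 'cV[R]_(1 + n.+1) := mxext i (scale_jet g i) x.

Definition ext_form i x : 'M[R]_(1 + n.+1) :=
  mxext i (metric_cotractor_form g nabla i) x.

Section System.
Variables (U : set T) (C : conn A) (i : idx A).
Hypothesis Ce : thomas_ext U C.

Let oU : copen i U. Proof. by have [] := Ce. Qed.

Let w a x := thomas_form (thomas C) i a x.

Let ws a : smooth_mx i U (w a).
Proof.
have [_ Cs _] := Ce; apply: thomas_form_smooth => //.
exact: thomas_smooth.
Qed.

Let wE a x : U x -> minterior A x -> dom i x -> jet_form nabla i a x = w a x.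
Proof. move=> Ux mx ix; exact: (thomas_ext_form n_gt1 Amfd gm gG a Ce). Qed.

Let oUI := copenI oU (@oI i).

Let Uint : U `&` minterior A `<=` minterior A. Proof. by move=> y []. Qed.

Let nw a x := - w a x.

Let nws a : smooth_mx i U (nw a).
Proof.
move=> u v; apply: (@smooth_in_ext _ _ _ _ Asm i _ (fun y => - w a y u v)) => //.
  by move=> y _ _; rewrite /nw [RHS]mxE.
by apply: smooth_inN => //; exact: ws.
Qed.

(** The jet equation multiplies from the left only; a zero right coefficient brings it into the form
    of [mxext_smooth]. *)
Let zw (a : 'I_n.+1) (x : T) : 'M[R]_1 := 0.

Let zws a : smooth_mx i U (zw a).
Proof. exact: smooth_mx_cst. Qed.

Let jet_system a x : U x -> minterior A x -> dom i x ->
  mxpd i a (scale_jet g i) x (nw a x *m scale_jet g i x + scale_jet g i x *m zw a x).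
Proof.
move=> Ux mx ix; rewrite mulmx0 addr0 mulNmx -wE//.
exact: (scale_jet_deriv Asm oI gm gG Gflat).
Qed.

Lemma ext_jet_smooth_local : smooth_mx i U (ext_jet i).
Proof.
apply: (mxext_smooth Amfd oU nws zws _ jet_system).
apply: (smooth_mx_sub Amfd _ oUI Uint) => //.
exact: (scale_jet_smooth Asm oI gm).
Qed.

Lemma ext_jet_pd a x : U x -> dom i x ->
  mxpd i a (ext_jet i) x (- (w a x *m ext_jet i x)).
Proof.
move=> Ux ix; rewrite -mulNmx -[- _ *m _]addr0 -[X in _ + X](mulmx0 1 (ext_jet i x)).
apply: (mxext_pd Amfd oU nws zws _ jet_system) => //.
apply: (smooth_mx_sub Amfd _ oUI Uint) => //.
exact: (scale_jet_smooth Asm oI gm).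
Qed.

Let wts a : smooth_mx i U (fun x => (w a x)^T).
Proof. exact: smooth_mx_tr. Qed.

Let form_system a x : U x -> minterior A x -> dom i x ->
  mxpd i a (metric_cotractor_form g nabla i) x
    ((w a x)^T *m metric_cotractor_form g nabla i x +
     metric_cotractor_form g nabla i x *m w a x).
Proof.
move=> Ux mx ix; rewrite -wE//.
exact: (metric_form_deriv Asm oI gm gG Gflat).
Qed.

Lemma ext_form_smooth_local : smooth_mx i U (ext_form i).
Proof.
apply: (mxext_smooth Amfd oU wts ws _ form_system).
apply: (smooth_mx_sub Amfd _ oUI Uint) => //.
exact: (metric_form_smooth Asm oI gm gG).
Qed.

Lemma ext_form_pd a x : U x -> dom i x ->
  mxpd i a (ext_form i) x ((w a x)^T *m ext_form i x + ext_form i x *m w a x).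
Proof.
move=> Ux ix; apply: (mxext_pd Amfd oU wts ws _ form_system) => //.
apply: (smooth_mx_sub Amfd _ oUI Uint) => //.
exact: (metric_form_smooth Asm oI gm gG).
Qed.

End System.

Lemma ext_jet_smooth i : smooth_mx i setT (ext_jet i).
Proof.
apply: (smooth_mx_local Amfd) => x ix.
have [U [C [Ux Ce]]] := local_rep n_gt1 Amfd gG Gflat gC x.
by exists U; split=> //; [case: Ce|apply: ext_jet_smooth_local; exact: Ce].
Qed.

Lemma ext_form_smooth i : smooth_mx i setT (ext_form i).
Proof.
apply: (smooth_mx_local Amfd) => x ix.
have [U [C [Ux Ce]]] := local_rep n_gt1 Amfd gG Gflat gC x.
by exists U; split=> //; [case: Ce|apply: ext_form_smooth_local; exact: Ce].
Qed.

Lemma ext_jet_trans i j x : dom i x -> dom j x ->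
  ext_jet i x = jet_trans i j x *m ext_jet j x.
Proof.
move=> ix jx; have oj : copen i (dom j) by exact: sa_dom.
apply: (interior_eq_mx Amfd (F := ext_jet i)
  (G := fun y => jet_trans i j y *m ext_jet j y) oj _ _ _ jx ix).
- apply: smooth_cont_mx; apply: (smooth_mx_sub Amfd (@copenT _ _ _ _ i) oj) => //.
  exact: ext_jet_smooth.
- apply: cont_mxM; first by apply: smooth_cont_mx; exact: (jet_trans_smooth Amfd).
  by apply: (cont_mx_chart Amfd); exact: ext_jet_smooth.
move=> y jy my iy; rewrite /ext_jet !(mxext_interior Amfd)//.
by apply: (scale_jet_trans Asm oI gm).
Qed.

Lemma ext_form_trans i j x : dom i x -> dom j x ->
  ext_form j x = (jet_trans i j x)^T *m ext_form i x *m jet_trans i j x.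
Proof.
move=> ix jx; have oj : copen i (dom j) by exact: sa_dom.
have cJ : cont_mx i (dom j) (jet_trans i j) by apply: smooth_cont_mx; exact: (jet_trans_smooth Amfd).
apply: (interior_eq_mx Amfd (F := ext_form j)
  (G := fun y => (jet_trans i j y)^T *m ext_form i y *m jet_trans i j y) oj _ _ _ jx ix).
- by apply: (cont_mx_chart Amfd); exact: ext_form_smooth.
- apply: cont_mxM => //; apply: cont_mxM; first exact: cont_mx_tr.
  apply: smooth_cont_mx; apply: (smooth_mx_sub Amfd (@copenT _ _ _ _ i) oj) => //.
  exact: ext_form_smooth.
move=> y jy my iy; rewrite /ext_form !(mxext_interior Amfd)//.
by apply: (metric_form_trans Asm oI gm gG).
Qed.

Lemma ext_form_sym i x : dom i x -> (ext_form i x)^T = ext_form i x.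
Proof.
move=> ix; have oT : copen i setT by exact: copenT.
have cF : cont_mx i setT (ext_form i) by apply: smooth_cont_mx; exact: ext_form_smooth.
apply: (interior_eq_mx Amfd (F := fun y => (ext_form i y)^T) oT _ cF _ I ix); first exact: cont_mx_tr.
move=> y _ my iy; rewrite /ext_form !(mxext_interior Amfd)//.
exact: (metric_form_sym nabla gm).
Qed.

Lemma ext_form_jet i x : dom i x -> ext_form i x *m ext_jet i x = 0.
Proof.
move=> ix; have oT : copen i setT by exact: copenT.
have cF : cont_mx i setT (ext_form i) by apply: smooth_cont_mx; exact: ext_form_smooth.
have cL : cont_mx i setT (ext_jet i) by apply: smooth_cont_mx; exact: ext_jet_smooth.
apply: (interior_eq_mx Amfd (F := fun y => ext_form i y *m ext_jet i y)
  (G := fun _ => 0) oT _ _ _ I ix); first exact: cont_mxM.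
  by apply: smooth_cont_mx; exact: smooth_mx_cst.
move=> y _ my iy; rewrite /ext_form /ext_jet !(mxext_interior Amfd)//.
exact: (metric_form_scale_jet Asm oI gm gG).
Qed.

(* sigma / rho and its inverse both satisfy a linear system that is smooth up
   to the boundary, so that sigma / rho has a positive smooth extension. *)
Lemma scale_factor x : bdry A x -> exists U rho, [/\ open U, U x,
    defining_function A U rho & forall i, exists f, [/\ smooth_in i U f,
      forall y, U y -> dom i y -> f y != 0 &
      forall y, U y -> dom i y -> mext i (scale g i) y = rho y * f y]].
Proof.
move=> bx; have [U [rho [C [oU Ux rd Cc CE]]]] := boundary_rep n_gt1 Amfd gG Gflat gC bx.
exists U, rho; split=> // i.
have oUi : copen i U by exact: copen_open.
have oUI := copenI oUi (@oI i).
have [rs r0 rb _] := rd; have [Cs _ _] := Cc.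
have ss : smooth_in i (U `&` minterior A) (scale g i).
  by apply: (smooth_in_sub Asm (@oI i) oUI) => [y []//|]; exact: (scale_smooth Asm oI gm).
have rs' : smooth_in i (U `&` minterior A) rho.
  by apply: (smooth_in_sub Asm oUi oUI) => [y []//|]; exact: rs.
have rn y : U y -> minterior A y -> rho y != 0.
  by move=> Uy my; rewrite gt_eqF// (rho_gt0 rd).
have sn y : minterior A y -> dom i y -> scale g i y != 0.
  by move=> my iy; rewrite gt_eqF// (scale_gt0 gm).
have tC y a : U y -> minterior A y -> dom i y ->
    theta C i y a 0 = theta nabla i y a 0 + (rho y)^-1 * pd i a rho y.
  move=> Uy my iy; have -> : theta C i y a 0 = theta (proj_change nabla (log_grad rho)) i y a 0.
    by rewrite !mxE; congr (_ * _); apply: eq_bigr => b _; exact: CE.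
  by rewrite theta_change /log_grad [X in _ + X]mxE [X in _ * X]mxE mul1r.
pose F (u : bool) y := if u then scale g i y / rho y else rho y / scale g i y.
(* By [tC], d log (sigma / rho) = - theta nabla - d rho / rho = - theta C, which is smooth up to the
   boundary; the inverse has the opposite sign. *)
pose K a (u v : bool) y := if u == v then (if u then - theta C i y a 0 else theta C i y a 0) else 0.
have tCs a : smooth_in i U (fun y => theta C i y a 0).
  by apply: theta_smooth_in => // c a' b'; exact: Cs.
have Ks a u v : smooth_in i U (K a u v).
  case: u v => [] []; try exact: smooth_in_cst; [exact: smooth_inN|exact: tCs].
have Fs u : smooth_in i (U `&` minterior A) (F u).
  by case: u; apply: smooth_inM => //; apply: smooth_inV => // y [Uy my] iy; auto.
have FK a u y : U y -> minterior A y -> dom i y ->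
    ispd i a (F u) y (\sum_v K a u v y * F v y).
  move=> Uy my iy; rewrite big_bool /= /K.
  have ds := scale_deriv Asm oI gm gG (a := a) my iy.
  have dr := ispdP Asm (a := a) oUi Uy iy (rs i).
  case: u => /=.
    have := ispdM Asm iy ds (ispdV Asm iy (rn y Uy my) dr); congr ispd.
    by rewrite tC// /F; field; rewrite sn// rn.
  have := ispdM Asm iy dr (ispdV Asm iy (sn y my iy) ds); congr ispd.
  by rewrite tC// /F; field; rewrite rn// sn.
have Es u := mext_system_smooth Amfd oUi Ks Fs FK u.
(* The product is 1 in the interior and hence also in the limit, so the extended quotient cannot
   vanish on the boundary. *)
have sI : forall y, U y -> dom i y -> mext i (F true) y * mext i (F false) y = 1.
  apply: (interior_eq_smooth Amfd (f := fun y => mext i (F true) y * mext i (F false) y)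
    (g := fun _ => 1)) => //.
  - by apply: smooth_inM.
  - exact: smooth_in_cst.
  move=> y Uy my iy; rewrite !(mext_interior Amfd)// /F; field.
  by rewrite rn// sn.
exists (mext i (F true)); split=> //.
  move=> y Uy iy; apply/eqP => f0; have := sI y Uy iy.
  by rewrite f0 mul0r => /eqP; rewrite eq_sym oner_eq0.
move=> y Uy iy; apply: (mext_eq Amfd (g := fun y => rho y * mext i (F true) y) oUi Uy iy).
  by apply: smooth_in_wcont => //; exact: smooth_inM.
move=> z Uz mz iz; rewrite (mext_interior Amfd)// /F; field.
exact: rn.
Qed.

Lemma ext_jet_top i x : ext_jet i x (lshift n.+1 0) 0 = mext i (scale g i) x.
Proof.
rewrite mxE; congr mext; apply/funext => y.
by rewrite col_mxEu mxE eqxx mulr1n.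
Qed.

(** The top row of the parallel equation: up to the boundary, the other components of L are the
    derivatives of the extended sigma, so its boundary values reduce to those of a single
    function. *)
Lemma ext_jet_pd_top i a x : dom i x ->
  ispd i a (mext i (scale g i)) x (ext_jet i x (rshift 1 a) 0).
Proof.
move=> ix; have [U [C [Ux Ce]]] := local_rep n_gt1 Amfd gG Gflat gC x.
have := @ext_jet_pd U C i Ce a x Ux ix (lshift n.+1 0) 0.
rewrite [X in ispd _ _ _ _ X]mxE thomas_form_top opprK.
rewrite (_ : (fun _ => _) = mext i (scale g i))//.
by apply/funext => y; exact: ext_jet_top.
Qed.

Lemma ext_jet_bdry_top i x : bdry A x -> dom i x -> ext_jet i x (lshift n.+1 0) 0 = 0.
Proof.
move=> bx ix; have [U [rho [oU Ux rd /(_ i)[f [fs fn fE]]]]] := scale_factor bx.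
rewrite ext_jet_top fE//; have [_ _ rb _] := rd.
by have -> : rho x = 0; [exact/(rb x Ux)|rewrite mul0r].
Qed.

Lemma ext_jet_bdry_tangential i x (a : 'I_n) : bdry A x -> dom i x ->
  ext_jet i x (rshift 1 (lift ord0 a)) 0 = 0.
Proof.
move=> bx ix; have E := @ext_jet_pd_top i (lift ord0 a) x ix.
have oT : copen i setT by exact: copenT.
apply: (tangential_pd Amfd oT I bx ix _ E).
by move=> y _ by_ iy; rewrite -ext_jet_top ext_jet_bdry_top.
Qed.

(** Writing sigma = rho f, the normal derivative at the boundary is f d_0 rho, a product of nonzero
    factors; its sign follows from sigma being nonnegative. *)
Lemma ext_jet_bdry_normal i x : bdry A x -> dom i x ->
  0 < ext_jet i x (rshift 1 ord0) 0.
Proof.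
move=> bx ix; have [U [rho [oU Ux rd /(_ i)[f [fs fn fE]]]]] := scale_factor bx.
have oUi : copen i U by exact: copen_open.
have [rs _ rb _] := rd.
have r0 : rho x = 0 by exact/(rb x Ux).
have E := @ext_jet_pd_top i ord0 x ix.
have oT : copen i setT by exact: copenT.
rewrite lt_def; apply/andP; split.
  have dr := ispdP Asm (a := ord0) oUi Ux ix (rs i).
  have df := ispdP Asm (a := ord0) oUi Ux ix fs.
  have := ispdM Asm ix dr df; rewrite r0 mul0r addr0.
  move/(@ispd_local _ _ _ _ Asm i ord0 U _ (mext i (scale g i)) x _ oUi Ux ix).
  have h : forall y, U y -> dom i y -> rho y * f y = mext i (scale g i) y by move=> y Uy iy; rewrite fE.
  move=> /(_ h) /(ispd_unique Asm ix E) ->.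
  by rewrite mulf_neq0 ?fn// gt_eqF// (normal_rho Amfd oU rd).
apply: (normal_pd_ge0 Amfd oT I bx ix _ _ E).
  by rewrite -ext_jet_top ext_jet_bdry_top.
move=> y _ iy; have [by_|my] := pselect (bdry A y).
  by rewrite -ext_jet_top ext_jet_bdry_top.
by rewrite (mext_interior Amfd)// ltW// (scale_gt0 gm).
Qed.

Lemma ext_jet_neq0 i x : dom i x -> ext_jet i x != 0.
Proof.
move=> ix; apply/eqP => L0; have [bx|mx] := pselect (bdry A x).
  by have := ext_jet_bdry_normal bx ix; rewrite L0 mxE ltxx.
have := ext_jet_top i x; rewrite L0 mxE (mext_interior Amfd)// => s0.
by have := scale_gt0 gm mx ix; rewrite -s0 ltxx.
Qed.

End TractorExtension.

Section Selection.
Context {R : realType} {n : nat}.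

(* drop_nu deletes the component mu_0 of a cotractor (sigma, mu), and nu0 is the
   cotractor whose only non-zero component is mu_0; along the boundary it spans
   the same line as L(sigma). *)
Definition drop_nu : 'M[R]_(1 + n, 1 + (1 + n)) := block_mx 1%:M 0 0 (row_mx 0 1%:M).

Definition nu0 : 'cV[R]_(1 + (1 + n)) := col_mx 0 (col_mx 1%:M 0).

Lemma drop_nuK : drop_nu *m drop_nu^T = 1%:M.
Proof.
rewrite /drop_nu tr_block_mx mulmx_block tr_row_mx mul_row_col !trmx0 !trmx1.
by rewrite !(mulmx0, mul0mx, mulmx1, addr0, add0r) -scalar_mx_block.
Qed.

Lemma drop_nu_tr_drop_nu : drop_nu^T *m drop_nu = 1%:M - nu0 *m nu0^T.
Proof.
apply/eqP; rewrite eq_sym subr_eq; apply/eqP; rewrite /drop_nu /nu0.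
rewrite tr_block_mx mulmx_block tr_row_mx mul_col_row !tr_col_mx !mul_col_row.
rewrite !trmx0 !trmx1 !(mulmx0, mul0mx, mulmx1, mul1mx, addr0, add0r).
rewrite add_block_mx !(addr0, add0r) add_block_mx !(addr0, add0r).
by rewrite -scalar_mx_block -scalar_mx_block.
Qed.

Lemma nu0E u : nu0 u 0 = (u == rshift 1 (lshift n 0 : 'I_(1 + n)))%:R.
Proof.
rewrite /nu0; case: (fintype.split_ordP u) => v ->; first by rewrite col_mxEu mxE eq_lrshift.
rewrite col_mxEd; case: (fintype.split_ordP v) => w ->.
  by rewrite col_mxEu mxE ord1 !eqxx.
by rewrite col_mxEd mxE eq_shift eq_sym eq_lrshift.
Qed.

Lemma drop_nu_form (H : 'M[R]_(1 + (1 + n))) : H^T = H -> H *m nu0 = 0 ->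
  H = drop_nu^T *m (drop_nu *m H *m drop_nu^T) *m drop_nu.
Proof.
move=> Hs H0; have H0' : nu0^T *m H = 0.
  by rewrite -Hs -trmx_mul H0 trmx0.
rewrite !mulmxA drop_nu_tr_drop_nu mulmxBl mul1mx -[nu0 *m _ *m _]mulmxA H0' mulmx0 subr0.
by rewrite -mulmxA drop_nu_tr_drop_nu mulmxBr mulmx1 mulmxA H0 mul0mx subr0.
Qed.

Lemma drop_nu_eq0 (V : 'cV[R]_(1 + (1 + n))) : drop_nu *m V = 0 -> exists c, V = c *: nu0.
Proof.
move=> V0; exists ((nu0^T *m V) 0 0).
rewrite -[LHS]mul1mx -[1%:M](subrK (nu0 *m nu0^T)) -drop_nu_tr_drop_nu.
rewrite mulmxDl -!mulmxA V0 mulmx0 add0r.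
by rewrite {1}[nu0^T *m V]mx11_scalar mul_mx_scalar.
Qed.

End Selection.

Section NearbyEntries.
Context {R : realType} {n : nat} {T : topologicalType} (A : atlas R n.+1 T).
Hypothesis Amfd : manifold_with_boundary A.
Let Asm := mwb_smooth_atlas Amfd.

Lemma cont_mx_near r s (i : idx A) W (F : T -> 'M[R]_(r, s)) x (e : R) :
  cont_mx i W F -> W x -> dom i x -> 0 < e ->
  exists2 d : R, 0 < d & forall z, cube (crd i x) d z -> cimg i W z ->
    forall u v, `|F (prm i z) u v - F x u v| < e.
Proof.
move=> cF Wx ix e0.
have : \forall z \near within (cimg i W) (nbhs (crd i x)),
    forall uv : 'I_r * 'I_s, `|F (prm i z) uv.1 uv.2 - F x uv.1 uv.2| < e.
  apply: filter_forall => uv.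
  have /wcontP/(_ e e0)[d d0 db] := cF uv.1 uv.2 x Wx ix.
  apply/near_within_cube; exists d => // z dz Dz.
  by have := db z dz Dz; rewrite /= (sa_crdK Asm).
move/near_within_cube => [d d0 db]; exists d => // z dz Dz u v.
exact: (db z dz Dz (u, v)).
Qed.

End NearbyEntries.

(** * The form on the quotient by L(sigma) *)

Section ReducedForm.
Context {R : realType} {n : nat} {T : topologicalType} (A : atlas R n.+1 T).
Variables (p q : nat) (g : tensor2 A) (nabla : conn A).
Hypothesis n_gt1 : (1 < n)%N.
Hypothesis Amfd : manifold_with_boundary A.
Hypothesis gm : is_metric p q (minterior A) g.
Hypothesis gG : levi_civita (minterior A) g nabla.
Hypothesis Gflat : forall i x, minterior A x -> dom i x -> ricci nabla i x = 0.
Hypothesis gC : proj_compact nabla.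
Implicit Types (i j : idx A) (x y : T).
Let Asm := mwb_smooth_atlas Amfd.
Let oI i : copen i (minterior A) := copen_minterior Amfd (i := i).

Local Notation L := (ext_jet g).
Local Notation H := (ext_form g nabla).

Definition normal i x : R := L i x (rshift 1 ord0) 0.

Definition reduced_form i x : 'M[R]_(1 + n) := drop_nu *m H i x *m drop_nu^T.

(** The one-form rows of [splitting] restricted to cotractors with mu_0 = 0. Its determinant theta_0
    is what brings the normal component of L(sigma) into the determinant of the reduced form. *)
Definition frame i x : 'M[R]_(1 + n) :=
  row_mx (theta nabla i x : 'cV_(1 + n)) (col_mx 0 1%:M).

Lemma det_frame i x : \det (frame i x) = theta nabla i x 0 0.
Proof.
rewrite /frame -{1}[theta nabla i x](vsubmxK (m1 := 1) (m2 := n)) -block_mxEh det_lblock.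
by rewrite det1 mulr1 det_mx11 [LHS]mxE; congr (theta nabla i x _ _); apply: val_inj.
Qed.

Lemma reduced_form_interior i x : minterior A x -> dom i x ->
  reduced_form i x = (frame i x)^T *m inv_metric g i x *m frame i x.
Proof.
move=> mx ix; rewrite /reduced_form /ext_form (mxext_interior Amfd)//.
rewrite metric_cotractor_formE.
have E : splitting nabla i x *m drop_nu^T =
    col_mx (row_mx 1%:M 0 : 'M[R]_(1, 1 + n)) (frame i x).
  rewrite /splitting /drop_nu tr_block_mx mulmx_block tr_row_mx !trmx0 !trmx1.
  by rewrite !(mulmx0, mul0mx, mulmx1, mul1mx, addr0, add0r) block_mxEv.
have -> : drop_nu *m ((splitting nabla i x)^T *m split_metric g i x *m splitting nabla i x) *m drop_nu^T
   = (splitting nabla i x *m drop_nu^T)^T *m split_metric g i x *m (splitting nabla i x *m drop_nu^T).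
  by rewrite trmx_mul trmxK !mulmxA.
rewrite E tr_col_mx /split_metric mul_row_block !mulmx0 !add0r mul_row_col.
by rewrite mul0mx add0r.
Qed.

(** A count of weights: 1 / |det g| is scale to the power 2(n+2), while the factor scale^-2
    contributes the power -2(n+1). *)
Lemma norm_det_inv_metric i x : minterior A x -> dom i x ->
  `|\det (inv_metric g i x)| = scale g i x ^+ 2.
Proof.
move=> mx ix; have s0 := scale_gt0 gm mx ix.
have d0 := det_metric_neq0 gm mx ix.
rewrite /inv_metric detZ det_inv normrM normrX normfV normrX normrV ?unitfE//.
rewrite (gtr0_norm s0).
have -> : `|\det (g i x)|^-1 = scale g i x ^+ 2 ^+ n.+2.
  rewrite -exprM -powR_mulrn ?(ltW s0)// scaleE -powRrM.
  rewrite -powR_inv1 ?normr_ge0//; congr (_ `^ _); rewrite /dens_exp natrM.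
  have : n.+2%:R != 0 :> R by rewrite pnatr_eq0.
  by move: (n.+2%:R) => M M0; field.
rewrite exprVn [X in _ * X]exprS mulrCA mulVf ?mulr1//.
by rewrite !expf_neq0// gt_eqF.
Qed.

Lemma normal_interior i x : minterior A x -> dom i x ->
  normal i x = - theta nabla i x 0 0 * scale g i x.
Proof.
move=> mx ix; rewrite /normal /ext_jet (mxext_interior Amfd)// col_mxEd mxE.
by apply: ispd_pd => //; exact: (scale_deriv Asm oI gm gG).
Qed.

Lemma norm_det_reduced i x : minterior A x -> dom i x ->
  `|\det (reduced_form i x)| = normal i x ^+ 2.
Proof.
move=> mx ix; rewrite reduced_form_interior// !det_mulmx det_tr !normrM.
rewrite norm_det_inv_metric// det_frame normal_interior//.
by rewrite mulrAC -normrM -expr2 ger0_norm ?sqr_ge0// exprMn sqrrN.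
Qed.

Lemma reduced_form_smooth i : smooth_mx i setT (reduced_form i).
Proof.
have oT : copen i setT by exact: copenT.
apply: smooth_mxM => //; last exact: smooth_mx_cst.
apply: smooth_mxM => //; first exact: smooth_mx_cst.
exact: (ext_form_smooth n_gt1 Amfd gm gG Gflat gC).
Qed.

Lemma normal_smooth i : smooth_in i setT (normal i).
Proof. exact: (ext_jet_smooth n_gt1 Amfd gm gG Gflat gC). Qed.

(** Squaring removes the absolute value, so both sides are smooth and the interior identity
    extends. *)
Lemma det_reduced_sqr i x : dom i x -> \det (reduced_form i x) ^+ 2 = normal i x ^+ 4.
Proof.
move=> ix; have oT : copen i setT by exact: copenT.
have ds : smooth_in i setT (fun y => \det (reduced_form i y)).
  by apply: smooth_in_det => //; exact: reduced_form_smooth.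
have ns := normal_smooth i.
apply: (interior_eq_smooth Amfd (f := fun y => \det (reduced_form i y) ^+ 2)
  (g := fun y => normal i y ^+ 4) oT _ _ _ I ix).
- exact: smooth_inM.
- by do 3!(apply: smooth_inM => //).
move=> y _ my iy; have := norm_det_reduced my iy.
by move=> /(congr1 (fun t => t ^+ 2)); rewrite real_normK ?num_real// -exprM.
Qed.

Lemma normal_gt0 i x : bdry A x -> dom i x -> 0 < normal i x.
Proof. exact: (ext_jet_bdry_normal n_gt1 Amfd gm gG Gflat gC). Qed.

Lemma ext_jet_nu0 i x : bdry A x -> dom i x -> L i x = normal i x *: nu0.
Proof.
move=> bx ix; apply/matrixP => u v; rewrite !ord1 [RHS]mxE nu0E.
case: (fintype.split_ordP u) => u' ->.
  by rewrite ord1 (ext_jet_bdry_top n_gt1 Amfd gm gG Gflat gC)// eq_lrshift mulr0.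
rewrite eq_shift; case: (unliftP ord0 u') => [w ->|->].
  rewrite (ext_jet_bdry_tangential n_gt1 Amfd gm gG Gflat gC)//.
  by rewrite (_ : (_ == _) = false) ?mulr0.
by rewrite (_ : (_ == _) = true) ?mulr1.
Qed.

Lemma ext_form_nu0 i x : bdry A x -> dom i x -> H i x *m nu0 = 0.
Proof.
move=> bx ix; have := ext_form_jet n_gt1 Amfd gm gG Gflat gC ix.
rewrite ext_jet_nu0// -scalemxAr => /eqP; rewrite scaler_eq0 gt_eqF ?normal_gt0//=.
by move/eqP.
Qed.

Lemma ext_form_reduced i x : bdry A x -> dom i x ->
  H i x = drop_nu^T *m reduced_form i x *m drop_nu.
Proof.
move=> bx ix; apply: drop_nu_form; last exact: ext_form_nu0.
exact: (ext_form_sym n_gt1 Amfd gm gG Gflat gC).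
Qed.

Lemma reduced_form_sym i x : dom i x -> (reduced_form i x)^T = reduced_form i x.
Proof.
move=> ix; rewrite /reduced_form !trmx_mul trmxK mulmxA.
by rewrite (ext_form_sym n_gt1 Amfd gm gG Gflat gC).
Qed.

Lemma reduced_form_unit i x : bdry A x -> dom i x -> reduced_form i x \in unitmx.
Proof.
move=> bx ix; rewrite unitmxE unitfE -sqrf_eq0 det_reduced_sqr//.
by rewrite expf_neq0// gt_eqF// normal_gt0.
Qed.

Lemma ext_form_kernel i x (V : 'cV[R]_(1 + n.+1)) : dom i x ->
  H i x *m V = 0 -> exists c : R, V = c *: L i x.
Proof.
move=> ix; have [bx|mx] := pselect (bdry A x); last first.
  rewrite /ext_form /ext_jet !(mxext_interior Amfd)//.
  exact: (metric_form_kernel Asm oI gm gG).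
have := reduced_form_unit bx ix; rewrite ext_form_reduced//.
move: (reduced_form i x) => M Mu; rewrite -!mulmxA => /(congr1 (mulmx drop_nu)).
rewrite !mulmxA drop_nuK mul1mx mulmx0 => /(congr1 (mulmx (invmx M))).
rewrite !mulmxA mulVmx// mul1mx mulmx0 => /drop_nu_eq0[c Vc].
exists (c / normal i x); rewrite ext_jet_nu0// scalerA mulfVK//.
by rewrite gt_eqF// normal_gt0.
Qed.

Lemma reduced_form_signature_interior i x : minterior A x -> dom i x ->
  normal i x != 0 -> has_signature p q (reduced_form i x).
Proof.
move=> mx ix; rewrite normal_interior// mulf_eq0 oppr_eq0 negb_or => /andP[t0 _].
have [_ gs _] := gm.
rewrite reduced_form_interior// -[in X in _ *m X](trmxK (frame i x)).
apply: has_signature_congr; first by rewrite unitmx_tr unitmxE unitfE det_frame.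
apply: has_signature_scale; first by rewrite invr_gt0 exprn_gt0// (scale_gt0 gm).
by apply: has_signature_inv; exact: gs.
Qed.

Lemma reduced_form_signature i x : bdry A x -> dom i x ->
  has_signature p q (reduced_form i x).
Proof.
move=> bx ix; apply: has_signature_limit; first exact: reduced_form_sym.
  exact: reduced_form_unit.
move=> e e0; have oT : copen i setT by exact: copenT.
have hD := hopen_cimg Amfd oT.
have Dx : cimg i setT (crd i x) by exact: cimg_crd.
have [r r0 rb] := cont_mx_near Amfd (smooth_cont_mx (@reduced_form_smooth i)) I ix e0.
have n0 := normal_gt0 bx ix.
have cn := @smooth_in_wcont _ _ _ _ i setT _ x I ix (@normal_smooth i).
(* The approximating interior points must keep the normal component nonzero, as the interior
   computation of the signature requires. *)
have [s s0 sb] := (wcontP _ _ _).1 cn _ n0.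
have := near_up hD Dx (r := Num.min r s); rewrite lt_min r0 s0 => /(_ isT).
move=> /(@filter_ex _ _ _)[t [hz cz]].
set z := _ + _ in hz cz; have [_ mz iz zE] := cimg_interior Amfd hz.
have Dz : cimg i setT z by exact: hint_sub hz.
exists (reduced_form i (prm i z)).
  apply: reduced_form_signature_interior => //.
  have := sb z (cubeW _ cz) Dz; rewrite ge_min lexx orbT => /(_ isT) /=.
  rewrite (sa_crdK Asm)// => /ltr_normlW; rewrite ltrBlDr => nz.
  apply/eqP => z0.
  have := sb z (cubeW _ cz) Dz; rewrite ge_min lexx orbT => /(_ isT) /=.
  by rewrite z0 (sa_crdK Asm)// sub0r normrN gtr0_norm// ltxx.
move=> u v; apply: (rb z _ Dz u v); apply: cubeW cz.
by rewrite ge_min lexx.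
Qed.

End ReducedForm.

Section CongruenceInverse.
Context {R : realType} {r : nat}.

Lemma invmx_congr (Q M : 'M[R]_r) : Q \in unitmx -> M \in unitmx ->
  invmx (Q^T *m M *m Q) = invmx Q *m invmx M *m (invmx Q)^T.
Proof.
move=> Qu Mu; set X := _ *m Q; set Y := _ *m _^T.
have Xu : X \in unitmx by rewrite /X !unitmx_mul unitmx_tr Qu Mu.
have XY : X *m Y = 1%:M.
  rewrite /X /Y !mulmxA -[_ *m Q *m invmx Q]mulmxA mulmxV// mulmx1.
  by rewrite -[_ *m M *m invmx M]mulmxA mulmxV// mulmx1 -trmx_mul mulVmx// trmx1.
by rewrite -[LHS]mulmx1 -XY mulmxA mulVmx// mul1mx.
Qed.

End CongruenceInverse.

Section Intertwining.
Context {R : realType} {n : nat}.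

Lemma drop_row (r : nat) (X : 'M[R]_(1 + n, r)) : row_mx 0 1%:M *m X = dsubmx X.
Proof. by rewrite -{1}[X]vsubmxK mul_row_col mul0mx mul1mx add0r. Qed.

(* The first factor is the matrix of the projection from cotractors to boundary
   cotractors, the other two are the tractor connection forms of the ambient and of
   the boundary projective structure; the right hand side is the derivative of the
   projection. *)
Lemma intertwining (k t : R) (d : 'rV[R]_n) (u q dv : 'cV[R]_n) (P : 'M[R]_n) :
  d *m u = t%:M ->
  block_mx k%:M 0 (k *: u) k%:M *m block_mx 0 (- d) q (- P) -
  block_mx 0 (- d) (q - dv + P *m u + t *: u) (- (P + t%:M + u *m d)) *m
    block_mx k%:M 0 (k *: u) k%:M =
  block_mx (k * t)%:M 0 (k *: (dv + t *: u)) (k * t)%:M.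
Proof.
move=> du; rewrite !mulmx_block !(mulmx0, mul0mx, addr0, add0r).
rewrite !mul_scalar_mx !mul_mx_scalar -!scalemxAr -!scalemxAl.
rewrite !mulNmx !mulmxDl du mul_scalar_mx -mulmxA du mul_mx_scalar.
rewrite opp_block_mx add_block_mx; congr block_mx.
- by rewrite sub0r scalerN opprK scale_scalar_mx.
- by rewrite subrr.
- rewrite -!(scalerN, scalerBr, scalerDr); congr (_ *: _).
  by apply/matrixP => a b; rewrite !mxE; ring.
rewrite mulmxN -scale_scalar_mx -scalerDr -scalerBr; congr (_ *: _).
by move: (u *m d) (t%:M : 'M[R]_n) => X Y; apply/matrixP => a b; rewrite !mxE; ring.
Qed.

End Intertwining.

(** * The tractor metric of the boundary *)

Section BoundaryMetric.
Context {R : realType} {n : nat} {T : topologicalType} (A : atlas R n.+1 T).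
Variables (p q : nat) (g : tensor2 A) (nabla : conn A).
Hypothesis n_gt1 : (1 < n)%N.
Hypothesis Amfd : manifold_with_boundary A.
Hypothesis gm : is_metric p q (minterior A) g.
Hypothesis gG : levi_civita (minterior A) g nabla.
Hypothesis Gflat : forall i x, minterior A x -> dom i x -> ricci nabla i x = 0.
Hypothesis gC : proj_compact nabla.
Implicit Types (i j : idx A) (x y : T).
Let Asm := mwb_smooth_atlas Amfd.
Let Bsm := bdry_smooth_atlas Amfd.

Local Notation B := (bdry_atlas A).
Local Notation L := (ext_jet g).
Local Notation H := (ext_form g nabla).
Local Notation normal := (normal g).
Local Notation rform := (reduced_form g nabla).
Local Notation k := (bdry_factor L).

Let oB i : @copen _ _ _ B i (bdry A).
Proof.
by move=> x ix bx; exists 1 => // y _ iy; have [[]] := img_prm Bsm iy.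
Qed.

(** [bdry_proj] is [drop_nu], which kills the line of L, followed by this invertible change from
    ambient to boundary weights. *)
Definition factor_mx i x : 'M[R]_(1 + n) :=
  block_mx (k i x)%:M 0 (@grad _ _ _ B i (k i) x) (k i x)%:M.

Definition boundary_metric : tractor_form B := fun i x =>
  factor_mx i x *m invmx (rform i x) *m (factor_mx i x)^T.

Lemma bdry_projE i x : bdry_proj L i x = factor_mx i x *m drop_nu.
Proof.
rewrite /bdry_proj /factor_mx /drop_nu mulmx_block.
by rewrite !(mulmx0, mul0mx, mulmx1, addr0, add0r) mul_mx_row mulmx0 mulmx1.
Qed.

Lemma factor_gt0 i x : bdry A x -> dom i x -> 0 < k i x.
Proof.
by move=> bx ix; apply: powR_gt0; exact: (normal_gt0 n_gt1 Amfd gm gG Gflat gC).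
Qed.

Lemma factor_mx_unit i x : bdry A x -> dom i x -> factor_mx i x \in unitmx.
Proof.
move=> bx ix; have k0 := factor_gt0 bx ix.
by rewrite unitmxE unitfE det_lblock !det_scalar mulf_neq0// expf_neq0// gt_eqF.
Qed.

Let rform_unit i x : bdry A x -> dom i x -> rform i x \in unitmx.
Proof. exact: (reduced_form_unit n_gt1 Amfd gm gG Gflat gC). Qed.

Lemma boundary_metric_unit i x : bdry A x -> dom i x -> boundary_metric i x \in unitmx.
Proof.
move=> bx ix; rewrite /boundary_metric !unitmx_mul unitmx_tr unitmx_inv.
by rewrite factor_mx_unit// rform_unit.
Qed.

Lemma boundary_metric_induced : inverse_induced L H boundary_metric.
Proof.
move=> i x bx [ix _]; split; first exact: boundary_metric_unit.
have Ku := factor_mx_unit bx ix; have Mu := rform_unit bx ix.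
rewrite bdry_projE (ext_form_reduced n_gt1 Amfd gm gG Gflat gC)// /boundary_metric.
move: (factor_mx i x) (rform i x) Ku Mu => K M Ku Mu.
have -> : invmx (K *m invmx M *m K^T) = (invmx K)^T *m M *m invmx K.
  rewrite -{1}[K]trmxK invmx_congr ?unitmx_tr ?unitmx_inv//.
  by rewrite invmxK -trmx_inv trmxK.
rewrite trmx_mul !mulmxA -[_ *m invmx K *m K]mulmxA mulVmx// mulmx1.
by rewrite -[_ *m K^T *m _]mulmxA -trmx_mul mulVmx// trmx1 mulmx1.
Qed.

Lemma boundary_metric_signature i x : bdry A x -> dom i x ->
  has_signature p q (boundary_metric i x).
Proof.
move=> bx ix; apply: has_signature_congr; first exact: factor_mx_unit.
by apply: has_signature_inv; exact: (reduced_form_signature n_gt1 Amfd gm gG Gflat gC).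
Qed.

Lemma boundary_metric_sym i x : bdry A x -> dom i x ->
  (boundary_metric i x)^T = boundary_metric i x.
Proof. by move=> bx ix; exact: has_signature_sym (boundary_metric_signature bx ix). Qed.

Let bdry_smooth i f : smooth_in i setT f -> @smooth_in _ _ _ B i (bdry A) f.
Proof.
move=> fs; have oT : copen i setT by exact: copenT.
have := smooth_in_bdry Amfd oT fs; apply: (smooth_in_sub Bsm) => //.
exact: copen_bdry.
Qed.

Lemma factor_smooth i : @smooth_in _ _ _ B i (bdry A) (k i).
Proof.
apply: (@smooth_in_powR _ _ _ _ Bsm i (bdry A) (normal i) (n.+1%:R^-1)); first exact: oB.
  by move=> y by_ [iy _]; exact: (normal_gt0 n_gt1 Amfd gm gG Gflat gC).
by apply: bdry_smooth; exact: (normal_smooth n_gt1 Amfd gm gG Gflat gC).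
Qed.

Let scalar_smooth r i f : @smooth_in _ _ _ B i (bdry A) f ->
  @smooth_mx _ _ _ B r r i (bdry A) (fun y => (f y)%:M).
Proof.
move=> fs u v; apply: (@smooth_in_ext _ _ _ _ Bsm i _ (fun y => f y * (u == v)%:R)) => //.
  by move=> y _ _; rewrite mxE mulr_natr.
by apply: (smooth_inM Bsm) => //; exact: smooth_in_cst.
Qed.

Lemma factor_mx_smooth i : @smooth_mx _ _ _ B _ _ i (bdry A) (factor_mx i).
Proof.
have oBi := @oB i; have ks := @factor_smooth i.
have k1 : @smooth_mx _ _ _ B 1 1 i (bdry A) (fun y => (k i y)%:M) by exact: scalar_smooth.
have kn : @smooth_mx _ _ _ B n n i (bdry A) (fun y => (k i y)%:M) by exact: scalar_smooth.
have gk : @smooth_mx _ _ _ B n 1 i (bdry A) (@grad _ _ _ B i (k i)).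
  exact: (@grad_smooth _ _ _ _ Bsm i (bdry A) (k i) oBi ks).
have z : @smooth_mx _ _ _ B 1 n i (bdry A) (fun _ => 0).
  exact: (@smooth_mx_cst _ _ _ _ Bsm i (bdry A) _ _ 0 oBi).
exact (@smooth_mx_block _ _ _ B i (bdry A) _ _ _ _ _ _ _ _ oBi k1 z gk kn).
Qed.

Let rform_smooth i : @smooth_mx _ _ _ B _ _ i (bdry A) (rform i).
Proof.
by move=> u v; apply: bdry_smooth; exact: (reduced_form_smooth n_gt1 Amfd gm gG Gflat gC).
Qed.

Lemma reduced_form_bdry_smooth i : @smooth_mx _ _ _ B _ _ i (bdry A) (rform i).
Proof. exact: rform_smooth. Qed.

Lemma boundary_metric_smooth i : @smooth_mx _ _ _ B _ _ i (bdry A) (boundary_metric i).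
Proof.
have oBi := @oB i; have Ks := @factor_mx_smooth i.
apply: (smooth_mxM Bsm oBi); last exact: smooth_mx_tr.
apply: (smooth_mxM Bsm oBi Ks); apply: (smooth_mx_inv Bsm oBi) => //.
by move=> y by_ [iy _]; exact: rform_unit.
Qed.

(** Transition of ambient jets restricted to the boundary: the directions are tangential but the
    density is still the ambient one, unlike in [jet_trans] of the boundary atlas. *)
Definition bdry_jet_trans i j x : 'M[R]_(1 + n) :=
  block_mx (dens_trans i j x)%:M 0 (@grad _ _ _ B i (dens_trans i j) x)
    (dens_trans i j x *: @jac _ _ _ B i j x).

Lemma drop_nu_jet_trans i j x : bdry A x -> dom i x -> dom j x ->
  drop_nu *m jet_trans i j x = bdry_jet_trans i j x *m drop_nu.
Proof.
move=> bx ix jx; have oj : copen i (dom j) by exact: sa_dom.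
rewrite /drop_nu /jet_trans /bdry_jet_trans !mulmx_block.
rewrite !(mulmx0, mul0mx, mulmx1, mul1mx, addr0, add0r) !drop_row mul_mx_row mulmx0 mulmx1.
congr block_mx; apply/matrixP => a b.
  rewrite [LHS]mxE !mxE rshift1; apply/esym.
  by apply: (pd_bdry Amfd _ oj jx bx ix); exact: dens_trans_smooth.
rewrite [LHS]mxE scalemx_entry rshift1; case: (fintype.split_ordP (b : 'I_(1 + n))) => b' ->.
  transitivity (0 : R); last by rewrite [RHS](@row_mxEl _ n 1 n) mxE.
  by rewrite ord1 lshift0 (jac_tangential Amfd)// mulr0.
by rewrite [RHS](@row_mxEr _ n 1 n) scalemx_entry !rshift1 (jac_bdry Amfd).
Qed.

End BoundaryMetric.

Section LowerTriangular.
Context {R : realType} {n : nat}.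

Lemma mul_lower_mx (k d k' d' : R) (u v u' v' : 'I_n -> R) (J : 'M[R]_n) :
  k * d = d' * k' ->
  (forall a, u a * d + k * v a = v' a * k' + d' * \sum_b J a b * u' b) ->
  block_mx k%:M 0 (\col_a u a) k%:M *m block_mx d%:M 0 (\col_a v a) (d *: J) =
  block_mx d'%:M 0 (\col_a v' a) (d' *: J) *m block_mx k'%:M 0 (\col_a u' a) k'%:M.
Proof.
move=> kd uv0.
have uv : d *: (\col_a u a) + k *: (\col_a v a) =
    k' *: (\col_a v' a) + d' *: (J *m \col_a u' a).
  apply/matrixP => a b; rewrite ord1 {b} !addmx_entry !scalemx_entry mulmx_entry.
  have E w : (\col_a w a : 'cV[R]_n) a 0 = w a by rewrite mxE.
  rewrite !E; under eq_bigr do rewrite mxE.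
  by rewrite mulrC uv0 [k' * _]mulrC.
rewrite !mulmx_block !(mulmx0, mul0mx, addr0, add0r).
rewrite -!scalar_mxM !mul_mx_scalar !mul_scalar_mx kd uv -!scalemxAl.
by rewrite !scalerA kd [k' * d']mulrC.
Qed.

End LowerTriangular.

(** * Changes of charts for the boundary metric *)

Section BoundaryTransition.
Context {R : realType} {n : nat} {T : topologicalType} (A : atlas R n.+1 T).
Variables (p q : nat) (g : tensor2 A) (nabla : conn A).
Hypothesis n_gt1 : (1 < n)%N.
Hypothesis Amfd : manifold_with_boundary A.
Hypothesis gm : is_metric p q (minterior A) g.
Hypothesis gG : levi_civita (minterior A) g nabla.
Hypothesis Gflat : forall i x, minterior A x -> dom i x -> ricci nabla i x = 0.
Hypothesis gC : proj_compact nabla.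
Implicit Types (i j : idx A) (x y : T).
Let Asm := mwb_smooth_atlas Amfd.
Let Bsm := bdry_smooth_atlas Amfd.

Local Notation B := (bdry_atlas A).
Local Notation L := (ext_jet g).
Local Notation normal := (normal g).
Local Notation rform := (reduced_form g nabla).
Local Notation k := (bdry_factor L).

Lemma mul_nu0 r (X : 'M[R]_(r, 1 + (1 + n))) u :
  (X *m nu0) u 0 = X u (rshift 1 (lshift n 0)).
Proof.
rewrite mulmx_entry (bigD1 (rshift 1 (lshift n 0)))//= nu0E eqxx mulr1.
by rewrite big1 ?addr0// => v vn; rewrite nu0E (negbTE vn) mulr0.
Qed.

Lemma drop_congr (M J' : 'M[R]_(1 + n)) (J : 'M[R]_(1 + (1 + n))) :
  drop_nu *m J = J' *m drop_nu ->
  drop_nu *m (J^T *m (drop_nu^T *m M *m drop_nu) *m J) *m drop_nu^T =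
  J'^T *m M *m J'.
Proof.
move=> E; have Et : J^T *m drop_nu^T = drop_nu^T *m J'^T by rewrite -trmx_mul E trmx_mul.
rewrite !mulmxA -[drop_nu *m J^T *m _]mulmxA Et !mulmxA drop_nuK mul1mx.
by rewrite -[_ *m drop_nu *m J]mulmxA E !mulmxA -[_ *m drop_nu *m _]mulmxA drop_nuK mulmx1.
Qed.

Lemma normal_trans i j x : bdry A x -> dom i x -> dom j x ->
  normal i x = dens_trans i j x * jac i j x 0 0 * normal j x.
Proof.
move=> bx ix jx; rewrite -[normal i x]/(L i x (rshift 1 ord0) 0).
rewrite (ext_jet_trans n_gt1 Amfd gm gG Gflat gC ix jx).
rewrite (ext_jet_nu0 n_gt1 Amfd gm gG Gflat gC bx jx) -scalemxAr scalemx_entry.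
rewrite mul_nu0 /jet_trans mulrC; congr (_ * _).
by rewrite [LHS]block_mxEdr scalemx_entry lshift0.
Qed.

Lemma factor_trans i j x : bdry A x -> dom i x -> dom j x ->
  k i x * dens_trans i j x = @dens_trans _ _ _ B i j x * k j x.
Proof.
move=> bx ix jx; have J0 := jac_normal Amfd bx ix jx.
have d0 := dens_trans_gt0 Asm ix jx.
have n0 := normal_gt0 n_gt1 Amfd gm gG Gflat gC bx jx.
have -> : k i x = normal i x `^ n.+1%:R^-1 by [].
have -> : k j x = normal j x `^ n.+1%:R^-1 by [].
rewrite (normal_trans bx ix jx) powRM ?mulr_ge0 ?ltW// powRM ?ltW//.
rewrite mulrAC; congr (_ * _); rewrite /dens_trans (det_jac_bdry Amfd bx ix jx).
rewrite normrM (gtr0_norm J0) -powRrM.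
have D0 : 0 < `|\det (@jac _ _ _ B i j x)|.
  by rewrite normr_gt0 -unitfE -unitmxE (jac_unit Bsm).
move: (`|\det (@jac _ _ _ B i j x)|) D0 (jac i j x 0 0) J0 => D D0 J J0.
rewrite mulrAC -powRD; last by apply/implyP => _; rewrite gt_eqF// mulr_gt0.
(* This identity of weights dictates the exponent in [bdry_factor]: the ambient density and the
   power of the normal component combine to the boundary weight, and the powers of the normal
   Jacobian entry cancel. *)
have -> : - n.+2%:R^-1 * n.+1%:R^-1 + - n.+2%:R^-1 = - n.+1%:R^-1 :> R.
  have : n.+1%:R != 0 :> R by rewrite pnatr_eq0.
  have : n.+2%:R != 0 :> R by rewrite pnatr_eq0.
  by rewrite -[n.+2%:R]natr1; move: (n.+1%:R) => M M0 M1; field; rewrite M0 M1.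
rewrite powRM ?ltW// [J `^ - _]powRN mulrAC mulVf ?mul1r//.
by rewrite gt_eqF// powR_gt0.
Qed.

(** The diagonal blocks reduce to [factor_trans], the lower left one to its derivative along the
    boundary. *)
Lemma factor_mx_trans i j x : bdry A x -> dom i x -> dom j x ->
  factor_mx g i x *m bdry_jet_trans i j x =
  @jet_trans _ _ _ B i j x *m factor_mx g j x.
Proof.
move=> bx ix jx; have kd := factor_trans bx ix jx.
have ixB : @dom _ _ _ B i x by []. have jxB : @dom _ _ _ B j x by [].
have oj : copen i (dom j) by exact: sa_dom.
have ojB : @copen _ _ _ B i (dom j) by exact: copen_bdry.
have oB l : @copen _ _ _ B l (bdry A).
  by move=> z iz bz; exists 1 => // y _ iy; have [[]] := img_prm Bsm iy.
apply: mul_lower_mx => // a.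
have ks l : @smooth_in _ _ _ B l (bdry A) (k l).
  exact: (factor_smooth n_gt1 Amfd gm gG Gflat gC).
have dki := ispdP Bsm (a := a) (oB i) bx ixB (ks i).
have dkj := @chain_rule _ _ _ _ Bsm i j a (bdry A) (k j) x (oB i) (oB j) bx ixB jxB (ks j).
have ds : @smooth_in _ _ _ B i (dom j) (dens_trans i j).
  by apply: smooth_in_bdry => //; exact: dens_trans_smooth.
have dd := ispdP Bsm (a := a) ojB jx ixB ds.
have dbs := @dens_trans_smooth _ _ _ _ Bsm i j.
have ojB' : @copen _ _ _ B i (@dom _ _ _ B j) by exact: sa_dom.
have ddb := ispdP Bsm (a := a) ojB' jxB ixB dbs.
have h1 := ispdM Bsm ixB dki dd; have h2 := ispdM Bsm ixB ddb dkj.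
have := @ispd_local _ _ _ _ Bsm i a _ _ _ x _ ojB' jxB ixB _ h1.
move=> /(_ (fun y => @dens_trans _ _ _ B i j y * k j y)) h3.
have {h3} h3 := h3 (fun y jy iy => factor_trans jy.2 iy.1 jy.1).
exact: (ispd_unique Bsm ixB h3 h2).
Qed.

Lemma reduced_form_trans i j x : bdry A x -> dom i x -> dom j x ->
  rform j x = (bdry_jet_trans i j x)^T *m rform i x *m bdry_jet_trans i j x.
Proof.
move=> bx ix jx; rewrite {1}/reduced_form.
rewrite (ext_form_trans n_gt1 Amfd gm gG Gflat gC ix jx).
rewrite (ext_form_reduced n_gt1 Amfd gm gG Gflat gC bx ix).
by apply: drop_congr; exact: (drop_nu_jet_trans Amfd bx ix jx).
Qed.

Lemma boundary_metric_trans i j x : bdry A x -> dom i x -> dom j x ->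
  boundary_metric g nabla i x = @jet_trans _ _ _ B i j x *m
    boundary_metric g nabla j x *m (@jet_trans _ _ _ B i j x)^T.
Proof.
move=> bx ix jx; have E := factor_mx_trans bx ix jx.
have M := reduced_form_trans bx ix jx.
have Mi := reduced_form_unit n_gt1 Amfd gm gG Gflat gC bx ix.
have Mj := reduced_form_unit n_gt1 Amfd gm gG Gflat gC bx jx.
have Ju : bdry_jet_trans i j x \in unitmx.
  by move: Mj; rewrite M !unitmx_mul => /andP[].
rewrite /boundary_metric M invmx_congr//.
rewrite !mulmxA -E -!mulmxA -[(factor_mx g j x)^T *m _]trmx_mul -E trmx_mul.
move: (factor_mx g i x) (bdry_jet_trans i j x) Ju (rform i x) => K J Ju N.
rewrite !mulmxA -[K *m J *m invmx J]mulmxA mulmxV// mulmx1.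
by rewrite -[_ *m (invmx J)^T *m J^T]mulmxA -trmx_mul mulmxV// trmx1 mulmx1.
Qed.

End BoundaryTransition.

Section ParallelAlgebra.
Context {R : realType} {r : nat}.

(** If K intertwines the connection forms w and wb and M is parallel for w, then K M^-1 K^T is
    parallel for wb; the left side is its covariant derivative expanded by the product rule. *)
Lemma parallel_congr (K M w wb : 'M[R]_r) : M \in unitmx ->
  let iM := invmx M in let dK := K *m w - wb *m K in
  let dM := w^T *m M + M *m w in let h := K *m iM *m K^T in
  (dK *m iM + K *m (- (iM *m dM *m iM))) *m K^T + K *m iM *m dK^T +
  wb *m h + h *m wb^T = 0.
Proof.
move=> Mu /=; set iM := invmx M.
have -> : iM *m (w^T *m M + M *m w) *m iM = iM *m w^T + w *m iM.
  rewrite mulmxDr mulmxDl !mulmxA (mulVmx Mu) mul1mx.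
  by rewrite -[_ *m M *m iM]mulmxA (mulmxV Mu) mulmx1.
rewrite linearB /= !trmx_mul !(mulmxBl, mulmxBr, mulmxDl, mulmxDr, mulmxN, mulNmx) !mulmxA.
set a := K *m w *m _ *m _; set b := wb *m _ *m _ *m _; set c := K *m iM *m _ *m _.
set d := K *m iM *m _ *m _; apply/matrixP => u v; rewrite !mxE; ring.
Qed.

End ParallelAlgebra.

Section Entries.
Context {R : realType} {n : nat}.

Lemma lower_left_entry (q dv : 'I_n -> R) (M : 'I_n -> 'I_n -> R) (u : 'cV[R]_n) (t : R) b :
  ((\col_a q a) - (\col_a dv a) + (\matrix_(a, c) M a c) *m u + t *: u) b 0 =
  q b - dv b + \sum_c M b c * u c 0 + t * u b 0.
Proof. by rewrite !mxE; congr (_ + _ + _); apply: eq_bigr => c _; rewrite mxE. Qed.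

Lemma lower_right_entry (M : 'I_n -> 'I_n -> R) (u : 'cV[R]_n) (t : R) a b c :
  (- ((\matrix_(b, c) M b c) + t%:M + u *m delta_mx 0 a)) b c =
  - (M b c + t * (b == c)%:R + u b 0 * (a == c)%:R).
Proof.
by rewrite [LHS]mxE !addmx_entry mulmx_entry big_ord1 !mxE mulr_natr eqxx [c == a]eq_sym.
Qed.

End Entries.

Section ConstantCongruence.
Context {R : realType} {m : nat} {T : Type} (A : atlas R m T).
Hypothesis Asm : smooth_atlas A.

Lemma mxpd_congr_cst r s (Q : 'M[R]_(r, s)) (Q' : 'M[R]_(s, r)) (i : idx A) a
    (F : T -> 'M[R]_s) F' x : dom i x ->
  mxpd i a F x F' -> mxpd i a (fun y => Q *m F y *m Q') x (Q *m F' *m Q').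
Proof.
move=> ix dF.
have := mxpdM Asm ix (mxpdM Asm ix (mxpd_cst i a x Q) dF) (mxpd_cst i a x Q').
by rewrite mul0mx add0r mulmx0 addr0.
Qed.

End ConstantCongruence.

Section DropForm.
Context {R : realType} {n : nat}.

Lemma drop_form_deriv (M w' : 'M[R]_(1 + n)) (w : 'M[R]_(1 + (1 + n))) :
  drop_nu *m w = w' *m drop_nu ->
  drop_nu *m (w^T *m (drop_nu^T *m M *m drop_nu) + drop_nu^T *m M *m drop_nu *m w) *m drop_nu^T
  = w'^T *m M + M *m w'.
Proof.
move=> E; have Et : w^T *m drop_nu^T = drop_nu^T *m w'^T by rewrite -trmx_mul E trmx_mul.
rewrite mulmxDr mulmxDl !mulmxA; congr (_ + _).
  rewrite -[drop_nu *m w^T *m _]mulmxA Et !mulmxA drop_nuK mul1mx.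
  by rewrite -mulmxA drop_nuK mulmx1.
by rewrite drop_nuK mul1mx -[M *m _ *m w]mulmxA E mulmxA -mulmxA drop_nuK mulmx1.
Qed.

End DropForm.

Section ThomasFormBottom.
Context {R : realType} {m : nat} {T : Type} (A : atlas R m T).

Lemma thomas_form_bot (P : conn A) i a x r (V : 'M[R]_(1 + m, r)) b v :
  (thomas_form P i a x *m V) (rshift 1 b) v =
  m.-1%:R^-1 * ricci P i x a b * V (lshift m 0) v - \sum_c P i x c a b * V (rshift 1 c) v.
Proof.
rewrite mulmx_entry big_split_ord /= big_ord1 block_mxEdl [(\col__ _) _ _]mxE -sumrN.
by congr (_ + _); apply: eq_bigr => c _; rewrite block_mxEdr [(\matrix_(_, _) _) _ _]mxE mulNr.
Qed.

End ThomasFormBottom.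

(** * Compatibility of the projection with the tractor connections *)

Section BoundaryConnection.
Context {R : realType} {n : nat} {T : topologicalType} (A : atlas R n.+1 T).
Variables (p q : nat) (g : tensor2 A) (nabla : conn A).
Hypothesis n_gt1 : (1 < n)%N.
Hypothesis Amfd : manifold_with_boundary A.
Hypothesis gm : is_metric p q (minterior A) g.
Hypothesis gG : levi_civita (minterior A) g nabla.
Hypothesis Gflat : forall i x, minterior A x -> dom i x -> ricci nabla i x = 0.
Hypothesis gC : proj_compact nabla.
Implicit Types (i j : idx A) (x y : T).
Let Asm := mwb_smooth_atlas Amfd.
Let Bsm := bdry_smooth_atlas Amfd.

Local Notation B := (bdry_atlas A).
Local Notation L := (ext_jet g).
Local Notation normal := (normal g).
Local Notation rform := (reduced_form g nabla).
Local Notation k := (bdry_factor L).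
Local Notation lf := (lift ord0).

Section Local.
Variables (U : set T) (C : conn A) (i : idx A).
Hypothesis Ce : thomas_ext nabla U C.
Local Notation P := (thomas C).

Let oU : copen i U. Proof. by have [] := Ce. Qed.

Let Ps : smooth_conn i U P.
Proof. by have [_ Cs _] := Ce; exact: thomas_smooth. Qed.

Let ltop x := L i x (lshift n.+1 0) 0.
Let lbot b x := L i x (rshift 1 b) 0.

Let Ls : smooth_mx i U (L i).
Proof. exact: (@ext_jet_smooth_local _ _ _ _ _ _ _ _ n_gt1 Amfd gm gG Gflat U C i Ce). Qed.

Let ltop_pd a x : U x -> dom i x -> ispd i a ltop x (lbot a x).
Proof.
move=> Ux ix; have := @ext_jet_pd _ _ _ _ _ _ _ _ n_gt1 Amfd gm gG Gflat U C i Ce a x Ux ix (lshift n.+1 0) 0.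
by rewrite [X in ispd _ _ _ _ X]mxE thomas_form_top opprK.
Qed.

Let lbot_pd a b x : U x -> dom i x -> ispd i a (lbot b) x
  (\sum_c P i x c a b * lbot c x - n%:R^-1 * ricci P i x a b * ltop x).
Proof.
move=> Ux ix; have := @ext_jet_pd _ _ _ _ _ _ _ _ n_gt1 Amfd gm gG Gflat U C i Ce a x Ux ix (rshift 1 b) 0.
by rewrite [X in ispd _ _ _ _ X]mxE thomas_form_bot opprB.
Qed.

Let lbot_bdry b x : bdry A x -> dom i x -> lbot b x = normal i x * (ord0 == b)%:R.
Proof.
move=> bx ix; rewrite /lbot (ext_jet_nu0 n_gt1 Amfd gm gG Gflat gC bx ix) scalemx_entry.
by rewrite nu0E eq_shift -(inj_eq val_inj) eq_sym.
Qed.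

Let ltop_bdry x : bdry A x -> dom i x -> ltop x = 0.
Proof. exact: (ext_jet_bdry_top n_gt1 Amfd gm gG Gflat gC). Qed.

Let sum_lbot (F : 'I_n.+1 -> R) x : bdry A x -> dom i x ->
  \sum_c F c * lbot c x = normal i x * F ord0.
Proof.
move=> bx ix; under eq_bigr do rewrite lbot_bdry// mulrA.
by rewrite sum_delta mulrC.
Qed.

Lemma lbot_pd_bdry a b x : U x -> bdry A x -> dom i x ->
  ispd i a (lbot b) x (normal i x * P i x ord0 a b).
Proof.
move=> Ux bx ix; have := @lbot_pd a b x Ux ix.
by rewrite ltop_bdry// mulr0 subr0 sum_lbot.
Qed.

(** Third derivatives of sigma at the boundary, from differentiating the parallel equation once.
    There sigma = 0 and d sigma has only a normal component, so every term carries the factor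
    [normal]. *)
Lemma lbot_pd2 d a b x : U x -> bdry A x -> dom i x ->
  pd i d (pd i a (lbot b)) x = normal i x *
    (pd i d (fun y => P i y ord0 a b) x + \sum_c P i x c a b * P i x ord0 d c
     - n%:R^-1 * ricci P i x a b * (ord0 == d)%:R).
Proof.
move=> Ux bx ix.
have dP c := ispdP Asm (a := d) oU Ux ix (@Ps c a b).
have dR := ispdP Asm (a := d) oU Ux ix (ricci_smooth Asm a b oU Ps).
have h1 : ispd i d (fun y => \sum_c P i y c a b * lbot c y) x
    (\sum_c (pd i d (fun y => P i y c a b) x * lbot c x +
             P i x c a b * (normal i x * P i x ord0 d c))).
  by apply: ispd_sum => c _; apply: ispdM => //; exact: lbot_pd_bdry.
have h2 := ispdM Asm ix (ispdM Asm ix (@ispd_cst _ _ _ _ i d x n%:R^-1) dR) (@ltop_pd d x Ux ix).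
have := ispdB h1 h2.
move=> /(@ispd_local _ _ _ _ Asm i d U _ (pd i a (lbot b)) x _ oU Ux ix) h.
have {}h := h (fun y Uy iy => esym (ispd_pd Asm iy (@lbot_pd a b y Uy iy))).
rewrite (ispd_pd Asm ix h) big_split /= sum_lbot// ltop_bdry// mulr0 add0r lbot_bdry//.
have -> : \sum_c P i x c a b * (normal i x * P i x ord0 d c) =
    normal i x * \sum_c P i x c a b * P i x ord0 d c.
  by rewrite mulr_sumr; apply: eq_bigr => c _; rewrite mulrCA.
ring.
Qed.

(** The curvature component R_0a^0_b of [P], the summand c = 0 in the trace defining its Ricci
    tensor. *)
Let curv a b x := pd i ord0 (fun y => P i y ord0 a b) x - pd i a (fun y => P i y ord0 ord0 b) x
  + \sum_e (P i x ord0 ord0 e * P i x e a b - P i x ord0 a e * P i x e ord0 b).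

(* Differentiating the parallel section L(sigma) twice and using the symmetry of
   second derivatives along the boundary. *)
Lemma curv_ricci (a b : 'I_n) x : U x -> bdry A x -> dom i x ->
  curv (lf a) (lf b) x = n%:R^-1 * ricci P i x (lf a) (lf b).
Proof.
move=> Ux bx ix; have n0 := normal_gt0 n_gt1 Amfd gm gG Gflat gC bx ix.
have := schwarz_pd Asm ord0 (lf a) oU Ux ix (@Ls (rshift 1 (lf b)) 0).
rewrite -[fun _ => _]/(lbot (lf b)) !lbot_pd2//= mulr1 mulr0 subr0.
move/(mulfI (lt0r_neq0 n0)) => E; rewrite /curv sumrB.
have S (F G : 'I_n.+1 -> R) : \sum_e F e * G e = \sum_e G e * F e.
  by apply: eq_bigr => e _; exact: mulrC.
rewrite [\sum_e P i x ord0 ord0 e * _]S [\sum_e P i x ord0 (lf a) e * _]S.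
by move: E; set s1 := \sum_c _; set s2 := \sum_c _; lra.
Qed.

Hypothesis Csym : forall x c a b, U x -> dom i x -> C i x c a b = C i x c b a.

(** As the boundary is totally geodesic, the ambient Ricci tensor is that of the restriction plus
    the normal term [curv], which is 1/n of the total. The rest is (n-1)/n of it, so the two
    normalizations by n-1 and n agree. *)
Lemma ricci_restrict (a b : 'I_n) x : U x -> bdry A x -> dom i x ->
  (n%:R - 1)^-1 * ricci (restrict_conn P) i x a b = n%:R^-1 * ricci P i x (lf a) (lf b).
Proof.
move=> Ux bx ix.
have P0 (d e : 'I_n) : P i x ord0 (lf d) (lf e) = 0.
  rewrite thomas_tangential.
  exact: (thomas_ext_tangential n_gt1 Amfd gG Gflat gC _ _ Ce).
have : ricci P i x (lf a) (lf b) = curv (lf a) (lf b) x + ricci (restrict_conn P) i x a b.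
  rewrite [LHS]mxE [X in _ + X]mxE big_ord_recl; congr (_ + _).
  apply: eq_bigr => c _; congr (_ - _ + _).
  - apply/esym; apply: (pd_bdry Amfd _ oU Ux bx ix); exact: Ps.
  - apply/esym; apply: (pd_bdry Amfd _ oU Ux bx ix); exact: Ps.
  by rewrite big_ord_recl !P0 !mulr0 subrr add0r.
rewrite curv_ricci// => E.
have n0 : n%:R != 0 :> R by rewrite pnatr_eq0 -lt0n ltnW.
have n1 : n%:R - 1 != 0 :> R by rewrite subr_eq0 pnatr_eq1 gtn_eqF.
have -> : ricci (restrict_conn P) i x a b = (1 - n%:R^-1) * ricci P i x (lf a) (lf b).
  by move: E; set s := ricci P i x _ _; set t := ricci _ _ _ _ _; move=> E; rewrite mulrBl mul1r {1}E; ring.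
by move: (ricci P i x _ _) => r; field; rewrite n0 n1.
Qed.

(** Restricting trace-free symbols to tangential indices loses the summand with the normal index;
    this form restores a vanishing trace in dimension n. *)
Definition bdry_change : oneform B := fun j y =>
  \col_a (n.+1%:R^-1 * P j y ord0 (lf a) ord0).

Local Notation ups := (bdry_change i).
Let du a b x := @pd _ _ _ B i a (fun y => ups y b 0) x.

Let oUB : @copen _ _ _ B i U. Proof. exact: copen_bdry. Qed.

Let upsE y a : ups y a 0 = n.+1%:R^-1 * P i y ord0 (lf a) ord0.
Proof. by rewrite mxE. Qed.

(** The form correcting the trace is also d log of [bdry_factor], because the parallel equation
    gives d_a normal = normal P^0_a0 along the boundary. In particular it is closed. *)
Lemma factor_pd a y : U y -> bdry A y -> dom i y ->
  @ispd _ _ _ B i a (k i) y (k i y * ups y a 0).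
Proof.
move=> Uy by_ iy; have iyB : @dom _ _ _ B i y by [].
have n0 := normal_gt0 n_gt1 Amfd gm gG Gflat gC by_ iy.
have h := ispd_bdry Amfd by_ iy (@lbot_pd_bdry (lf a) ord0 y Uy by_ iy).
have := @ispd_powR _ _ _ _ Bsm i a (lbot ord0) y _ n.+1%:R^-1 iyB n0 h; congr (@ispd _ _ _ _ _ _ _ _ _).
rewrite upsE -[k i y]/(normal i y `^ n.+1%:R^-1).
have -> : normal i y `^ n.+1%:R^-1 = normal i y `^ (n.+1%:R^-1 - 1) * normal i y.
  rewrite -{3}[normal i y]powRr1 ?ltW// -powRD ?subrK//.
  by apply/implyP => _; rewrite gt_eqF.
by rewrite -!mulrA mulrCA; congr (_ * _); rewrite mulrCA.
Qed.

Let ups_smooth a : @smooth_in _ _ _ B i U (fun y => ups y a 0).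
Proof.
apply: (@smooth_in_ext _ _ _ _ Bsm i U (fun y => n.+1%:R^-1 * P i y ord0 (lf a) ord0)) => //.
apply: (smooth_inM Bsm oUB); first exact: smooth_in_cst.
by apply: smooth_in_bdry => //; exact: Ps.
Qed.

Lemma factor_pd2 a b x : U x -> bdry A x -> dom i x ->
  @ispd _ _ _ B i a (@pd _ _ _ B i b (k i)) x
    (k i x * ups x a 0 * ups x b 0 + k i x * du a b x).
Proof.
move=> Ux bx ix; have ixB : @dom _ _ _ B i x by [].
have h1 := @factor_pd a x Ux bx ix.
have h2 := ispdP Bsm (a := a) oUB Ux ixB (@ups_smooth b).
have h3 := ispdM Bsm ixB h1 h2.
apply: (ispd_local Bsm oUB Ux ixB _ h3) => y Uy [iy by_].
by apply/esym; apply: (ispd_pd Bsm) => //; exact: factor_pd.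
Qed.

Lemma bdry_change_closed a b x : U x -> bdry A x -> dom i x -> du a b x = du b a x.
Proof.
move=> Ux bx ix; have ixB : @dom _ _ _ B i x by [].
have oB : @copen _ _ _ B i (bdry A).
  by move=> z iz bz; exists 1 => // y _ iy; have [[]] := img_prm Bsm iy.
have k0 := factor_gt0 n_gt1 Amfd gm gG Gflat gC bx ix.
have := schwarz_pd Bsm a b oB bx ixB (factor_smooth n_gt1 Amfd gm gG Gflat gC i).
rewrite (ispd_pd Bsm ixB (@factor_pd2 a b x Ux bx ix)).
rewrite (ispd_pd Bsm ixB (@factor_pd2 b a x Ux bx ix)).
rewrite -!mulrA -!mulrDr => /(mulfI (lt0r_neq0 k0)) E.
by apply: (addrI (ups x a 0 * ups x b 0)); rewrite E mulrC.
Qed.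

Let kd a x := block_mx (k i x * ups x a 0)%:M 0
  (k i x *: ((\col_b du a b x) + ups x a 0 *: ups x)) (k i x * ups x a 0)%:M.

Let scalar_mxpd r a f x l : @ispd _ _ _ B i a f x l ->
  @mxpd _ _ _ B r r i a (fun y => (f y)%:M) x l%:M.
Proof.
move=> fl u v; rewrite [X in @ispd _ _ _ _ _ _ _ _ X]mxE.
rewrite (_ : (fun _ => _) = (fun y => f y *+ (u == v))); last by apply/funext => y; rewrite mxE.
by case: (u == v) => //=; rewrite ?mulr0n ?mulr1n//; exact: ispd_cst.
Qed.

Lemma factor_mx_pd a x : U x -> bdry A x -> dom i x ->
  @mxpd _ _ _ B _ _ i a (factor_mx g i) x (kd a x).
Proof.
move=> Ux bx ix; apply: mxpd_block.
- by apply: scalar_mxpd; exact: factor_pd.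
- exact: mxpd_cst.
- move=> b u; rewrite (_ : (fun _ => _) = @pd _ _ _ B i b (k i)); last first.
    by apply/funext => y; rewrite mxE.
  have := @factor_pd2 a b x Ux bx ix; congr (@ispd _ _ _ _ _ _ _ _ _).
  have duE : (\col_e du a e x : 'cV[R]_n) b 0 = du a b x by rewrite mxE.
  rewrite ord1 scalemx_entry addmx_entry scalemx_entry duE.
  by move: (ups x a 0) (ups x b 0) (du a b x) (k i x) => t s d l; ring.
by apply: scalar_mxpd; exact: factor_pd.
Qed.

Lemma factor_mxE x : U x -> bdry A x -> dom i x ->
  factor_mx g i x = block_mx (k i x)%:M 0 (k i x *: ups x) (k i x)%:M.
Proof.
move=> Ux bx ix; congr block_mx; apply/matrixP => a u.
rewrite ord1 scalemx_entry [LHS]mxE; apply: (ispd_pd Bsm) => //.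
exact: factor_pd.
Qed.

Definition tangential_form (a : 'I_n) x : 'M[R]_(1 + n) :=
  block_mx 0 (- delta_mx 0 a) (\col_b (n%:R^-1 * ricci P i x (lf a) (lf b)))
    (- \matrix_(b, c) P i x (lf c) (lf a) (lf b)).

(** In tangential directions the entries coupling mu_0 to the retained components vanish, since the
    boundary is totally geodesic. The connection therefore descends to the quotient by L. *)
Lemma drop_thomas_form (a : 'I_n) x : U x -> bdry A x -> dom i x ->
  drop_nu *m thomas_form P i (lf a) x = tangential_form a x *m drop_nu.
Proof.
move=> Ux bx ix; rewrite /drop_nu /thomas_form /tangential_form !mulmx_block.
rewrite !(mulmx0, mul0mx, mulmx1, mul1mx, addr0, add0r) !drop_row !mul_mx_row !mulmx0 !mulmx1.
congr block_mx.
- apply/matrixP => u v; rewrite !ord1; case: (fintype.split_ordP (v : 'I_(1 + n))) => v' ->.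
    by rewrite [RHS](@row_mxEl _ 1 1 n) ord1 lshift0 !mxE (negbTE (neq_lift _ _)) andbF oppr0.
  by rewrite [RHS](@row_mxEr _ 1 1 n) rshift1 !mxE eqxx (inj_eq lift_inj).
- by apply/matrixP => b u; rewrite [LHS]mxE [LHS]mxE [RHS]mxE rshift1.
apply/matrixP => b v; rewrite [LHS]mxE [LHS]mxE rshift1.
case: (fintype.split_ordP (v : 'I_(1 + n))) => v' ->.
  rewrite [RHS](@row_mxEl _ n 1 n) mxE ord1 lshift0 thomas_tangential.
  by rewrite (thomas_ext_tangential n_gt1 Amfd gG Gflat gC _ _ Ce)// oppr0.
by rewrite [RHS](@row_mxEr _ n 1 n) !mxE rshift1.
Qed.

Lemma reduced_form_pd a x : U x -> bdry A x -> dom i x ->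
  @mxpd _ _ _ B _ _ i a (rform i) x
    ((tangential_form a x)^T *m rform i x + rform i x *m tangential_form a x).
Proof.
move=> Ux bx ix; have Hd := @ext_form_pd _ _ _ _ _ _ _ _ n_gt1 Amfd gm gG Gflat U C i Ce (lf a) x Ux ix.
have E := drop_form_deriv (rform i x) (drop_thomas_form a Ux bx ix).
rewrite (ext_form_reduced n_gt1 Amfd gm gG Gflat gC bx ix) in Hd.
rewrite -E => u v; apply: (ispd_bdry Amfd) => //.
have Hq := @mxpd_congr_cst _ _ _ _ Asm _ _ drop_nu drop_nu^T i (lf a) _ _ x ix Hd.
exact: Hq u v.
Qed.

Section Representative.
Variables (D : conn B) (W : set T).
Hypothesis oW : @copen _ _ _ B i W.
Hypothesis WU : W `<=` U.
Hypothesis DE : forall y c a b, W y -> @dom _ _ _ B i y ->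
  thomas D i y c a b = proj_change (restrict_conn P) bdry_change i y c a b.

(** The change is by a closed form, so [ricci_change] applies, and [ricci_restrict] replaces the
    intrinsic Ricci tensor by the ambient one. The result has the shape required by
    [intertwining]. *)
Lemma thomas_form_restrict a x : W x -> bdry A x -> dom i x ->
  thomas_form (thomas D) i a x =
  block_mx 0 (- delta_mx 0 a)
    ((\col_b (n%:R^-1 * ricci P i x (lf a) (lf b))) - (\col_b du a b x) +
     (\matrix_(b, c) P i x (lf c) (lf a) (lf b)) *m ups x + ups x a 0 *: ups x)
    (- ((\matrix_(b, c) P i x (lf c) (lf a) (lf b)) + (ups x a 0)%:M + ups x *m delta_mx 0 a)).
Proof.
move=> Wx bx ix; have Ux := WU Wx; have ixB : @dom _ _ _ B i x by [].
rewrite (thomas_form_local Bsm (W := W) (P' := proj_change (restrict_conn P) bdry_change))//.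
have dP d c b e : @ispd _ _ _ B i d (fun y => restrict_conn P i y c b e) x
    (@pd _ _ _ B i d (fun y => restrict_conn P i y c b e) x).
  by apply: (ispdP Bsm oUB Ux ixB); apply: smooth_in_bdry => //; exact: Ps.
have dw d b : @ispd _ _ _ B i d (fun y => ups y b 0) x (du d b x).
  exact: (ispdP Bsm oUB Ux ixB).
have Psym c b e : restrict_conn P i x c b e = restrict_conn P i x c e b.
  by rewrite /restrict_conn !thomasE Csym//; ring.
have dws b e : du b e x = du e b x by exact: bdry_change_closed.
have n1 : n%:R - 1 != 0 :> R by rewrite subr_eq0 pnatr_eq1 gtn_eqF.
have nE : n.-1%:R = n%:R - 1 :> R by rewrite -{2}(prednK (ltnW n_gt1)) -natr1 addrK.
congr block_mx; apply/matrixP => b c.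
  rewrite ord1 [LHS]mxE (ricci_change Bsm ixB dP dw Psym dws) nE mulrBr ricci_restrict//.
  rewrite mulKf//.
  by rewrite [RHS]lower_left_entry; ring.
by rewrite [LHS]mxE [RHS]lower_right_entry.
Qed.

Lemma factor_mx_intertwining a x : W x -> bdry A x -> dom i x ->
  @mxpd _ _ _ B _ _ i a (factor_mx g i) x
   (factor_mx g i x *m tangential_form a x - thomas_form (thomas D) i a x *m factor_mx g i x).
Proof.
move=> Wx bx ix; have Ux := WU Wx.
rewrite thomas_form_restrict// factor_mxE// intertwining; first exact: factor_mx_pd.
by rewrite -rowE; apply/matrixP => u v; rewrite !ord1 !mxE mulr1n.
Qed.

Lemma boundary_metric_parallel_at a x : W x -> bdry A x -> dom i x ->
  @pdmx _ _ _ B _ _ i a (boundary_metric g nabla i) x +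
  thomas_form (thomas D) i a x *m boundary_metric g nabla i x +
  boundary_metric g nabla i x *m (thomas_form (thomas D) i a x)^T = 0.
Proof.
move=> Wx bx ix; have Ux := WU Wx; have ixB : @dom _ _ _ B i x by [].
have oB : @copen _ _ _ B i (bdry A).
  by move=> z iz bz; exists 1 => // y _ iy; have [[]] := img_prm Bsm iy.
have dK := @factor_mx_intertwining a x Wx bx ix.
have dM := @reduced_form_pd a x Ux bx ix.
have Mu y : bdry A y -> @dom _ _ _ B i y -> rform i y \in unitmx.
  by move=> by_ [iy _]; exact: (reduced_form_unit n_gt1 Amfd gm gG Gflat gC).
have Ms : @smooth_mx _ _ _ B _ _ i (bdry A) (rform i).
  exact: (reduced_form_bdry_smooth n_gt1 Amfd gm gG Gflat gC).
have dI := mxpd_inv Bsm oB bx ixB Mu Ms dM.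
have := mxpdM Bsm ixB (mxpdM Bsm ixB dK dI) (mxpd_tr dK).
move/(mxpd_pdmx Bsm ixB) => ->.
exact: parallel_congr (Mu x bx ixB).
Qed.

End Representative.

End Local.

End BoundaryConnection.

(** * The canonical metric and its uniqueness *)

Section CanonicalMetric.
Context {R : realType} {n : nat} {T : topologicalType} (A : atlas R n.+1 T).
Variables (p q : nat) (g : tensor2 A) (nabla : conn A).
Hypothesis n_gt1 : (1 < n)%N.
Hypothesis Amfd : manifold_with_boundary A.
Hypothesis gm : is_metric p q (minterior A) g.
Hypothesis gG : levi_civita (minterior A) g nabla.
Hypothesis Gflat : forall i x, minterior A x -> dom i x -> ricci nabla i x = 0.
Hypothesis gC : proj_compact nabla.
Implicit Types (i j : idx A) (x y : T).
Let Asm := mwb_smooth_atlas Amfd.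
Let Bsm := bdry_smooth_atlas Amfd.

Local Notation B := (bdry_atlas A).
Local Notation lf := (lift ord0).
Local Notation h := (boundary_metric g nabla).

Lemma thomas_restrict (C : conn A) i y c a b :
  thomas (restrict_conn C) i y c a b =
  proj_change (restrict_conn (thomas C)) (bdry_change C) i y c a b.
Proof.
rewrite thomasE /proj_change /restrict_conn thomasE.
(* The difference between the ambient trace divided by n+2 and the tangential trace divided by
   n+1. *)
have cE d : bdry_change C i y d 0 = theta C i y (lf d) 0 -
    @theta _ _ _ B (restrict_conn C) i y d 0.
  rewrite [LHS]mxE thomasE mulr1 mulr0 subr0.
  have -> : @theta _ _ _ B (restrict_conn C) i y d 0 =
      n.+1%:R^-1 * \sum_e C i y (lf e) (lf d) (lf e) by rewrite mxE.
  have -> : theta C i y (lf d) 0 = n.+2%:R^-1 *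
      (C i y ord0 (lf d) ord0 + \sum_e C i y (lf e) (lf d) (lf e)).
    by rewrite mxE big_ord_recl.
  have : n.+1%:R != 0 :> R by rewrite pnatr_eq0.
  have : n.+2%:R != 0 :> R by rewrite pnatr_eq0.
  by rewrite -[n.+2%:R]natr1; move: (n.+1%:R) => M M0 M1; field; rewrite M0 M1.
rewrite !cE !(inj_eq lift_inj).
by move: (b == c)%:R (a == c)%:R => s t; ring.
Qed.

Lemma boundary_metric_parallel : tractor_form_parallel (bdry_class (ext_class nabla)) h.
Proof.
move=> U D [oU Dc DE] Dv i x a Ux [ix bx]; have ixB : @dom _ _ _ B i x by [].
have oUB : @copen _ _ _ B i U by apply: (copen_bdry Amfd); apply: (copen_open Amfd).
rewrite (jet_form_thomas Bsm a n_gt1 oUB Dc Dv Ux ixB).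
have [U' [C [Cc Ux' [w _ CD]]]] := DE x Ux bx.
have [oU' [_ Csym _] _] := Cc.
have oUB' : @copen _ _ _ B i (U `&` U').
  by apply: copenI => //; apply: (copen_bdry Amfd); apply: (copen_open Amfd).
have Ce := ext_class_thomas Amfd Cc.
have sub : U `&` U' `<=` U' by move=> y [].
have CD' y c a' b' : (U `&` U') y -> @dom _ _ _ B i y ->
    thomas D i y c a' b' = proj_change (restrict_conn (thomas C)) (bdry_change C) i y c a' b'.
  move=> Uy iy; rewrite -thomas_restrict -(thomas_change (restrict_conn C) w).
  by apply: thomas_pointwise => c' a'' b''; exact: CD.
apply: (boundary_metric_parallel_at n_gt1 Amfd gm gG Gflat gC Ce _ oUB' sub CD') => //.
by move=> y c a' b' Uy iy; exact: Csym.
Qed.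

Lemma boundary_metric_tractor : parallel_tractor_metric (ext_class nabla) p q h.
Proof.
split; last exact: boundary_metric_parallel.
- split.
  + by move=> i; exact: (boundary_metric_smooth n_gt1 Amfd gm gG Gflat gC).
  + by move=> i x bx [ix _]; exact: (boundary_metric_sym n_gt1 Amfd gm gG Gflat gC).
  by move=> i j x [bx [ix _] [jx _]]; exact: (boundary_metric_trans n_gt1 Amfd gm gG Gflat gC).
by move=> i x bx [ix _]; exact: (boundary_metric_signature n_gt1 Amfd gm gG Gflat gC).
Qed.

Lemma ext_jet_extends : extends_L g (ext_jet g).
Proof.
split; last by move=> i x mx ix; rewrite /ext_jet (mxext_interior Amfd).
split; first by move=> i; exact: (ext_jet_smooth n_gt1 Amfd gm gG Gflat gC).
by move=> i j x [_ ix jx]; exact: (ext_jet_trans n_gt1 Amfd gm gG Gflat gC).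
Qed.

Lemma ext_form_extends : extends_form g nabla (ext_form g nabla).
Proof.
split; last by move=> i x mx ix; rewrite /ext_form (mxext_interior Amfd).
split.
- by move=> i; exact: (ext_form_smooth n_gt1 Amfd gm gG Gflat gC).
- by move=> i x _ ix; exact: (ext_form_sym n_gt1 Amfd gm gG Gflat gC).
by move=> i j x [_ ix jx]; exact: (ext_form_trans n_gt1 Amfd gm gG Gflat gC).
Qed.

Lemma ext_jet_parallel : cotractor_parallel (ext_class nabla) (ext_jet g).
Proof.
move=> U C Cc Cv i x a Ux ix; rewrite (ext_class_form n_gt1 Amfd a Cc Cv)//.
have Ce := ext_class_thomas Amfd Cc.
have d := @ext_jet_pd _ _ _ _ _ _ _ _ n_gt1 Amfd gm gG Gflat U C i Ce a x Ux ix.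
by rewrite (mxpd_pdmx Asm ix d) addNr.
Qed.

Lemma ext_form_parallel : cotractor_form_parallel (ext_class nabla) (ext_form g nabla).
Proof.
move=> U C Cc Cv i x a Ux ix; rewrite (ext_class_form n_gt1 Amfd a Cc Cv)//.
have Ce := ext_class_thomas Amfd Cc.
have d := @ext_form_pd _ _ _ _ _ _ _ _ n_gt1 Amfd gm gG Gflat U C i Ce a x Ux ix.
by rewrite (mxpd_pdmx Asm ix d) -addrA -opprD subrr.
Qed.

Lemma boundary_metric_canonical : canonical_metric g nabla h.
Proof.
exists (ext_jet g), (ext_form g nabla); split.
- exact: ext_jet_extends.
- exact: ext_jet_parallel.
- by move=> i x ix; exact: (ext_jet_neq0 n_gt1 Amfd gm gG Gflat gC).
- by move=> i x bx ix; exact: (ext_jet_bdry_top n_gt1 Amfd gm gG Gflat gC).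
split; [exact: ext_form_extends|exact: ext_form_parallel| |].
  move=> i x ix V; split; first exact: (ext_form_kernel n_gt1 Amfd gm gG Gflat gC).
  move=> [c ->]; rewrite -scalemxAr.
  by rewrite (ext_form_jet n_gt1 Amfd gm gG Gflat gC)// scaler0.
exact: (boundary_metric_induced n_gt1 Amfd gm gG Gflat gC).
Qed.

Lemma right_inverse_inj r s (K : 'M[R]_(r, s)) (K' : 'M[R]_(s, r)) (M N : 'M[R]_r) :
  K *m K' = 1%:M -> K^T *m M *m K = K^T *m N *m K -> M = N.
Proof.
move=> KK E; have KK' : K'^T *m K^T = 1%:M by rewrite -trmx_mul KK trmx1.
have : K'^T *m (K^T *m M *m K) *m K' = K'^T *m (K^T *m N *m K) *m K' by rewrite E.
by rewrite !mulmxA KK' !mul1mx -!mulmxA KK !mulmx1.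
Qed.

(** L and H are continuous and prescribed in the interior, hence determined on the boundary; the
    projection has a right inverse, so the induced form, and with it its inverse, is determined as
    well. *)
Lemma canonical_metric_unique (h' : tractor_form B) : canonical_metric g nabla h' ->
  forall i x, bdry A x -> dom i x -> h' i x = h i x.
Proof.
move=> [L [H [[[Ls _] LE] _ _ _ [[[Hs _ _] HE] _ _ Hh]]]] i x bx ix.
have oT j : copen j setT by exact: copenT.
have cont r s j (F : T -> 'M[R]_(r, s)) : smooth_mx j setT F -> cont_mx j setT F.
  exact: smooth_cont_mx.
have EL j y : dom j y -> L j y = ext_jet g j y.
  move=> jy; apply: (interior_eq_mx Amfd (F := L j) (G := ext_jet g j) (oT j) _ _ _ I jy).
  - exact/cont/Ls.
  - by apply: cont; exact: (ext_jet_smooth n_gt1 Amfd gm gG Gflat gC).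
  by move=> z _ mz jz; rewrite LE// /ext_jet (mxext_interior Amfd).
have EH : H i x = ext_form g nabla i x.
  apply: (interior_eq_mx Amfd (F := H i) (G := ext_form g nabla i) (oT i) _ _ _ I ix).
  - exact/cont/Hs.
  - by apply: cont; exact: (ext_form_smooth n_gt1 Amfd gm gG Gflat gC).
  by move=> z _ mz iz; rewrite HE// /ext_form (mxext_interior Amfd).
have ixB : @dom _ _ _ B i x by [].
(* Equality on the whole chart domain is required, because the projection also contains the gradient
   of this factor. *)
have Ek y : dom i y -> bdry_factor L i y = bdry_factor (ext_jet g) i y.
  by move=> iy; rewrite /bdry_factor EL.
have gE (f f' : T -> R) : (forall y, dom i y -> f y = f' y) ->
    @grad _ _ _ B i f x = @grad _ _ _ B i f' x.
  move=> ff; apply/matrixP => a u; rewrite [LHS]mxE [RHS]mxE.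
  apply: (pd_local Bsm a (W := setT)) => //; first exact: copenT.
  by move=> y _ [iy _]; exact: ff.
have EK : bdry_proj L i x = bdry_proj (ext_jet g) i x.
  by rewrite /bdry_proj (Ek x ix) (gE _ _ Ek).
have [hu' hE'] := Hh i x bx ixB.
have [hu hE] := boundary_metric_induced n_gt1 Amfd gm gG Gflat gC bx ixB.
rewrite -[LHS]invmxK -[RHS]invmxK; congr invmx.
have Ku := factor_mx_unit n_gt1 Amfd gm gG Gflat gC bx ix.
apply: (@right_inverse_inj _ _ (bdry_proj (ext_jet g) i x) (drop_nu^T *m invmx (factor_mx g i x))).
  by rewrite bdry_projE -mulmxA [drop_nu *m _]mulmxA drop_nuK mul1mx mulmxV.
by move: hE'; rewrite EK EH => <-; exact: hE.
Qed.

End CanonicalMetric.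

Theorem theorem3p9 (R : realType) (n p q : nat) (T : topologicalType)
    (A : atlas R n.+1 T) (g : tensor2 A) (nabla : conn A)
    (n_gt1 : (1 < n)%N) (pqE : (p + q)%N = n.+1)
    (A_mfd : manifold_with_boundary A)
    (g_metric : is_metric p q (minterior A) g)
    (g_conn : levi_civita (minterior A) g nabla)
    (g_ricci_flat : forall i x, minterior A x -> dom i x -> ricci nabla i x = 0)
    (g_compact : proj_compact nabla) :
  [/\ proj_compact_order 1 nabla,
      bdry A !=set0 ->
        forall alpha : R, 0 < alpha -> proj_compact_order alpha nabla ->
        alpha = 1,
      totally_geodesic (ext_class nabla)
    & exists h : tractor_form (bdry_atlas A),
        [/\ canonical_metric g nabla h,
            parallel_tractor_metric (ext_class nabla) p q h
          & forall h' : tractor_form (bdry_atlas A),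
              canonical_metric g nabla h' ->
              forall i x, bdry A x -> dom i x -> h' i x = h i x]].
Proof.
split.
- exact: (compact_order1 n_gt1 A_mfd g_conn g_ricci_flat g_compact).
- move=> b0 alpha a0.
  exact: (compact_order_unique n_gt1 A_mfd g_conn g_ricci_flat b0 a0).
- exact: (ext_class_totally_geodesic n_gt1 A_mfd g_conn g_ricci_flat g_compact).
exists (boundary_metric g nabla); split.
- exact: (boundary_metric_canonical n_gt1 A_mfd g_metric g_conn g_ricci_flat g_compact).
- exact: (boundary_metric_tractor n_gt1 A_mfd g_metric g_conn g_ricci_flat g_compact).
move=> h' hh i x bx [ix _].
exact: (canonical_metric_unique n_gt1 A_mfd g_metric g_conn g_ricci_flat g_compact hh).
Qed.
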